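(* Let $E$ be a Hermite-Biehler function with phase $\varphi$ and let $\nu\ge2$ be an integer. Assume that differentiation defines a bounded operator on $\mathcal{H}(E^\nu)$ with norm $\mathcal{D}$. Then: (1) For all real $x$, $\varphi'(x)\le\mathcal{D}\sqrt{\nu}$. (2) The zeros of $E$ are separated from the real axis; that is, if $E(x-iy)=0$ for $x,y\in\mathbb{R}$, then $y\ge\dfrac{1}{\mathcal{D}\sqrt{\nu}}$.
   Context: $\mathbb{C}^+=\{z:\operatorname{Im} z>0\}$. For entire $F$, $F^*(z)=\overline{F(\overline z)}$. A Hermite-Biehler function is an entire function $E$ with $|E^*(z)|<|E(z)|$ for all $z\in\mathbb{C}^+$ (then so is $E^\nu$). A function analytic in $\mathbb{C}^+$ has bounded type if it is a quotient of two bounded analytic functions in $\mathbb{C}^+$; its mean type is $v(F)=\limsup_{y\to\infty}y^{-1}\log|F(iy)|$. The de Branges space $\mathcal{H}(E)$ is the Hilbert space of entire $F$ with $\|F\|_E^2=\int_{\mathbb{R}}|F(x)|^2|E(x)|^{-2}dx<\infty$ such that $F/E$ and $F^*/E$ have bounded type and non-positive mean type in $\mathbb{C}^+$. The phase $\varphi$ of $E$ is an analytic function in a neighborhood of $\mathbb{R}$ with $e^{i\varphi(x)}E(x)\in\mathbb{R}$ for all real $x$; one has $\varphi'(x)=\operatorname{Re}(iE'(x)/E(x))>0$. *)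

(* Defs.v *)
From HB Require Import structures.
From mathcomp Require Import all_boot all_order all_algebra.
From mathcomp Require Import complex.
From mathcomp Require Import all_classical all_reals all_analysis.

Set Implicit Arguments.
Unset Strict Implicit.
Unset Printing Implicit Defensive.

Import Order.TTheory GRing.Theory Num.Theory.
Import numFieldNormedType.Exports.

Local Open Scope classical_set_scope.
Local Open Scope complex_scope.
Local Open Scope ring_scope.

(* R[i] as a normed space over itself, so that [derivable] and [derive1] are
   complex differentiability and the complex derivative. *)
HB.instance Definition _ (R : rcfType) := NormedModule.copy R[i] R[i]^o.

Section DeBranges.
Variable R : realType.
Local Notation C := R[i].
Implicit Types E F G phi : C -> C.

Definition holomorphic_on (U : set C) F :=
  forall z, U z -> derivable F z 1.

Definition entire F := holomorphic_on setT F.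

Definition upper_half_plane : set C := [set z | 0 < complex.Im z].

Definition star F : C -> C := fun z => ((F z^*)^*).

Definition hermite_biehler E :=
  entire E /\ forall z, upper_half_plane z -> `|star E z| < `|E z|.

(* The quotient [G = P / Q] is required where [Q] does not vanish; as [Q] is
   not identically zero, this is the identity of meromorphic functions. *)
Definition bounded_type G :=
  holomorphic_on upper_half_plane G /\
  exists P Q : C -> C,
    [/\ holomorphic_on upper_half_plane P /\ holomorphic_on upper_half_plane Q,
        exists M : R, forall z, upper_half_plane z ->
          `|P z| <= M%:C /\ `|Q z| <= M%:C,
        exists2 z, upper_half_plane z & Q z != 0 &
        forall z, upper_half_plane z -> Q z != 0 -> G z = P z / Q z].

(* [lne] sends 0 to [-oo], so the mean type of the zero function is [-oo]. *)
Definition mean_type G : \bar R :=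
  limf_esup (fun y : R =>
    ((y^-1)%:E * lne (ComplexField.Normc.normc (G (y *i)))%:E)%E) +oo_R.

(* At the real zeros of [E] the integrand is 0 by the convention x / 0 = 0;
   these zeros form a countable set. *)
Definition sqnorm E F : \bar R :=
  (\int[lebesgue_measure]_(x in [set: R])
     ((ComplexField.Normc.normc (F x%:C) /
       ComplexField.Normc.normc (E x%:C)) ^+ 2)%:E)%E.

Definition de_Branges E F :=
  [/\ entire F,
      (sqnorm E F < +oo)%E,
      bounded_type (fun z => F z / E z),
      bounded_type (fun z => star F z / E z) &
      (mean_type (fun z => F z / E z)%R <= 0)%E /\
      (mean_type (fun z => star F z / E z)%R <= 0)%E].

Definition dB_norm E F : R := Num.sqrt (fine (sqnorm E F)).

Definition bounded_differentiation E :=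
  (forall F, de_Branges E F -> de_Branges E (derive1 F)) /\
  exists M : R, forall F, de_Branges E F ->
    dB_norm E (derive1 F) <= M * dB_norm E F.

Definition differentiation_norm E : R :=
  sup [set dB_norm E (derive1 F) |
        F in [set F | de_Branges E F /\ dB_norm E F <= 1]].

(* The phase is real on the real line, where [exp (i phi)] is then
   [cos phi + i sin phi]. *)
Definition is_phase E phi :=
  (exists U : set C, [/\ open U, forall x : R, U x%:C & holomorphic_on U phi]) /\
  forall x : R,
    complex.Im (phi x%:C) = 0 /\
    complex.Im ((cos (complex.Re (phi x%:C)) +i* sin (complex.Re (phi x%:C)))
                * E x%:C) = 0.

End DeBranges.

(* Main.v *)
(* Write Theta = E^* / E and T(z) = Theta(x + z) / Theta(x), with T'(0) = i tau.
   On the line T = e^(2 i (phi(x + .) - phi(x))), so that tau = 2 phi'(x), and both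
   parts follow from tau <= 2 D sqrt nu.

   For G in H(B), B = E^nu, the reproducing kernel of H(B) gives
   |G(x)|^2 <= |B(x)|^2 ||G||^2 nu tau / (2 pi).  It is applied to G = F', where
   F = c E^(nu - 2) S^2 / (z - x) and S = i (conj(E(x)) E - E(x) E^* ) vanishes at x.
   On the line |F / B| <= 2 c |E(x)|^2 |1 - T(z - x)| / |z - x|, whose square integral
   is a multiple of tau, and c makes ||F|| <= 1, hence ||F'|| <= D; on the other hand
   F'(x) = c E(x)^(nu - 2) S'(x)^2 is of order tau^2.  This bounds tau.
   If E(x - i y) = 0, then |T(s)| <= |(s - i y) / (s + i y)| in the half-plane, and
   letting s tend to 0 vertically gives tau >= 2 / y.

   The kernel inequality integrates G / B and its reflection against the kernel;
   residues are replaced by integrals over half-plane contours avoiding the pole, and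
   functions of bounded type and non-positive mean type are controlled by
   Phragmen-Lindelof.  This requires E to have no real zeros.  If E(a) = 0 and E does not
   vanish on (a, b], then F = E^(nu - 1) K, with K the reproducing kernel of H(E) at i,
   has |F / B| bounded below on (a, b], so that F' / F is square integrable there,
   which is incompatible with F(a) = 0. *)

From HB Require Import structures.
Require Import Defs.
From mathcomp Require Import all_boot all_order all_algebra.
From mathcomp Require Import complex.
From mathcomp Require Import all_classical all_reals all_analysis.
From mathcomp Require Import measurable_realfun.
From mathcomp Require Import ring lra.

Set Implicit Arguments.
Unset Strict Implicit.
Unset Printing Implicit Defensive.

Import Order.TTheory GRing.Theory Num.Theory.
Import numFieldNormedType.Exports.

Local Open Scope classical_set_scope.
Local Open Scope complex_scope.
Local Open Scope ring_scope.

(** The square in S^2 makes the estimate close. One factor S supplies the square integral on the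
    line and the other is merely bounded, yet F has a simple zero at x, so F'(x) contains S'(x)
    twice. The exponent nu - 2 is where nu >= 2 enters. In numbers, ||F||^2 <= 8 pi tau c^2
    |E(x)|^4; normalising this to 1 and inserting |F'(x)| = |c| |E(x)|^(nu + 2) tau^2 into the
    kernel inequality leaves pi tau^3 / 2 <= 2 pi nu tau D^2, that is tau^2 <= 4 nu D^2.

    The obstacle in the kernel inequality is that G / B has no pointwise bound on large arcs, so
    contours cannot be closed with it. A multiplier first makes it integrable on the line. The
    primitive of an integrable function is bounded on the line, and Phragmen-Lindelof carries that
    bound into the half-plane; after an integration by parts the integrand is the primitive over
    z^2, which decays fast enough for contours. *)

Local Notation nrm := ComplexField.Normc.normc.
Local Notation Re := complex.Re.
Local Notation Im := complex.Im.

(** * Complex differentiability *)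

Section ComplexBasics.
Variable R : realType.
Local Notation C := R[i].
Implicit Types (z w a b l : C) (f g : C -> C).

Lemma le_of_eq (x y : R) : x = y -> x <= y.
Proof. by move=> ->. Qed.

Lemma normCE z : `|z| = (nrm z)%:C.
Proof. by rewrite normc_def; case: z. Qed.

Lemma nrm_ge0 z : 0 <= nrm z.
Proof. by case: z => x y; apply: sqrtr_ge0. Qed.

Lemma nrmM z w : nrm (z * w) = nrm z * nrm w.
Proof. exact: ComplexField.Normc.normcM. Qed.

Lemma nrmV z : nrm z^-1 = (nrm z)^-1.
Proof. exact: ComplexField.Normc.normcV. Qed.

Lemma nrm_div z w : nrm (z / w) = nrm z / nrm w.
Proof. by rewrite nrmM nrmV. Qed.

Lemma nrmD z w : nrm (z + w) <= nrm z + nrm w.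
Proof. by have := ler_normD z w; rewrite !normCE -rmorphD /= lecR. Qed.

Lemma nrmN z : nrm (- z) = nrm z.
Proof. by apply: complexI; rewrite -!normCE normrN. Qed.

Lemma nrmB z w : nrm (z - w) <= nrm z + nrm w.
Proof. by rewrite -(nrmN w) nrmD. Qed.

Lemma nrm_sub z w : nrm z - nrm w <= nrm (z - w).
Proof. by rewrite lerBlDr -{1}(subrK w z) nrmD. Qed.

Lemma nrm_distC z w : nrm (z - w) = nrm (w - z).
Proof. by rewrite -nrmN opprB. Qed.

Lemma nrm0 : nrm (0 : C) = 0.
Proof. exact: ComplexField.Normc.normc0. Qed.

Lemma nrm1 : nrm (1 : C) = 1.
Proof. exact: ComplexField.Normc.normc1. Qed.

Lemma nrm_eq0 z : (nrm z == 0) = (z == 0).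
Proof.
apply/eqP/eqP => [|->]; last exact: nrm0.
exact: ComplexField.Normc.eq0_normc.
Qed.

Lemma nrm_gt0 z : (0 < nrm z) = (z != 0).
Proof. by rewrite lt_neqAle nrm_ge0 andbT eq_sym nrm_eq0. Qed.

Lemma nrmX z n : nrm (z ^+ n) = nrm z ^+ n.
Proof. by elim: n => [|n IH]; rewrite ?expr0 ?nrm1 // !exprS nrmM IH. Qed.

Lemma nrmR (x : R) : nrm x%:C = `|x|.
Proof. by rewrite /= expr0n /= addr0 sqrtr_sqr. Qed.

Lemma nrmi : nrm ('i : C) = 1.
Proof. by rewrite /= expr0n expr1n add0r sqrtr1. Qed.

Lemma nrm_conj z : nrm z^* = nrm z.
Proof. by apply: complexI; rewrite -!normCE normcJ. Qed.

Lemma nrm_sqr z : nrm z ^+ 2 = Re z ^+ 2 + Im z ^+ 2.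
Proof. by case: z => x y /=; rewrite sqr_sqrtr // addr_ge0 ?sqr_ge0. Qed.

Lemma Re_le_nrm z : `|Re z| <= nrm z.
Proof.
rewrite -(@ler_pXn2r _ 2) ?nnegrE ?nrm_ge0 // nrm_sqr real_normK ?num_real //.
by rewrite lerDl sqr_ge0.
Qed.

Lemma Im_le_nrm z : `|Im z| <= nrm z.
Proof.
rewrite -(@ler_pXn2r _ 2) ?nnegrE ?nrm_ge0 // nrm_sqr real_normK ?num_real //.
by rewrite lerDr sqr_ge0.
Qed.

Lemma nrm_le_ReIm z : nrm z <= `|Re z| + `|Im z|.
Proof.
rewrite -(@ler_pXn2r _ 2) ?nnegrE ?nrm_ge0 ?addr_ge0 // nrm_sqr.
rewrite -[Re z ^+ 2]real_normK ?num_real // -[Im z ^+ 2]real_normK ?num_real //.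
by have := normr_ge0 (Re z); have := normr_ge0 (Im z); nra.
Qed.

Lemma ReM z w : Re (z * w) = Re z * Re w - Im z * Im w.
Proof. by case: z; case: w. Qed.
Lemma ImM z w : Im (z * w) = Re z * Im w + Im z * Re w.
Proof. by case: z; case: w. Qed.
Lemma ReD z w : Re (z + w) = Re z + Re w.
Proof. by case: z; case: w. Qed.
Lemma ImD z w : Im (z + w) = Im z + Im w.
Proof. by case: z; case: w. Qed.
Lemma ReN z : Re (- z) = - Re z. Proof. by case: z. Qed.
Lemma ImN z : Im (- z) = - Im z. Proof. by case: z. Qed.
Definition ReIm := (ReM, ImM, ReD, ImD, ReN, ImN).

Lemma complex_eqP z w : Re z = Re w -> Im z = Im w -> z = w.
Proof. by case: z; case: w => ? ? ? ? /= -> ->. Qed.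

(** The norm of [R[i]] takes its values in [R[i]] itself; this characterisation lets all estimates
    use real radii. *)
Lemma nearC z (P : set C) :
  nbhs z P <-> exists2 d : R, 0 < d & forall w, nrm (w - z) < d -> P w.
Proof.
split=> [/nbhs_ballP[[d e] /=] | [d d0 dP]].
  rewrite ltcE /= => /andP[/eqP-> d0] dP.
  exists d => // w wd; apply: dP; rewrite /ball /= normCE ltcR.
  by rewrite nrm_distC.
apply/nbhs_ballP; exists d%:C => /=; first by rewrite ltcR.
by move=> w; rewrite /ball /= normCE ltcR nrm_distC; exact: dP.
Qed.

Lemma nearR (x : R) (P : set R) :
  nbhs x P <-> exists2 d : R, 0 < d & forall y, `|y - x| < d -> P y.
Proof.
split=> [/nbhs_ballP[d /= d0] dP | [d d0 dP]].
  by exists d => // y yd; apply: dP; rewrite /ball /= distrC.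
by apply/nbhs_ballP; exists d => //= y; rewrite /ball /= distrC; exact: dP.
Qed.

Section Continuity.
Variables (T : topologicalType).

Lemma cvgC (F : set_system T) (FF : Filter F) (f : T -> C) l :
  (f x @[x --> F] --> l) <->
  forall e : R, 0 < e -> \forall x \near F, nrm (f x - l) < e.
Proof.
split=> [fl e e0 | H].
  by apply: (fl [set w | nrm (w - l) < e]); apply/nearC; exists e.
move=> P /nearC[d d0 dP]; rewrite /fmap /=.
by apply: filterS (H d d0) => x; exact: dP.
Qed.

(** Epsilon form over an arbitrary domain, so that functions on the line and on the plane share the
    same algebra of continuity. *)
Definition cont (f : T -> C) x :=
  forall e : R, 0 < e -> \forall y \near x, nrm (f y - f x) < e.

Lemma cont_Re (f : T -> C) x : cont f x -> {for x, continuous (fun y => Re (f y))}.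
Proof.
move=> cf; apply/cvgrPdist_lt => e e0; apply: filterS (cf e e0) => y.
by apply: le_lt_trans; rewrite -ReN -ReD nrm_distC Re_le_nrm.
Qed.

Lemma cont_Im (f : T -> C) x : cont f x -> {for x, continuous (fun y => Im (f y))}.
Proof.
move=> cf; apply/cvgrPdist_lt => e e0; apply: filterS (cf e e0) => y.
by apply: le_lt_trans; rewrite -ImN -ImD nrm_distC Im_le_nrm.
Qed.

Lemma cont_nrm (f : T -> C) x : cont f x -> {for x, continuous (fun y => nrm (f y))}.
Proof.
move=> cf; apply/cvgrPdist_lt => e e0; apply: filterS (cf e e0) => y.
apply: le_lt_trans; rewrite ler_norml; apply/andP; split.
  by rewrite lerNl opprB nrm_sub.
by rewrite nrm_distC nrm_sub.
Qed.

Lemma cont_conj (f : T -> C) x : cont f x -> cont (fun y => (f y)^* ) x.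
Proof.
by move=> cf e e0; apply: filterS (cf e e0) => y; rewrite -rmorphB nrm_conj.
Qed.

Lemma cont_ReIm (u v : T -> R) x :
  {for x, continuous u} -> {for x, continuous v} -> cont (fun y => u y +i* v y) x.
Proof.
move=> /cvgrPdist_lt cu /cvgrPdist_lt cv e e0.
have e20 : 0 < e / 2 by rewrite divr_gt0.
apply: filterS2 (cu _ e20) (cv _ e20) => y uy vy.
apply: le_lt_trans (nrm_le_ReIm _) _ => /=.
by rewrite distrC (distrC (v y)) (splitr e) ltrD.
Qed.

Lemma cont_cst k x : cont (fun _ : T => k) x.
Proof. by move=> e e0; apply: nearW => y; rewrite subrr nrm0. Qed.

Lemma contD (f g : T -> C) x : cont f x -> cont g x -> cont (fun y => f y + g y) x.
Proof.
move=> cf cg e e0; have e20 : 0 < e / 2 by rewrite divr_gt0.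
apply: filterS2 (cf _ e20) (cg _ e20) => y fy gy.
have -> : f y + g y - (f x + g x) = (f y - f x) + (g y - g x) by ring.
by apply: le_lt_trans (nrmD _ _) _; rewrite (splitr e) ltrD.
Qed.

Lemma contN (f : T -> C) x : cont f x -> cont (fun y => - f y) x.
Proof.
move=> cf e e0; apply: filterS (cf _ e0) => y.
by rewrite -opprD nrmN.
Qed.

Lemma contB (f g : T -> C) x : cont f x -> cont g x -> cont (fun y => f y - g y) x.
Proof. by move=> cf cg; apply: contD => //; exact: contN. Qed.

Lemma contM (f g : T -> C) x : cont f x -> cont g x -> cont (fun y => f y * g y) x.
Proof.
move=> cf cg e e0.
pose M := nrm (f x) + nrm (g x) + 1.
have M1 : 1 <= M by rewrite lerDr addr_ge0 ?nrm_ge0.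
have M0 : 0 < M by lra.
pose d := Num.min 1 (e / (2 * M)).
have d0 : 0 < d by rewrite lt_min ltr01 divr_gt0 // mulr_gt0.
apply: filterS2 (cf _ d0) (cg _ d0) => y fy gy.
have -> : f y * g y - f x * g x = (f y - f x) * (g y - g x) +
   (f x * (g y - g x) + (f y - f x) * g x) by ring.
apply: le_lt_trans (nrmD _ _) _.
apply: le_lt_trans (lerD (lexx _) (nrmD _ _)) _; rewrite !nrmM.
have d1 : d <= 1 by rewrite ge_min lexx.
have de : d * M <= e / 2.
  have : d <= e / (2 * M) by rewrite ge_min lexx orbT.
  by rewrite invfM mulrA -ler_pdivlMr.
have H1 : nrm (f y - f x) * nrm (g y - g x) <= d.
  rewrite -[leRHS]mulr1 ler_pM ?nrm_ge0 ?(ltW fy) //.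
  by apply: le_trans (ltW gy) d1.
have H2 : nrm (f x) * nrm (g y - g x) <= nrm (f x) * d.
  by rewrite ler_wpM2l ?nrm_ge0 // ltW.
have H3 : nrm (f y - f x) * nrm (g x) <= d * nrm (g x).
  by rewrite ler_wpM2r ?nrm_ge0 // ltW.
rewrite /M in de; lra.
Qed.

End Continuity.

Lemma cont_comp (T : topologicalType) (f : T -> C) (g : C -> C) (x : T) :
  cont f x -> cont g (f x) -> cont (fun y => g (f y)) x.
Proof.
move=> cf cg e e0; have /nearC[d d0 dP] := cg e e0.
by apply: filterS (cf d d0) => y; exact: dP.
Qed.

Lemma cont_id z : cont (fun w => w) z.
Proof. by move=> e e0; apply/nearC; exists e. Qed.

(** Caratheodory's form of the derivative: the difference quotient extends continuously to z. Sums,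
    products and compositions become algebraic identities between the quotients [g]. *)
Definition isd f z l :=
  exists g, [/\ cont g z, forall w, f w = f z + (w - z) * g w & g z = l].
Definition cdiff f z := exists l, isd f z l.

Lemma isd_eps f z l : isd f z l <->
  forall e : R, 0 < e -> exists2 d : R, 0 < d &
    forall w, nrm (w - z) < d -> nrm (f w - f z - l * (w - z)) <= e * nrm (w - z).
Proof.
split=> [[g [cg fg gz]] e e0 | H].
  have /nearC[d d0 dP] := cg e e0; exists d => // w wd.
  rewrite -gz.
  have -> : f w - f z - g z * (w - z) = (g w - g z) * (w - z) by rewrite (fg w); ring.
  by rewrite nrmM ler_wpM2r ?nrm_ge0 // ltW // dP.
exists (fun w => if w == z then l else (f w - f z) / (w - z)).
split; last by rewrite eqxx.
- move=> e e0; have e20 : 0 < e / 2 by rewrite divr_gt0.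
  have [d d0 dP] := H _ e20; apply/nearC; exists d => // w wd.
  rewrite eqxx; case: (eqVneq w z) => [wz|wz]; first by rewrite subrr nrm0.
  have wz0 : w - z != 0 by rewrite subr_eq0.
  have -> : (f w - f z) / (w - z) - l = (f w - f z - l * (w - z)) / (w - z).
    by field.
  rewrite nrm_div ltr_pdivrMr ?nrm_gt0 //; apply: le_lt_trans (dP _ wd) _.
  by rewrite ltr_pM2r ?nrm_gt0 // {2}(splitr e) ltrDl.
- move=> w; case: (eqVneq w z) => [->|wz]; first by rewrite subrr mul0r addr0.
  by rewrite mulrCA mulfV ?subr_eq0 // mulr1 addrC subrK.
Qed.

Lemma isd_cont f z l : isd f z l -> cont f z.
Proof.
move=> [g [cg fg _]].
have -> : f = (fun w => f z + (w - z) * g w) by apply/funext.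
apply: contD; first exact: cont_cst.
by apply: contM => //; apply: contB; [exact: cont_id|exact: cont_cst].
Qed.

Lemma cdiff_cont f z : cdiff f z -> cont f z.
Proof. by move=> [l /isd_cont]. Qed.

Lemma isd_near f g z l : (\forall w \near z, f w = g w) -> isd f z l -> isd g z l.
Proof.
move=> /nearC[d d0 dP] /isd_eps H; apply/isd_eps => e e0; have [d' d'0 dP'] := H e e0.
exists (Num.min d d'); first by rewrite lt_min d0.
move=> w; rewrite lt_min => /andP[wd wd'].
by rewrite -!dP ?subrr ?nrm0 //; apply: dP'.
Qed.

Lemma isd_cst k z : isd (fun _ => k) z 0.
Proof.
exists (fun _ => 0); split => //; first exact: cont_cst.
by move=> w; rewrite mulr0 addr0.
Qed.

Lemma isd_id z : isd (fun w => w) z 1.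
Proof.
exists (fun _ => 1); split => //; first exact: cont_cst.
by move=> w; rewrite mulr1 addrC subrK.
Qed.

Lemma isdD f g z a b : isd f z a -> isd g z b -> isd (fun w => f w + g w) z (a + b).
Proof.
move=> [p [cp fp <-]] [q [cq gq <-]]; exists (fun w => p w + q w); split => //.
  exact: contD.
by move=> w; rewrite (fp w) (gq w); ring.
Qed.

Lemma isdM f g z a b : isd f z a -> isd g z b ->
  isd (fun w => f w * g w) z (a * g z + f z * b).
Proof.
move=> df; have cf := isd_cont df; move: df.
move=> [p [cp fp <-]] [q [cq gq <-]].
exists (fun w => p w * g z + f w * q w); split => //.
  by apply: contD; apply: contM => //; exact: cont_cst.
by move=> w; rewrite (gq w) mulrDr {1}(fp w); ring.
Qed.

Lemma isd_comp f g z a b : isd f z a -> isd g (f z) b -> isd (fun w => g (f w)) z (b * a).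
Proof.
move=> df; have cf := isd_cont df; move: df.
move=> [p [cp fp <-]] [q [cq gq <-]].
exists (fun w => q (f w) * p w); split => //.
  by apply: contM => //; exact: cont_comp.
move=> w; rewrite (gq (f w)); have -> : f w - f z = (w - z) * p w by rewrite (fp w); ring.
ring.
Qed.

Lemma isd_inv z : z != 0 -> isd (fun w => w^-1) z (- z^-2).
Proof.
move=> z0; apply/isd_eps => e e0.
have nz : 0 < nrm z by rewrite nrm_gt0.
(* The first bound keeps |w| >= |z| / 2; the second then controls the exact remainder (w - z)^2 / (w
   z^2). *)
pose d := Num.min (nrm z / 2) (e * nrm z ^+ 3 / 2).
have d0 : 0 < d by rewrite lt_min !divr_gt0 ?mulr_gt0 ?exprn_gt0.
exists d => // w; rewrite lt_min => /andP[w1 w2].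
have wz : nrm z / 2 <= nrm w.
  have := nrm_sub z w; rewrite nrm_distC => H; lra.
have w0 : w != 0 by rewrite -nrm_gt0; lra.
have -> : w^-1 - z^-1 - - z^-2 * (w - z) = (w - z) ^+ 2 / (w * z ^+ 2).
  by field; rewrite w0 z0.
rewrite nrm_div nrmX nrmM nrmX ler_pdivrMr ?mulr_gt0 ?exprn_gt0 //; last lra.
have [->|nwz] := eqVneq (nrm (w - z)) 0; first by rewrite expr0n /= mulr0 mul0r.
rewrite expr2 mulrAC ler_pM2r ?lt_neqAle ?nrm_ge0 1?eq_sym ?nwz //.
apply: le_trans (ltW w2) _.
have -> : e * nrm z ^+ 3 / 2 = e * (nrm z / 2 * nrm z ^+ 2) by field.
by rewrite ler_wpM2l ?(ltW e0) // ler_wpM2r // exprn_ge0 // nrm_ge0.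
Qed.

Lemma isd_unique f z a b : isd f z a -> isd f z b -> a = b.
Proof.
move=> /isd_eps ha /isd_eps hb; apply/eqP; rewrite -subr_eq0 -nrm_eq0.
apply/negPn/negP => ab; have ab0 : 0 < nrm (a - b) by rewrite lt_neqAle eq_sym ab nrm_ge0.
have e0 : 0 < nrm (a - b) / 4 by rewrite divr_gt0.
have [d d0 dP] := ha _ e0; have [d' d'0 dP'] := hb _ e0.
pose h := Num.min d d' / 2.
have h0 : 0 < h by rewrite divr_gt0 // lt_min d0.
have hd : h < Num.min d d' by rewrite ltr_pdivrMr // ltr_pMr ?ltr1n // lt_min d0.
move: hd; rewrite lt_min => /andP[hd hd'].
have E : nrm ((z + h%:C) - z) = h by rewrite addrC addKr nrmR gtr0_norm.
have := dP (z + h%:C); rewrite E => /(_ hd) H1.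
have := dP' (z + h%:C); rewrite E => /(_ hd') H2.
have : nrm ((a - b) * (z + h%:C - z)) <= nrm (a - b) / 2 * h.
  have -> : (a - b) * (z + h%:C - z) = (f (z + h%:C) - f z - b * (z + h%:C - z)) -
    (f (z + h%:C) - f z - a * (z + h%:C - z)) by ring.
  apply: le_trans (nrmB _ _) _; apply: le_trans (lerD H2 H1) _; lra.
by rewrite nrmM E ler_pM2r // leNgt ltr_pdivrMr // ltr_pMr // ltr1n.
Qed.

Lemma cdiff_cst k z : cdiff (fun _ => k) z. Proof. by eexists; exact: isd_cst. Qed.
Lemma cdiff_id z : cdiff (fun w => w) z. Proof. by eexists; exact: isd_id. Qed.
Lemma cdiffD f g z : cdiff f z -> cdiff g z -> cdiff (fun w => f w + g w) z.
Proof. by move=> [a fa] [b gb]; eexists; exact: isdD fa gb. Qed.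
Lemma cdiffM f g z : cdiff f z -> cdiff g z -> cdiff (fun w => f w * g w) z.
Proof. by move=> [a fa] [b gb]; eexists; exact: isdM fa gb. Qed.
Lemma cdiff_comp f g z : cdiff f z -> cdiff g (f z) -> cdiff (fun w => g (f w)) z.
Proof. by move=> [a fa] [b gb]; eexists; exact: isd_comp fa gb. Qed.

Lemma isdN f z a : isd f z a -> isd (fun w => - f w) z (- a).
Proof.
move=> fa; have := isdM (isd_cst (-1) z) fa.
rewrite mul0r add0r mulN1r; apply: isd_near; near=> w; exact: mulN1r.
Unshelve. all: by end_near. Qed.
Lemma cdiffN f z : cdiff f z -> cdiff (fun w => - f w) z.
Proof. by move=> [a fa]; eexists; exact: isdN fa. Qed.
Lemma isdB f g z a b : isd f z a -> isd g z b -> isd (fun w => f w - g w) z (a - b).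
Proof. by move=> fa gb; exact: isdD fa (isdN gb). Qed.
Lemma cdiffB f g z : cdiff f z -> cdiff g z -> cdiff (fun w => f w - g w) z.
Proof. by move=> [a fa] [b gb]; eexists; exact: isdB fa gb. Qed.
Lemma isdV f z a : isd f z a -> f z != 0 -> isd (fun w => (f w)^-1) z (- a / f z ^+ 2).
Proof.
by move=> fa fz; have := isd_comp fa (isd_inv fz); rewrite mulNr mulrC -mulNr.
Qed.
Lemma cdiffV f z : cdiff f z -> f z != 0 -> cdiff (fun w => (f w)^-1) z.
Proof. by move=> [a fa] fz; eexists; exact: isdV fa fz. Qed.
Lemma cdiff_div f g z : cdiff f z -> cdiff g z -> g z != 0 -> cdiff (fun w => f w / g w) z.
Proof. by move=> df dg gz; apply: cdiffM => //; apply: cdiffV. Qed.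
Lemma isdX f z a n : isd f z a -> isd (fun w => f w ^+ n) z (n%:R * f z ^+ n.-1 * a).
Proof.
move=> fa; elim: n => [|n IH].
  by rewrite mul0r mul0r; have := isd_cst 1 z; apply: isd_near; near=> w; rewrite expr0.
have := isdM fa IH.
have -> : a * f z ^+ n + f z * (n%:R * f z ^+ n.-1 * a) = n.+1%:R * f z ^+ n.+1.-1 * a.
  case: n {IH} => [|n] /=; first by rewrite expr0; ring.
  rewrite exprS -(natr1 n.+1); ring.
by apply: isd_near; near=> w; rewrite exprS.
Unshelve. all: by end_near. Qed.
Lemma cdiffX f z n : cdiff f z -> cdiff (fun w => f w ^+ n) z.
Proof. by move=> [a fa]; eexists; exact: isdX fa. Qed.
Lemma cdiff_near f g z : (\forall w \near z, f w = g w) -> cdiff f z -> cdiff g z.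
Proof. by move=> fg [a fa]; exists a; exact: isd_near fg fa. Qed.

Lemma isd_derivable f z l : isd f z l -> derivable f z 1 /\ derive1 f z = l.
Proof.
move=> [g [cg fg <-]].
have H : h^-1 *: ((f \o shift z) (h *: 1) - f z) @[h --> 0^'] --> g z.
  apply/cvgC => e e0; have /nearC[d d0 dP] := cg e e0.
  apply/nearC; exists d => // h; rewrite subr0 => hd h0.
  have E : h + z - z = h by rewrite addrK.
  have -> : h^-1 *: ((f \o shift z) (h *: 1) - f z) = g (h + z).
    have -> : h *: (1 : C) = h by exact: mulr1.
    rewrite /= fg E addrAC subrr add0r; exact: mulKf.
  by apply: dP; rewrite E.
split; first by apply/cvg_ex; exists (g z).
rewrite derive1E; exact: cvg_lim H.
Qed.

Lemma derivable_isd f z : derivable f z 1 -> isd f z (derive1 f z).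
Proof.
move=> /derivableP[df _]; apply/isd_eps => e e0.
move: df => /cvg_ex[l fl].
suff H : isd f z l by have [_ ->] := isd_derivable H; move/isd_eps: H; apply.
apply/isd_eps => {}e {}e0; move/cvgC: fl => /(_ e e0)/nearC[d d0 dP].
exists d => // w wd; have [->|wz] := eqVneq w z; first by rewrite !subrr mulr0 subrr nrm0 mulr0.
have wz0 : w - z != 0 by rewrite subr_eq0.
have := dP (w - z); rewrite subr0 => /(_ wd wz0).
have -> : (w - z)^-1 *: ((f \o shift z) ((w - z) *: 1) - f z) = (f w - f z) / (w - z).
  have -> : (w - z) *: (1 : C) = w - z by exact: mulr1.
  by rewrite /= subrK; exact: mulrC.
have -> : (f w - f z) / (w - z) - l = (f w - f z - l * (w - z)) / (w - z).
  by field.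
by rewrite nrm_div ltr_pdivrMr ?nrm_gt0 // => /ltW.
Qed.

Lemma cdiffP f z : cdiff f z <-> derivable f z 1.
Proof.
by split=> [[l /isd_derivable[]]|/derivable_isd] //; exists (derive1 f z).
Qed.

End ComplexBasics.

Arguments ComplexField.Normc.normc : simpl never.

(** * The complex exponential *)

Section ComplexExp.
Variable R : realType.
Local Notation C := R[i].
Implicit Types (z w : C).

Lemma realD_eps (f : R -> R) (x l : R) :
  is_derive x (1 : R) f l <->
  forall e : R, 0 < e -> exists2 d : R, 0 < d &
    forall h, `|h| < d -> `|f (x + h) - f x - l * h| <= e * `|h|.
Proof.
split=> [[df dl] e e0 | H].
- have := df; rewrite /derivable => /cvg_ex[l' fl].
  have El : l' = l by rewrite -dl; apply/esym; exact: cvg_lim fl.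
  move/cvgrPdist_lt: fl => /(_ e e0)/nearR[d d0 dP].
  exists d => // h hd; have [->|h0] := eqVneq h 0.
    by rewrite addr0 subrr mulr0 subrr normr0 mulr0.
  have := dP h; rewrite subr0 => /(_ hd h0) /=.
  have -> : h *: (1 : R) = h by exact: mulr1.
  rewrite El => /ltW H.
  have -> : f (x + h) - f x - l * h = - (l - h^-1 *: (f (h + x) - f x)) * h.
    have -> : h^-1 *: (f (h + x) - f x) = h^-1 * (f (h + x) - f x) by [].
    by rewrite (addrC h x); field.
  by rewrite normrM normrN ler_wpM2r.
- have H' : h^-1 *: ((f \o shift x) (h *: (1 : R)) - f x) @[h --> 0^'] --> l.
    apply/cvgrPdist_le => e e0; have [d d0 dP] := H e e0.
    apply/nearR; exists d => // h; rewrite subr0 => hd h0 /=.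
    have -> : h *: (1 : R) = h by exact: mulr1.
    have -> : h^-1 *: (f (h + x) - f x) = h^-1 * (f (h + x) - f x) by [].
    have -> : l - h^-1 * (f (h + x) - f x) = - (f (x + h) - f x - l * h) / h.
      by rewrite (addrC h x); field.
    by rewrite normrM normrN normfV ler_pdivrMr ?normr_gt0 // dP.
  split; first by apply/cvg_ex; exists l.
  exact: cvg_lim H'.
Qed.

(** Built from real functions, so that its modulus is [expR (Re z)] at once; this is what damping
    factors and logarithms use. *)
Definition expC z : C := (expR (Re z))%:C * (cos (Im z) +i* sin (Im z)).

Lemma expC0 : expC 0 = 1.
Proof. by rewrite /expC /= expR0 cos0 sin0 mul1r. Qed.

Lemma expCD z w : expC (z + w) = expC z * expC w.
Proof.
rewrite /expC !ReIm expRD cosD sinD; apply: complex_eqP; rewrite !ReIm /=; ring.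
Qed.

Lemma nrm_cossin (x : R) : nrm (cos x +i* sin x) = 1.
Proof. by rewrite /ComplexField.Normc.normc cos2Dsin2 sqrtr1. Qed.

Lemma nrm_expC z : nrm (expC z) = expR (Re z).
Proof. by rewrite nrmM nrmR nrm_cossin mulr1 ger0_norm // expR_ge0. Qed.

Lemma expC_neq0 z : expC z != 0.
Proof. by rewrite -nrm_gt0 nrm_expC expR_gt0. Qed.

Lemma expCN z : expC (- z) = (expC z)^-1.
Proof. by apply: (mulfI (expC_neq0 z)); rewrite -expCD subrr expC0 mulfV ?expC_neq0. Qed.

Lemma isd_expC0 : isd expC 0 1.
Proof.
apply/isd_eps => e e0.
(* The three real remainders contribute at most (1 + 3 + 3 + 2) e1 |h| = 9 e1 |h|, which 16
   covers. *)
pose e1 := Num.min 1 (e / 16).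
have e10 : 0 < e1 by rewrite lt_min ltr01 divr_gt0.
have e11 : e1 <= 1 by rewrite ge_min lexx.
have e1e : e1 <= e / 16 by rewrite ge_min lexx orbT.
clearbody e1.
have [d1 d10 H1] := (realD_eps _ _ _).1 (is_derive_expR (0 : R)) _ e10.
have [d2 d20 H2] := (realD_eps _ _ _).1 (is_derive_cos (0 : R)) _ e10.
have [d3 d30 H3] := (realD_eps _ _ _).1 (is_derive_sin (0 : R)) _ e10.
exists (Num.min (Num.min d1 d2) (Num.min d3 e1)); first by rewrite !lt_min d10 d20 d30.
move=> h; rewrite !lt_min subr0 => /andP[/andP[h1 h2] /andP[h3 h4]].
have hR := Re_le_nrm h; have hI := Im_le_nrm h.
have {H1} := H1 (Re h) (le_lt_trans hR h1).
have {H2} := H2 (Im h) (le_lt_trans hI h2).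
have {H3} := H3 (Im h) (le_lt_trans hI h3).
rewrite !add0r expR0 cos0 sin0 ?oppr0 ?mul0r ?subr0 ?addr0 ?mul1r.
set a := Re h in hR *; set b := Im h in hI *; set n := nrm h in hR hI h4 *.
move=> H3 H2 H1.
have n0 : 0 <= n by exact: nrm_ge0.
rewrite expC0.
set r1 := expR a - 1 - a in H1; set r2 := cos b - 1 in H2; set r3 := sin b - b in H3.
have B1 : `|r1| <= e1 * n by apply: le_trans H1 _; rewrite ler_wpM2l // ltW.
have B2 : `|r2| <= e1 * n by apply: le_trans H2 _; rewrite ler_wpM2l // ltW.
have B3 : `|r3| <= e1 * n by apply: le_trans H3 _; rewrite ler_wpM2l // ltW.
have n1 : n <= 1 by lra.
have en : e1 * n <= e1 by rewrite ler_piMr // ltW.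
have K : `|1 + a + r1| <= 3.
  have k1 := ler_normD (1 + a) r1; have := ler_normD 1 a; rewrite normr1 => k2; lra.
have Ha : `|a + r1| <= 2 * e1.
  have := ler_normD a r1; lra.
apply: le_trans (nrm_le_ReIm _) _.
have -> : Re (expC h - 1 - h) = r1 + r2 * (1 + a + r1).
  rewrite !ReIm /expC /= /r1 /r2 -/a -/b; ring.
have -> : Im (expC h - 1 - h) = r3 * (1 + a + r1) + b * (a + r1).
  rewrite !ReIm /expC /= /r1 /r3 -/a -/b; ring.
apply: le_trans (lerD (ler_normD _ _) (ler_normD _ _)) _; rewrite !normrM.
have P1 : `|r2| * `|1 + a + r1| <= (e1 * n) * 3 by rewrite ler_pM.
have P2 : `|r3| * `|1 + a + r1| <= (e1 * n) * 3 by rewrite ler_pM.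
have P3 : `|b| * `|a + r1| <= n * (2 * e1) by rewrite ler_pM.
have : e1 * n <= e / 16 * n by rewrite ler_wpM2r.
have : 0 <= e * n by rewrite mulr_ge0 // ltW.
lra.
Qed.

(** The functional equation transports the derivative from 0 to z. *)
Lemma isd_expC z : isd expC z (expC z).
Proof.
have E : expC = (fun w => expC z * expC (w - z)).
  by apply/funext => w; rewrite -expCD addrC subrK.
rewrite {1}E.
have := isdM (isd_cst (expC z) z) (isd_comp (isdB (isd_id z) (isd_cst z z))
  (_ : isd expC (z - z) 1)).
rewrite subrr expC0 mul0r add0r subr0 !mulr1; apply.
exact: isd_expC0.
Qed.

Lemma cdiff_expC f z : cdiff f z -> cdiff (fun w => expC (f w)) z.
Proof. by move=> df; apply: cdiff_comp => //; eexists; exact: isd_expC. Qed.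

End ComplexExp.

(** * Integrals of continuous functions *)

Section Integral.
Variable R : realType.
Local Notation C := R[i].
Local Notation mu := (@lebesgue_measure R).
Implicit Types (a b c t : R) (f g : R -> C) (u v : R -> R).

Definition contI a b f := forall t, a <= t <= b -> cont f t.
Definition rcontI a b u := forall t, a <= t <= b -> {for t, continuous u}.

Definition ru a b u : R := \int[mu]_(x in `[a, b]) u x.

Lemma ru_integrable a b u : rcontI a b u -> mu.-integrable `[a, b] (EFin \o u).
Proof.
move=> cu; apply: continuous_compact_integrable; first exact: segment_compact.
apply: continuous_in_subspaceT => t; rewrite inE /= in_itv /=; exact: cu.
Qed.

Lemma ru_eq0 a b u : b <= a -> ru a b u = 0.
Proof.
rewrite le_eqVlt => /predU1P[->|ab]; first by rewrite /ru set_itv1 Rintegral_set1.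
by rewrite /ru set_itv_ge ?Rintegral_set0 // bnd_simp -ltNge.
Qed.

Lemma ruD a b u v : rcontI a b u -> rcontI a b v ->
  ru a b (fun t => u t + v t) = ru a b u + ru a b v.
Proof. by move=> cu cv; rewrite /ru RintegralD //; exact: ru_integrable. Qed.

Lemma ruZ a b k u : rcontI a b u -> ru a b (fun t => k * u t) = k * ru a b u.
Proof. by move=> cu; rewrite /ru RintegralZl //; exact: ru_integrable. Qed.

Lemma ru_ext a b u v : (forall t, a <= t <= b -> u t = v t) -> ru a b u = ru a b v.
Proof. by move=> uv; apply: eq_Rintegral => t; rewrite inE /= in_itv; exact: uv. Qed.

Lemma ru_chasles a b c u : a <= b -> b <= c -> rcontI a c u ->
  ru a c u = ru a b u + ru b c u.
Proof.
move=> ab bc cu; have iu := ru_integrable cu.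
have := @Rintegral_itvB R u (BLeft a) (BRight c) b iu.
rewrite !bnd_simp => /(_ ab bc) => H.
rewrite /ru -(@Rintegral_itv_obnd_cbnd _ b (BRight c) u); last first.
  apply: integrableS iu => //; apply: subset_itvr.
  by rewrite bnd_simp.
by rewrite -H addrC subrK.
Qed.

Lemma ru_le a b u v : rcontI a b u -> rcontI a b v ->
  (forall t, a <= t <= b -> u t <= v t) -> ru a b u <= ru a b v.
Proof.
move=> cu cv uv; apply: le_Rintegral; [by []|exact: ru_integrable|exact: ru_integrable|].
by move=> t; rewrite /= in_itv; exact: uv.
Qed.

Lemma rcontI_cst a b (k : R) : rcontI a b (fun _ => k).
Proof. by move=> t _; exact: cst_continuous. Qed.

Lemma ru_cst a b k : a <= b -> ru a b (fun _ => k) = k * (b - a).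
Proof.
move=> ab; rewrite /ru Rintegral_cst // (_ : fine _ = b - a) //.
transitivity (fine (lebesgue_measure ([set` `[a, b]] : set R))) => //.
rewrite lebesgue_measure_itv /= lte_fin.
move: ab; rewrite le_eqVlt => /predU1P[->|ab]; first by rewrite ltxx subrr.
by rewrite ab.
Qed.

Lemma ru_ge0 a b u : (forall t, a <= t <= b -> 0 <= u t) -> 0 <= ru a b u.
Proof. by move=> u0; apply: Rintegral_ge0 => t; rewrite /= in_itv; exact: u0. Qed.

Lemma ru_FTC a b u v : a <= b -> rcontI a b v ->
  (forall t, a <= t <= b -> is_derive t (1 : R) u (v t)) -> ru a b v = u b - u a.
Proof.
rewrite le_eqVlt => /predU1P[->|ab] cv du; first by rewrite subrr ru_eq0.
have cu t : a <= t <= b -> {for t, continuous u}.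
  move=> /du [dut _]; apply: differentiable_continuous; exact/derivable1_diffP.
rewrite /ru /Rintegral (continuous_FTC2 (F := u) ab) //.
- by apply: continuous_in_subspaceT => t; rewrite inE /= in_itv /=; exact: cv.
- split.
  + move=> t; rewrite in_itv /= => /andP[at_ tb].
    by have /du[] : a <= t <= b by rewrite !ltW.
  + by apply: cvg_at_right_filter; apply: cu; rewrite lexx ltW.
  + by apply: cvg_at_left_filter; apply: cu; rewrite lexx ltW.
- move=> t; rewrite in_itv /= => /andP[at_ tb].
  have /du[_ <-] : a <= t <= b by rewrite !ltW.
  by rewrite derive1E.
Qed.

Definition cu a b f : C := ru a b (fun t => Re (f t)) +i* ru a b (fun t => Im (f t)).

Lemma contI_Re a b f : contI a b f -> rcontI a b (fun t => Re (f t)).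
Proof. by move=> cf t /cf; exact: cont_Re. Qed.
Lemma contI_Im a b f : contI a b f -> rcontI a b (fun t => Im (f t)).
Proof. by move=> cf t /cf; exact: cont_Im. Qed.
Lemma contI_nrm a b f : contI a b f -> rcontI a b (fun t => nrm (f t)).
Proof. by move=> cf t /cf; exact: cont_nrm. Qed.

Lemma cu_eq0 a b f : b <= a -> cu a b f = 0.
Proof. by move=> ba; rewrite /cu !ru_eq0. Qed.

Lemma cuD a b f g : contI a b f -> contI a b g ->
  cu a b (fun t => f t + g t) = cu a b f + cu a b g.
Proof.
move=> cf cg; apply: complex_eqP; rewrite !ReIm /= -ruD;
  try exact: contI_Re; try exact: contI_Im; by apply: ru_ext => t _; rewrite !ReIm.
Qed.

Lemma rcontIZ a b k u : rcontI a b u -> rcontI a b (fun t => k * u t).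
Proof. by move=> cu_ t /cu_ ct; apply: continuousM => //; exact: cst_continuous. Qed.

Lemma cuZ a b k f : contI a b f -> cu a b (fun t => k * f t) = k * cu a b f.
Proof.
move=> cf; have cR := contI_Re cf; have cI := contI_Im cf.
apply: complex_eqP; rewrite !ReIm /=.
- rewrite -mulNr -!ruZ // -ruD; [|exact: rcontIZ..].
  by apply: ru_ext => t _; rewrite ReM mulNr.
- rewrite -!ruZ // -ruD; [|exact: rcontIZ..].
  by apply: ru_ext => t _; rewrite ImM.
Qed.

Lemma cu_ext a b f g : (forall t, a <= t <= b -> f t = g t) -> cu a b f = cu a b g.
Proof. by move=> fg; congr Complex; apply: ru_ext => t /fg ->. Qed.

Lemma cu_chasles a b c f : a <= b -> b <= c -> contI a c f ->
  cu a c f = cu a b f + cu b c f.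
Proof.
move=> ab bc cf; apply: complex_eqP; rewrite !ReIm /=; apply: ru_chasles => //.
  exact: contI_Re.
exact: contI_Im.
Qed.

(* [|w|^2 = Re (w^* \int f) = \int Re (w^* f) <= |w| \int |f|] for [w = \int f]. *)
Lemma nrm_cu a b f : contI a b f -> nrm (cu a b f) <= ru a b (fun t => nrm (f t)).
Proof.
move=> cf; set w := cu a b f; have [w0|w0] := eqVneq (nrm w) 0.
  by rewrite w0; apply: ru_ge0 => t _; exact: nrm_ge0.
have wp : 0 < nrm w by rewrite lt_neqAle eq_sym w0 nrm_ge0.
rewrite -(ler_pM2l wp) -ruZ; last exact: contI_nrm.
have cwf : contI a b (fun t => w^* * f t).
  by move=> t /cf ct; apply: contM => //; exact: cont_cst.
have -> : nrm w * nrm w = ru a b (fun t => Re (w^* * f t)).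
  transitivity (Re (w^* * cu a b f)); last by rewrite -cuZ.
  rewrite -/w -expr2 nrm_sqr ReM; case: (w) => x y /=; ring.
apply: ru_le; [exact: contI_Re|by apply: rcontIZ; exact: contI_nrm|].
move=> t _; rewrite -(nrm_conj w) -nrmM.
by apply: le_trans (Re_le_nrm _); exact: ler_norm.
Qed.

(** Derivative of a curve in the plane; real and imaginary parts inherit it because they are
    dominated by the modulus. *)
Definition rderiv f t (l : C) := forall e : R, 0 < e -> exists2 d : R, 0 < d &
  forall h : R, `|h| < d -> nrm (f (t + h) - f t - l * h%:C) <= e * `|h|.

Lemma rderiv_Re f t l : rderiv f t l -> is_derive t (1 : R) (fun s => Re (f s)) (Re l).
Proof.
move=> H; apply/realD_eps => e e0; have [d d0 dP] := H e e0; exists d => // h hd.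
apply: le_trans (dP h hd); apply: le_trans (Re_le_nrm _).
by rewrite !ReIm /= mulr0 subr0.
Qed.

Lemma rderiv_Im f t l : rderiv f t l -> is_derive t (1 : R) (fun s => Im (f s)) (Im l).
Proof.
move=> H; apply/realD_eps => e e0; have [d d0 dP] := H e e0; exists d => // h hd.
apply: le_trans (dP h hd); apply: le_trans (Im_le_nrm _).
by rewrite !ReIm /= mulr0 add0r.
Qed.

Lemma isd_rderiv (F : C -> C) (p q l : C) t :
  isd F (p + q * t%:C) l -> rderiv (fun s => F (p + q * s%:C)) t (q * l).
Proof.
move=> /isd_eps H e e0; have q1 : 0 < 1 + nrm q by have := nrm_ge0 q; lra.
have [d d0 dP] := H _ (divr_gt0 e0 q1).
exists (d / (1 + nrm q)) => [|h]; first by rewrite divr_gt0.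
rewrite ltr_pdivlMr // => hd.
have E : p + q * (t + h)%:C - (p + q * t%:C) = q * h%:C by rewrite rmorphD /=; ring.
have := dP (p + q * (t + h)%:C); rewrite E nrmM nrmR => H1.
have : nrm q * `|h| < d.
  by apply: le_lt_trans hd; rewrite mulrC ler_wpM2l // lerDr.
move=> /H1; rewrite mulrCA mulrA => /le_trans; apply.
rewrite mulrA ler_wpM2r // mulrAC ler_pdivrMr // ler_wpM2l ?(ltW e0) //.
by rewrite lerDr.
Qed.

Lemma cu_FTC a b F f : a <= b -> contI a b f ->
  (forall t, a <= t <= b -> rderiv F t (f t)) -> cu a b f = F b - F a.
Proof.
move=> ab cf dF; apply: complex_eqP; rewrite !ReIm /=.
  by apply: (@ru_FTC _ _ (fun s => Re (F s))) => [||t /dF /rderiv_Re] //; exact: contI_Re.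
by apply: (@ru_FTC _ _ (fun s => Im (F s))) => [||t /dF /rderiv_Im] //; exact: contI_Im.
Qed.

Lemma nrm_cu_le a b f (M : R) : a <= b -> contI a b f ->
  (forall t, a <= t <= b -> nrm (f t) <= M) -> nrm (cu a b f) <= M * (b - a).
Proof.
move=> ab cf fM; apply: le_trans (nrm_cu cf) _; rewrite -ru_cst //.
by apply: ru_le => //; [exact: contI_nrm|exact: rcontI_cst].
Qed.

Lemma contIS a b c d f : a <= c -> d <= b -> contI a b f -> contI c d f.
Proof.
move=> ac db cf t /andP[ct td]; apply: cf.
by rewrite (le_trans ac) // (le_trans td).
Qed.

(** The oriented integral: [cu] vanishes on reversed bounds, so at most one of the two terms
    survives. *)
Definition cint a b f := cu a b f - cu b a f.

Lemma cint_le a b f : a <= b -> cint a b f = cu a b f.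
Proof. by move=> ab; rewrite /cint (cu_eq0 _ ab) subr0. Qed.

Lemma cintC a b f : cint b a f = - cint a b f.
Proof. by rewrite /cint opprB. Qed.

Lemma cint_chasles m M a b c f : m <= a <= M -> m <= b <= M -> m <= c <= M ->
  contI m M f -> cint a c f = cint a b f + cint b c f.
Proof.
have main x y z : m <= x -> x <= y -> y <= z -> z <= M -> contI m M f ->
    cu x z f = cu x y f + cu y z f.
  by move=> mx xy yz zM cf; apply: cu_chasles => //; exact: contIS cf.
move=> /andP[ma aM] /andP[mb bM] /andP[mc cM] cf; rewrite /cint.
have [ab|/ltW ab] := leP a b; have [bc|/ltW bc] := leP b c;
have [ac|/ltW ac] := leP a c.
- by rewrite (cu_eq0 _ ab) (cu_eq0 _ bc) (cu_eq0 _ ac) (main a b c) // !subr0.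
- have E : a = b by apply/le_anti; rewrite ab (le_trans bc ac).
  by subst b; rewrite !(cu_eq0 _ (lexx a)) !subr0 add0r.
- by rewrite (cu_eq0 _ ab) (cu_eq0 _ bc) (cu_eq0 _ ac) (main a c b) //; ring.
- by rewrite (cu_eq0 _ ab) (cu_eq0 _ bc) (cu_eq0 _ ac) (main c a b) //; ring.
- by rewrite (cu_eq0 _ ab) (cu_eq0 _ bc) (cu_eq0 _ ac) (main b a c) //; ring.
- by rewrite (cu_eq0 _ ab) (cu_eq0 _ bc) (cu_eq0 _ ac) (main b c a) //; ring.
- have E : a = b by apply/le_anti; rewrite ab (le_trans ac bc).
  by subst b; rewrite !(cu_eq0 _ (lexx a)) subrr add0r.
- by rewrite (cu_eq0 _ ab) (cu_eq0 _ bc) (cu_eq0 _ ac) (main c b a) //; ring.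
Qed.

Lemma nrm_cint_le a b f (M : R) : contI (Num.min a b) (Num.max a b) f ->
  (forall t, Num.min a b <= t <= Num.max a b -> nrm (f t) <= M) ->
  nrm (cint a b f) <= M * `|b - a|.
Proof.
have [ab|/ltW ab] := leP a b => cf fM.
  by rewrite cint_le // ger0_norm ?subr_ge0 //; exact: nrm_cu_le.
by rewrite cintC nrmN cint_le // ler0_norm ?subr_le0 // opprB; exact: nrm_cu_le.
Qed.

Lemma cintD a b f g : contI (Num.min a b) (Num.max a b) f ->
  contI (Num.min a b) (Num.max a b) g ->
  cint a b (fun t => f t + g t) = cint a b f + cint a b g.
Proof.
have [ab|/ltW ab] := leP a b => cf cg; first by rewrite !cint_le // cuD.
by rewrite !(cintC b a) !cint_le // cuD // opprD.
Qed.

End Integral.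

(** * Cauchy theory on rectangles *)

Section Goursat.
Variable R : realType.
Local Notation C := R[i].
Implicit Types (x y t : R) (f g F : C -> C).

Lemma cont_h f x y : cont f (x +i* y) -> cont (fun s => f (s +i* y)) x.
Proof.
apply: (@cont_comp _ _ (fun s : R => s +i* y)) => e e0; apply/nearR; exists e => // s.
have -> : (s +i* y) - (x +i* y) = (s - x)%:C by apply: complex_eqP; rewrite !ReIm /= ?subrr.
by rewrite nrmR.
Qed.

Lemma cont_v f x y : cont f (x +i* y) -> cont (fun s => f (x +i* s)) y.
Proof.
apply: (@cont_comp _ _ (fun s : R => x +i* s)) => e e0; apply/nearR; exists e => // s.
have -> : (x +i* s) - (x +i* y) = 'i * (s - y)%:C.
  by apply: complex_eqP; rewrite !ReIm /=; ring.
by rewrite nrmM nrmi mul1r nrmR.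
Qed.

Lemma rderiv_h F x y l : isd F (x +i* y) l -> rderiv (fun s => F (s +i* y)) x l.
Proof.
have E s : (s +i* y) = 'i * y%:C + 1 * s%:C.
  by apply: complex_eqP; rewrite !ReIm /=; ring.
rewrite E => /isd_rderiv; rewrite mul1r.
by under [X in _ -> rderiv X _ _]eq_fun do rewrite E.
Qed.

Lemma rderiv_v F x y l : isd F (x +i* y) l -> rderiv (fun s => F (x +i* s)) y ('i * l).
Proof.
have E s : (x +i* s) = x%:C + 'i * s%:C.
  by apply: complex_eqP; rewrite !ReIm /=; ring.
rewrite E => /isd_rderiv.
by under [X in _ -> rderiv X _ _]eq_fun do rewrite E.
Qed.

(** Counterclockwise boundary integral: bottom minus top, plus i times right minus left. *)
Definition rectI f x1 x2 y1 y2 : C :=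
  cint x1 x2 (fun x => f (x +i* y1)) - cint x1 x2 (fun x => f (x +i* y2)) +
  'i * (cint y1 y2 (fun y => f (x2 +i* y)) - cint y1 y2 (fun y => f (x1 +i* y))).

Definition onrect x1 x2 y1 y2 (P : set C) :=
  forall x y, x1 <= x <= x2 -> y1 <= y <= y2 -> P (x +i* y).

Lemma onrectS x1 x2 y1 y2 a1 a2 b1 b2 (P Q : set C) :
  x1 <= a1 -> a2 <= x2 -> y1 <= b1 -> b2 <= y2 -> P `<=` Q ->
  onrect x1 x2 y1 y2 P -> onrect a1 a2 b1 b2 Q.
Proof.
move=> xa ax yb by_ PQ H x y /andP[ax1 ax2] /andP[by1 by2]; apply/PQ/H.
  by rewrite (le_trans xa) // (le_trans ax2).
by rewrite (le_trans yb) // (le_trans by2).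
Qed.

Lemma onrect_h x1 x2 y1 y2 f y : y1 <= y <= y2 -> onrect x1 x2 y1 y2 (cont f) ->
  contI x1 x2 (fun x => f (x +i* y)).
Proof. by move=> yy H t tx; apply: cont_h; exact: H. Qed.

Lemma onrect_v x1 x2 y1 y2 f x : x1 <= x <= x2 -> onrect x1 x2 y1 y2 (cont f) ->
  contI y1 y2 (fun y => f (x +i* y)).
Proof. by move=> xx H t ty; apply: cont_v; exact: H. Qed.

Definition onbd x1 x2 y1 y2 (P : set C) :=
  [/\ forall x, x1 <= x <= x2 -> P (x +i* y1), forall x, x1 <= x <= x2 -> P (x +i* y2),
      forall y, y1 <= y <= y2 -> P (x1 +i* y) & forall y, y1 <= y <= y2 -> P (x2 +i* y)].

Lemma onrect_bd x1 x2 y1 y2 (P : set C) : x1 <= x2 -> y1 <= y2 ->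
  onrect x1 x2 y1 y2 P -> onbd x1 x2 y1 y2 P.
Proof. by move=> x12 y12 H; split=> t tt; apply: H; rewrite ?lexx ?x12 ?y12. Qed.

Lemma onbd_cont f x1 x2 y1 y2 : onbd x1 x2 y1 y2 (cont f) ->
  [/\ contI x1 x2 (fun x => f (x +i* y1)), contI x1 x2 (fun x => f (x +i* y2)),
      contI y1 y2 (fun y => f (x1 +i* y)) & contI y1 y2 (fun y => f (x2 +i* y))].
Proof.
by move=> [h1 h2 v1 v2]; split=> t tt; (apply: cont_h || apply: cont_v);
  [exact: h1|exact: h2|exact: v1|exact: v2].
Qed.

Lemma onbdS x1 x2 y1 y2 (P Q : set C) : P `<=` Q ->
  onbd x1 x2 y1 y2 P -> onbd x1 x2 y1 y2 Q.
Proof. by move=> PQ [h1 h2 v1 v2]; split=> t tt; apply: PQ; auto. Qed.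

Lemma onbdI x1 x2 y1 y2 (P Q : set C) : onbd x1 x2 y1 y2 P -> onbd x1 x2 y1 y2 Q ->
  onbd x1 x2 y1 y2 (P `&` Q).
Proof. by move=> [? ? ? ?] [? ? ? ?]; split=> t tt; split; auto. Qed.

Lemma rectI_ext f g x1 x2 y1 y2 : x1 <= x2 -> y1 <= y2 ->
  onbd x1 x2 y1 y2 (fun z => f z = g z) -> rectI f x1 x2 y1 y2 = rectI g x1 x2 y1 y2.
Proof.
move=> x12 y12 [h1 h2 v1 v2]; rewrite /rectI !cint_le //.
by congr (_ - _ + 'i * (_ - _)); apply: cu_ext.
Qed.

Lemma rectID f g x1 x2 y1 y2 : x1 <= x2 -> y1 <= y2 ->
  onbd x1 x2 y1 y2 (cont f) -> onbd x1 x2 y1 y2 (cont g) ->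
  rectI (fun z => f z + g z) x1 x2 y1 y2 = rectI f x1 x2 y1 y2 + rectI g x1 x2 y1 y2.
Proof.
move=> x12 y12 /onbd_cont[? ? ? ?] /onbd_cont[? ? ? ?]; rewrite /rectI !cint_le //.
rewrite !cuD //; ring.
Qed.

Lemma rectIZ k f x1 x2 y1 y2 : x1 <= x2 -> y1 <= y2 ->
  onbd x1 x2 y1 y2 (cont f) ->
  rectI (fun z => k * f z) x1 x2 y1 y2 = k * rectI f x1 x2 y1 y2.
Proof.
move=> x12 y12 /onbd_cont[? ? ? ?]; rewrite /rectI !cint_le //.
rewrite !cuZ //; ring.
Qed.

Lemma nrm_rectI f x1 x2 y1 y2 M : x1 <= x2 -> y1 <= y2 ->
  onbd x1 x2 y1 y2 (cont f) -> onbd x1 x2 y1 y2 (fun z => nrm (f z) <= M) ->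
  nrm (rectI f x1 x2 y1 y2) <= M * (2 * ((x2 - x1) + (y2 - y1))).
Proof.
move=> x12 y12 /onbd_cont[? ? ? ?] [? ? ? ?]; rewrite /rectI !cint_le //.
apply: le_trans (nrmD _ _) _; rewrite nrmM nrmi mul1r.
apply: le_trans (lerD (nrmB _ _) (nrmB _ _)) _.
have H1 : nrm (cu x1 x2 (fun x => f (x +i* y1))) <= M * (x2 - x1) by exact: nrm_cu_le.
have H2 : nrm (cu x1 x2 (fun x => f (x +i* y2))) <= M * (x2 - x1) by exact: nrm_cu_le.
have V1 : nrm (cu y1 y2 (fun y => f (x1 +i* y))) <= M * (y2 - y1) by exact: nrm_cu_le.
have V2 : nrm (cu y1 y2 (fun y => f (x2 +i* y))) <= M * (y2 - y1) by exact: nrm_cu_le.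
lra.
Qed.

Lemma rectI_splitx f x1 xm x2 y1 y2 : x1 <= xm -> xm <= x2 -> y1 <= y2 ->
  onrect x1 x2 y1 y2 (cont f) ->
  rectI f x1 x2 y1 y2 = rectI f x1 xm y1 y2 + rectI f xm x2 y1 y2.
Proof.
move=> x1m xm2 y12 cf; have x12 := le_trans x1m xm2; rewrite /rectI !cint_le //.
rewrite !(@cu_chasles _ x1 xm x2) //; first ring.
  by apply: onrect_h cf; rewrite lexx andbT.
by apply: onrect_h cf; rewrite lexx.
Qed.

Lemma rectI_splity f x1 x2 y1 ym y2 : x1 <= x2 -> y1 <= ym -> ym <= y2 ->
  onrect x1 x2 y1 y2 (cont f) ->
  rectI f x1 x2 y1 y2 = rectI f x1 x2 y1 ym + rectI f x1 x2 ym y2.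
Proof.
move=> x12 y1m ym2 cf; have y12 := le_trans y1m ym2; rewrite /rectI !cint_le //.
rewrite !(@cu_chasles _ y1 ym y2) //; first ring.
  by apply: onrect_v cf; rewrite lexx.
by apply: onrect_v cf; rewrite lexx andbT.
Qed.

(** Each side contributes the difference of [F] at two corners, and the corner values cancel. *)
Lemma rectI_prim F f x1 x2 y1 y2 : x1 <= x2 -> y1 <= y2 ->
  onrect x1 x2 y1 y2 (cont f) -> onrect x1 x2 y1 y2 (fun z => isd F z (f z)) ->
  rectI f x1 x2 y1 y2 = 0.
Proof.
move=> x12 y12 cf dF; rewrite /rectI !cint_le //.
have e1 : y1 <= y1 <= y2 by rewrite lexx.
have e2 : y1 <= y2 <= y2 by rewrite lexx andbT.
have e3 : x1 <= x1 <= x2 by rewrite lexx.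
have e4 : x1 <= x2 <= x2 by rewrite lexx andbT.
have H y : y1 <= y <= y2 -> cu x1 x2 (fun x => f (x +i* y)) = F (x2 +i* y) - F (x1 +i* y).
  move=> yy; apply: (@cu_FTC _ _ _ (fun x => F (x +i* y))) => //; first exact: onrect_h yy cf.
  by move=> t tt; apply: rderiv_h; exact: dF.
have V x : x1 <= x <= x2 ->
    'i * cu y1 y2 (fun y => f (x +i* y)) = F (x +i* y2) - F (x +i* y1).
  move=> yy; have cv : contI y1 y2 (fun y => f (x +i* y)) by exact: onrect_v yy cf.
  rewrite -cuZ //; apply: (@cu_FTC _ _ _ (fun y => F (x +i* y))) => //.
    by move=> t tt; apply: contM; [exact: cont_cst|exact: cv].
  by move=> t tt; apply: rderiv_v; exact: dF.
rewrite mulrBr !H // !V //; ring.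
Qed.

(** One coordinate of a nested sequence of bisected rectangles: [u n] is the lower end and W / 2^n
    the side. *)
Lemma nested_dyadic (u : nat -> R) (W : R) : 0 <= W ->
  (forall n, u n <= u n.+1 <= u n + W / 2 ^+ n.+1) ->
  exists p, forall n, u n <= p <= u n + W / 2 ^+ n.
Proof.
move=> W0 hu.
have inc n k : u n <= u (n + k)%N.
  by elim: k => [|k IH]; rewrite ?addn0 // addnS (le_trans IH) //; case/andP: (hu (n + k)%N).
have dec n k : u (n + k)%N + W / 2 ^+ (n + k) <= u n + W / 2 ^+ n.
  elim: k => [|k]; rewrite ?addn0 // addnS; apply: le_trans.
  case/andP: (hu (n + k)%N) => _ H.
  have -> : W / 2 ^+ (n + k) = W / 2 ^+ (n + k).+1 + W / 2 ^+ (n + k).+1.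
    by rewrite exprS; field.
  by rewrite addrA lerD2r.
have pos n : 0 <= W / 2 ^+ n by rewrite divr_ge0 // exprn_ge0.
have ub n m : u m <= u n + W / 2 ^+ n.
  have [/subnKC <-|/ltnW/subnKC <-] := leqP n m.
    by apply: le_trans (dec _ (m - n)%N); rewrite lerDl.
  by apply: le_trans (inc m (n - m)%N) _; rewrite lerDl.
have hs : has_sup (range u).
  split; first by exists (u 0%N); exists 0%N.
  by exists (u 0%N + W / 2 ^+ 0) => _ [m _ <-]; exact: ub.
exists (sup (range u)) => n; apply/andP; split.
  by apply: sup_upper_bound => //; exists n.
apply: ge_sup; first by exists (u 0%N); exists 0%N.
by move=> _ [m _ <-]; exact: ub.
Qed.

Lemma archi_dyadic (W d : R) : 0 < d -> exists n, W / 2 ^+ n < d.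
Proof.
move=> d0; have [n Hn] : exists n : nat, W / d < n%:R.
  by exists (Num.truncn (W / d)).+1; rewrite truncnS_gt.
exists n; rewrite ltr_pdivrMr ?exprn_gt0 // mulrC -ltr_pdivrMr //.
apply: lt_trans Hn _; rewrite -natrX ltr_nat; exact: ltn_expl.
Qed.

Lemma segment_dist (x h a b : R) : x <= a -> a <= x + h -> x <= b -> b <= x + h ->
  `|a - b| <= h.
Proof. by move=> *; rewrite ler_norml; apply/andP; split; lra. Qed.

Theorem goursat f x1 x2 y1 y2 : x1 <= x2 -> y1 <= y2 ->
  onrect x1 x2 y1 y2 (cdiff f) -> rectI f x1 x2 y1 y2 = 0.
Proof.
move=> x12 y12 df.
have cf : onrect x1 x2 y1 y2 (cont f) by move=> x y xx yy; exact/cdiff_cont/df.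
pose W := x2 - x1; pose H := y2 - y1.
have W0 : 0 <= W by rewrite subr_ge0.
have H0 : 0 <= H by rewrite subr_ge0.
have pw n : 0 <= W / 2 ^+ n by rewrite divr_ge0 // exprn_ge0.
have ph n : 0 <= H / 2 ^+ n by rewrite divr_ge0 // exprn_ge0.
apply/eqP; rewrite -nrm_eq0; apply/negPn/negP => Ine.
have I0 : 0 < nrm (rectI f x1 x2 y1 y2) by rewrite lt_neqAle eq_sym Ine nrm_ge0.
(* With this e the error of the affine approximation, integrated over a rectangle, stays below what
   the bisection preserves. *)
have [e e0 He] : exists2 e : R, 0 < e &
    2 * e * (W + H) ^+ 2 < nrm (rectI f x1 x2 y1 y2).
  exists (nrm (rectI f x1 x2 y1 y2) / (2 * (1 + (W + H) ^+ 2))).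
    by rewrite divr_gt0 // mulr_gt0 // ltr_pwDl // sqr_ge0.
  have q0 : 0 < 1 + (W + H) ^+ 2 by rewrite ltr_pwDl // sqr_ge0.
  set q := 1 + _ in q0 *.
  have -> : 2 * (nrm (rectI f x1 x2 y1 y2) / (2 * q)) * (W + H) ^+ 2 =
    nrm (rectI f x1 x2 y1 y2) * ((W + H) ^+ 2 / q) by field; rewrite gt_eqF.
  by rewrite -[ltRHS]mulr1 ltr_pM2l // ltr_pdivrMr // mul1r /q ltrDr.
(* [p] is the lower left corner. The lower bound on the integral is divided by 4 at each stage, so
   one of the four quarters of a bad rectangle is bad. *)
pose bad n (p : R * R) := [/\ x1 <= p.1, p.1 + W / 2 ^+ n <= x2,
  y1 <= p.2, p.2 + H / 2 ^+ n <= y2 &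
  2 * e * ((W + H) / 2 ^+ n) ^+ 2 <
    nrm (rectI f p.1 (p.1 + W / 2 ^+ n) p.2 (p.2 + H / 2 ^+ n))].
have step n p : bad n p -> exists q, [/\ bad n.+1 q,
    p.1 <= q.1 <= p.1 + W / 2 ^+ n.+1 & p.2 <= q.2 <= p.2 + H / 2 ^+ n.+1].
  case: p => x y [/= hx1 hx2 hy1 hy2 hI].
  have Ew : W / 2 ^+ n = W / 2 ^+ n.+1 + W / 2 ^+ n.+1 by rewrite exprS; field.
  have Eh : H / 2 ^+ n = H / 2 ^+ n.+1 + H / 2 ^+ n.+1 by rewrite exprS; field.
  have pw1 := pw n.+1; have ph1 := ph n.+1.
  set w := W / 2 ^+ n.+1 in Ew pw1 *; set h := H / 2 ^+ n.+1 in Eh ph1 *.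
  have Ewh : (W + H) / 2 ^+ n.+1 = w + h by rewrite mulrDl.
  rewrite (mulrDl W H) Ew Eh in hI; rewrite Ew in hx2; rewrite Eh in hy2.
  have cfr : onrect x (x + (w + w)) y (y + (h + h)) (cont f).
    by apply: onrectS cf => //.
  have cfr1 : onrect x (x + w) y (y + (h + h)) (cont f).
    by apply: onrectS cfr => //; lra.
  have cfr2 : onrect (x + w) (x + (w + w)) y (y + (h + h)) (cont f).
    by apply: onrectS cfr => //; lra.
  have [l1 l2] : x <= x + w /\ x + w <= x + (w + w) by rewrite lerD2l !lerDl.
  have [l3 l4] : y <= y + h /\ y + h <= y + (h + h) by rewrite lerD2l !lerDl.
  rewrite (rectI_splitx l1 l2 (le_trans l3 l4) cfr) in hI.
  rewrite (rectI_splity l1 l3 l4 cfr1) (rectI_splity l2 l3 l4 cfr2) in hI.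
  rewrite !(addrA x w) !(addrA y h) in hI.
  apply: contrapT => /forallNP Hn.
  have Hn' q : x <= q.1 <= x + w -> y <= q.2 <= y + h ->
     nrm (rectI f q.1 (q.1 + w) q.2 (q.2 + h)) <= 2 * e * (w + h) ^+ 2.
    move=> /andP[q1 q2] /andP[q3 q4]; rewrite leNgt; apply/negP => Hlt.
    apply: (Hn q); split; rewrite ?q1 ?q2 ?q3 ?q4 //.
    split; rewrite ?Ewh -?/w -?/h //; clear -q1 q2 q3 q4 hx1 hx2 hy1 hy2; lra.
  have := Hn' (x, y); rewrite /= !lexx !lerDl pw1 ph1 => /(_ isT isT) B1.
  have := Hn' (x, y + h); rewrite /= !lexx !lerDl pw1 ph1 => /(_ isT isT) B2.
  have := Hn' (x + w, y); rewrite /= !lexx !lerDl pw1 ph1 => /(_ isT isT) B3.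
  have := Hn' (x + w, y + h); rewrite /= !lexx !lerDl pw1 ph1 => /(_ isT isT) B4.
  move: hI; rewrite ltNge => /negP; apply.
  set a := rectI _ _ _ _ _ in B1 *; set b := rectI _ _ _ _ _ in B2 *.
  set c := rectI _ _ _ _ _ in B3 *; set d := rectI _ _ _ _ _ in B4 *.
  have k1 := nrmD (a + b) (c + d); have k2 := nrmD c d; have k3 := nrmD a b.
  have -> : (w + w + (h + h)) ^+ 2 = 4 * (w + h) ^+ 2 by ring.
  clearbody a b c d; clear -B1 B2 B3 B4 k1 k2 k3; lra.
have bad0 : bad 0%N (x1, y1).
  have EW : x1 + W / 2 ^+ 0 = x2 by rewrite expr0 divr1 /W addrC subrK.
  have EH : y1 + H / 2 ^+ 0 = y2 by rewrite expr0 divr1 /H addrC subrK.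
  by split; rewrite /= ?EW ?EH ?lexx // expr0 divr1.
pose nxt n p := xget p [set q | [/\ bad n.+1 q,
    p.1 <= q.1 <= p.1 + W / 2 ^+ n.+1 & p.2 <= q.2 <= p.2 + H / 2 ^+ n.+1]].
pose s := fix s n := if n is m.+1 then nxt m (s m) else (x1, y1).
have nxtE n p : bad n p -> [/\ bad n.+1 (nxt n p),
    p.1 <= (nxt n p).1 <= p.1 + W / 2 ^+ n.+1 & p.2 <= (nxt n p).2 <= p.2 + H / 2 ^+ n.+1].
  by move=> /step ex; exact: (xgetPex p ex).
have bads n : bad n (s n).
  by elim: n => [|n IH]; [exact: bad0|case: (nxtE n _ IH)].
have nxtP n : (s n).1 <= (s n.+1).1 <= (s n).1 + W / 2 ^+ n.+1 /\
    (s n).2 <= (s n.+1).2 <= (s n).2 + H / 2 ^+ n.+1.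
  by have [_ h1 h2] := nxtE n _ (bads n).
have [px pxP] := nested_dyadic W0 (fun n => (nxtP n).1).
have [py pyP] := nested_dyadic H0 (fun n => (nxtP n).2).
have dp : cdiff f (px +i* py).
  have /andP[a1 a2] := pxP 0%N; have /andP[a3 a4] := pyP 0%N.
  move: a1 a2 a3 a4; rewrite /= expr0 !divr1 /W /H !(addrC _ (_ - _)) !subrK => a1 a2 a3 a4.
  by apply: df; apply/andP.
move: dp => [l] /isd_eps /(_ e e0) [d d0 dP].
have [n Hn] := archi_dyadic (W + H) d0.
have [/= hx1 hx2 hy1 hy2] := bads n.
have /andP[hx3 hx4] := pxP n; have /andP[hy3 hy4] := pyP n.
have pwn := pw n; have phn := ph n.
move: (s n) hx1 hx2 hy1 hy2 hx3 hx4 hy3 hy4 => [x y] /=.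
rewrite (mulrDl W H) in Hn *.
set w := W / 2 ^+ n in Hn pwn *; set h := H / 2 ^+ n in Hn phn *.
move=> hx1 hx2 hy1 hy2 hx3 hx4 hy3 hy4; rewrite ltNge => /negP; apply.
pose p := px +i* py; pose aff z := f p + l * (z - p); pose r z := f z - aff z.
have daff z : cdiff aff z.
  apply: cdiffD; first exact: cdiff_cst.
  by apply: cdiffM; [exact: cdiff_cst|apply: cdiffB; [exact: cdiff_id|exact: cdiff_cst]].
have cfr : onrect x (x + w) y (y + h) (cont f) by apply: onrectS cf.
have cr : onrect x (x + w) y (y + h) (cont r).
  by move=> a b ha hb; apply: contB; [exact: cfr|exact/cdiff_cont/daff].
have caff : onrect x (x + w) y (y + h) (cont aff).
  by move=> a b ha hb; exact/cdiff_cont/daff.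
have xw : x <= x + w by rewrite lerDl.
have yh : y <= y + h by rewrite lerDl.
(* The affine part of [f] at [p] has a primitive, so only the remainder [r] contributes. *)
have -> : rectI f x (x + w) y (y + h) = rectI r x (x + w) y (y + h).
  have -> : rectI f x (x + w) y (y + h) = rectI (fun z => r z + aff z) x (x + w) y (y + h).
    by apply: rectI_ext => //; apply: onrect_bd => // a b _ _; rewrite subrK.
  rewrite rectID ?(@rectI_prim (fun z => (f p - l * p) * z + l / 2 * z ^+ 2) aff) ?addr0 //; try exact: onrect_bd.
  move=> a b _ _; set z := a +i* b.
  have := isdD (isdM (isd_cst (f p - l * p) z) (isd_id z))
    (isdM (isd_cst (l / 2) z) (isdX 2 (isd_id z))).
  by congr (isd _ _ _); rewrite /aff /= expr1; field.
apply: le_trans (nrm_rectI (M := e * (w + h)) xw yh (onrect_bd xw yh cr) _) _; last first.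
  by apply: le_of_eq; ring.
apply: onrect_bd => // a b /andP[ha1 ha2] /andP[hb1 hb2].
have Hz : nrm ((a +i* b) - p) <= w + h.
  apply: le_trans (nrm_le_ReIm _) _; rewrite !ReIm /=.
  by apply: lerD; [exact: segment_dist ha1 ha2 hx3 hx4|exact: segment_dist hb1 hb2 hy3 hy4].
have := dP (a +i* b); rewrite -/p => /(_ (le_lt_trans Hz Hn)).
have -> : r (a +i* b) = f (a +i* b) - f p - l * (a +i* b - p) by rewrite /r /aff; ring.
by move=> /le_trans; apply; rewrite ler_wpM2l // ltW.
Qed.

End Goursat.

(** * Exceptional points and Cauchy integrals *)

Section Cauchy.
Variable R : realType.
Local Notation C := R[i].
Implicit Types (x y t : R) (f g k : C -> C) (z w p q : C).

Lemma rectI_xx f x y1 y2 : rectI f x x y1 y2 = 0.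
Proof. by rewrite /rectI subrr mulr0 !cint_le // !cu_eq0 // subrr addr0. Qed.

Lemma rectI_yy f x1 x2 y : rectI f x1 x2 y y = 0.
Proof. by rewrite /rectI subrr !cint_le // !cu_eq0 // subrr mulr0 addr0. Qed.

(** Mere continuity at [p] suffices: cut out a small rectangle around [p]. The remaining pieces miss
    [p] and integrate to 0, while the small one is of the order of its perimeter. *)
Lemma rectI_exc f p x1 x2 y1 y2 : x1 <= x2 -> y1 <= y2 ->
  onrect x1 x2 y1 y2 (cont f) ->
  (forall a1 a2 b1 b2, x1 <= a1 -> a1 <= a2 -> a2 <= x2 ->
     y1 <= b1 -> b1 <= b2 -> b2 <= y2 ->
     ~ (a1 <= Re p <= a2 /\ b1 <= Im p <= b2) -> rectI f a1 a2 b1 b2 = 0) ->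
  rectI f x1 x2 y1 y2 = 0.
Proof.
move=> x12 y12 cf H0.
have [[/andP[px1 px2] /andP[py1 py2]]|] :=
  pselect (x1 <= Re p <= x2 /\ y1 <= Im p <= y2); last exact: H0.
apply/eqP; rewrite -nrm_eq0; apply/negPn/negP => Ine.
have I0 : 0 < nrm (rectI f x1 x2 y1 y2) by rewrite lt_neqAle eq_sym Ine nrm_ge0.
have cp : cont f p by case: (p) px1 px2 py1 py2 => x y /= *; apply: cf; apply/andP.
have /nearC[d d0 dP] := cp 1 ltr01.
pose M := nrm (f p) + 1.
have M0 : 0 < M by rewrite ltr_wpDl // nrm_ge0.
(* The small rectangle has perimeter at most 8 e, so its integral is at most 8 e M, half of the
   supposed value. *)
pose e := Num.min (d / 4) (nrm (rectI f x1 x2 y1 y2) / (16 * M)).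
have e0 : 0 < e by rewrite lt_min !divr_gt0 // mulr_gt0.
have ed : e <= d / 4 by rewrite ge_min lexx.
have eI : e * (16 * M) <= nrm (rectI f x1 x2 y1 y2).
  by rewrite -ler_pdivlMr ?mulr_gt0 // ge_min lexx orbT.
clearbody e.
pose A := Num.max x1 (Re p - e); pose B := Num.min x2 (Re p + e).
pose G := Num.max y1 (Im p - e); pose K := Num.min y2 (Im p + e).
have xA : x1 <= A by rewrite le_max lexx.
have yG : y1 <= G by rewrite le_max lexx.
have Bx : B <= x2 by rewrite ge_min lexx.
have Ky : K <= y2 by rewrite ge_min lexx.
have Ap : A <= Re p by rewrite ge_max px1 gerBl ltW.
have Gp : G <= Im p by rewrite ge_max py1 gerBl ltW.
have pB : Re p <= B by rewrite le_min px2 lerDl ltW.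
have pK : Im p <= K by rewrite le_min py2 lerDl ltW.
have Ae : Re p - e <= A by rewrite le_max lexx orbT.
have Ge : Im p - e <= G by rewrite le_max lexx orbT.
have Be : B <= Re p + e by rewrite ge_min lexx orbT.
have Ke : K <= Im p + e by rewrite ge_min lexx orbT.
have AB := le_trans Ap pB; have GK := le_trans Gp pK.
have cf1 : onrect A x2 y1 y2 (cont f) by apply: onrectS cf.
have cf2 : onrect A B y1 y2 (cont f) by apply: onrectS cf.
have cf3 : onrect A B G y2 (cont f) by apply: onrectS cf.
have cf4 : onrect A B G K (cont f) by apply: onrectS cf.
have Ax2 := le_trans AB Bx; have Gy2 := le_trans GK Ky.
have E : rectI f x1 x2 y1 y2 = rectI f A B G K.
  rewrite (@rectI_splitx _ f x1 A) // (@rectI_splitx _ f A B x2) //.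
  rewrite (@rectI_splity _ f A B y1 G) // (@rectI_splity _ f A B G K) //.
  have -> : rectI f x1 A y1 y2 = 0.
    have [->|Axx] := eqVneq A x1; first exact: rectI_xx.
    apply: H0 => //.
    move=> [/andP[_ pA] _]; move: Axx; rewrite /A in pA *.
    by case: (leP (Re p - e) x1) pA => [_ _|_]; rewrite ?eqxx //; lra.
  have -> : rectI f B x2 y1 y2 = 0.
    have [->|Axx] := eqVneq B x2; first exact: rectI_xx.
    apply: H0 => //; first exact: le_trans AB.
    move=> [/andP[pA _] _]; move: Axx; rewrite /B in pA *.
    by case: (leP x2 (Re p + e)) pA => [_ _|_]; rewrite ?eqxx //; lra.
  have -> : rectI f A B y1 G = 0.
    have [->|Axx] := eqVneq G y1; first exact: rectI_yy.
    apply: H0 => //.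
    move=> [_ /andP[_ pA]]; move: Axx; rewrite /G in pA *.
    by case: (leP (Im p - e) y1) pA => [_ _|_]; rewrite ?eqxx //; lra.
  have -> : rectI f A B K y2 = 0.
    have [->|Axx] := eqVneq K y2; first exact: rectI_yy.
    apply: H0 => //; first exact: le_trans GK.
    move=> [_ /andP[pA _]]; move: Axx; rewrite /K in pA *.
    by case: (leP y2 (Im p + e)) pA => [_ _|_]; rewrite ?eqxx //; lra.
  by rewrite addr0 !add0r addr0.
clearbody A B G K.
have fM : onbd A B G K (fun z => nrm (f z) <= M).
  apply: onrect_bd => // x y /andP[? ?] /andP[? ?].
  have := dP (x +i* y); set z := x +i* y => /(_ _) Hz.
  have : nrm (f z - f p) < 1.
    apply: Hz; apply: le_lt_trans (nrm_le_ReIm _) _; rewrite !ReIm /=.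
    apply: (@le_lt_trans _ _ (e + e)); last lra.
    by apply: lerD; rewrite ler_norml; apply/andP; split; lra.
  have := nrm_sub (f z) (f p); rewrite /M; lra.
have := nrm_rectI AB GK (onrect_bd AB GK cf4) fM.
rewrite -E.
have : M * (2 * (B - A + (K - G))) <= M * (8 * e).
  by rewrite ler_wpM2l ?(ltW M0) //; lra.
lra.
Qed.

Lemma goursat1 f p x1 x2 y1 y2 : x1 <= x2 -> y1 <= y2 ->
  onrect x1 x2 y1 y2 (cont f) -> onrect x1 x2 y1 y2 (fun z => z != p -> cdiff f z) ->
  rectI f x1 x2 y1 y2 = 0.
Proof.
move=> x12 y12 cf df; apply: (@rectI_exc _ p) => // a1 a2 b1 b2 xa a12 ax yb b12 by_ np.
apply: goursat => // x y /andP[ax1 ax2] /andP[by1 by2]; apply: df.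
- by rewrite (le_trans xa) // (le_trans ax2).
- by rewrite (le_trans yb) // (le_trans by2).
- by apply: contra_notN np => /eqP <- /=; rewrite ax1 ax2 by1 by2.
Qed.

(** Two exceptional points occur together in Cauchy's formula: the pole of the difference quotient
    and a point where the function is only known to be continuous. *)
Lemma goursat2 f p q x1 x2 y1 y2 : x1 <= x2 -> y1 <= y2 ->
  onrect x1 x2 y1 y2 (cont f) ->
  onrect x1 x2 y1 y2 (fun z => z != p -> z != q -> cdiff f z) ->
  rectI f x1 x2 y1 y2 = 0.
Proof.
move=> x12 y12 cf df; apply: (@rectI_exc _ p) => // a1 a2 b1 b2 xa a12 ax yb b12 by_ np.
apply: (@goursat1 _ q) => //; first by apply: onrectS cf.
move=> x y /andP[ax1 ax2] /andP[by1 by2]; apply: df.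
- by rewrite (le_trans xa) // (le_trans ax2).
- by rewrite (le_trans yb) // (le_trans by2).
- by apply: contra_notN np => /eqP <- /=; rewrite ax1 ax2 by1 by2.
Qed.

Lemma contI_bounded (f : R -> C) a b : contI a b f ->
  exists M : R, forall t, a <= t <= b -> nrm (f t) <= M.
Proof.
have [ab cf|ba _] := leP a b; last first.
  by exists 0 => t /andP[at_ tb]; have := le_lt_trans (le_trans at_ tb) ba; rewrite ltxx.
have cn : {within `[a, b], continuous (fun t => nrm (f t))}.
  apply: continuous_in_subspaceT => t; rewrite inE /= in_itv /= => tab.
  exact/cont_nrm/cf.
have [c _ cP] := EVT_max ab cn; exists (nrm (f c)) => t tab.
by apply: cP; rewrite in_itv.
Qed.

Lemma onbd_bounded k x1 x2 y1 y2 : onbd x1 x2 y1 y2 (cont k) ->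
  exists2 M : R, 0 < M & onbd x1 x2 y1 y2 (fun z => nrm (k z) <= M).
Proof.
move=> /onbd_cont[h1 h2 v1 v2].
have [M1 H1] := contI_bounded h1; have [M2 H2] := contI_bounded h2.
have [M3 H3] := contI_bounded v1; have [M4 H4] := contI_bounded v2.
exists (1 + `|M1| + `|M2| + `|M3| + `|M4|).
  by rewrite !ltr_pwDl.
have [] := And4 (ler_norm M1) (ler_norm M2) (ler_norm M3) (ler_norm M4).
have [] := And4 (normr_ge0 M1) (normr_ge0 M2) (normr_ge0 M3) (normr_ge0 M4).
move=> *; split=> t tt; [have := H1 t tt|have := H2 t tt|have := H3 t tt|have := H4 t tt];
  lra.
Qed.

Definition inrect x1 x2 y1 y2 w := x1 < Re w < x2 /\ y1 < Im w < y2.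

Lemma inrect_dist x1 x2 y1 y2 w : inrect x1 x2 y1 y2 w ->
  exists2 r : R, 0 < r & onbd x1 x2 y1 y2 (fun z => r <= nrm (z - w)).
Proof.
move=> [/andP[a1 a2] /andP[b1 b2]].
exists (Num.min (Num.min (Re w - x1) (x2 - Re w)) (Num.min (Im w - y1) (y2 - Im w))).
  by rewrite !lt_min !subr_gt0 a1 a2 b1 b2.
set r := Num.min _ _.
have r1 : r <= Re w - x1 by rewrite !ge_min lexx.
have r2 : r <= x2 - Re w by rewrite !ge_min lexx orbT.
have r3 : r <= Im w - y1 by rewrite !ge_min lexx !orbT.
have r4 : r <= y2 - Im w by rewrite !ge_min lexx !orbT.
clearbody r; split=> t _.
- by apply: le_trans (Im_le_nrm _); rewrite !ReIm /= ler_normr; apply/orP; right; lra.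
- by apply: le_trans (Im_le_nrm _); rewrite !ReIm /= ler_normr; apply/orP; left; lra.
- by apply: le_trans (Re_le_nrm _); rewrite !ReIm /= ler_normr; apply/orP; right; lra.
- by apply: le_trans (Re_le_nrm _); rewrite !ReIm /= ler_normr; apply/orP; left; lra.
Qed.

Lemma inrect_near x1 x2 y1 y2 w : inrect x1 x2 y1 y2 w ->
  \forall v \near w, inrect x1 x2 y1 y2 v.
Proof.
move=> [/andP[a1 a2] /andP[b1 b2]]; apply/nearC.
exists (Num.min (Num.min (Re w - x1) (x2 - Re w)) (Num.min (Im w - y1) (y2 - Im w))).
  by rewrite !lt_min !subr_gt0 a1 a2 b1 b2.
move=> v; rewrite !lt_min => /andP[/andP[c1 c2] /andP[c3 c4]].
have := Re_le_nrm (v - w); have := Im_le_nrm (v - w); rewrite !ReIm !ler_norml.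
by move=> /andP[? ?] /andP[? ?]; split; apply/andP; split; lra.
Qed.

(** Not normalised by 2 pi i: the role of that constant is played by the same integral for the
    constant function 1. *)
Definition cauchyI k x1 x2 y1 y2 n w := rectI (fun z => k z * (z - w) ^- n) x1 x2 y1 y2.

Lemma inv_taylor1 (u h : C) (r : R) : 0 < r -> r <= nrm u -> nrm h <= r / 2 ->
  nrm ((u - h)^-1 - u^-1 - h * u^-2) <= 2 / r ^+ 3 * nrm h ^+ 2.
Proof.
move=> r0 ru hr; have un0 : 0 < nrm u by lra.
have uh : r / 2 <= nrm (u - h) by have := nrm_sub u h; lra.
have u0 : u != 0 by rewrite -nrm_gt0.
have uh0 : u - h != 0 by rewrite -nrm_gt0; lra.
have -> : (u - h)^-1 - u^-1 - h * u^-2 = h ^+ 2 / (u ^+ 2 * (u - h)) by field; rewrite ?u0 ?uh0.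
rewrite nrm_div nrmX nrmM nrmX mulrC ler_wpM2r ?sqr_ge0 //.
have -> : 2 / r ^+ 3 = (r ^+ 2 * (r / 2))^-1 by field; rewrite gt_eqF.
rewrite lef_pV2 ?posrE ?mulr_gt0 ?exprn_gt0 ?divr_gt0 //; last lra.
apply: ler_pM => //; first by rewrite exprn_ge0 // ltW.
- by rewrite divr_ge0 // ltW.
- by rewrite lerXn2r // nnegrE ltW.
Qed.

Lemma inv_taylor2 (u h : C) (r : R) : 0 < r -> r <= nrm u -> nrm h <= r / 2 ->
  nrm ((u - h) ^- 2 - u ^- 2 - h * (2 * u ^- 3)) <= 16 / r ^+ 4 * nrm h ^+ 2.
Proof.
move=> r0 ru hr; have un0 : 0 < nrm u by lra.
have uh : r / 2 <= nrm (u - h) by have := nrm_sub u h; lra.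
have u0 : u != 0 by rewrite -nrm_gt0.
have uh0 : u - h != 0 by rewrite -nrm_gt0; lra.
have -> : (u - h) ^- 2 - u ^- 2 - h * (2 * u ^- 3) =
    h ^+ 2 * ((3 * u - 2 * h) / u) / (u ^+ 2 * (u - h) ^+ 2) by field; rewrite ?u0 ?uh0.
have H4 : nrm ((3 * u - 2 * h) / u) <= 4.
  rewrite nrm_div ler_pdivrMr //; apply: le_trans (nrmB _ _) _; rewrite !nrmM.
  by rewrite -[3]/(3%:R) -[2]/(2%:R) -!(rmorph_nat (real_complex R)) !nrmR !normr_nat; lra.
rewrite nrm_div (nrmM (h ^+ 2)) (nrmM (u ^+ 2)) !nrmX mulrC.
have -> : 16 / r ^+ 4 * nrm h ^+ 2 = (r ^+ 2 * (r / 2) ^+ 2)^-1 * (nrm h ^+ 2 * 4).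
  by field; rewrite gt_eqF.
apply: ler_pM; rewrite ?invr_ge0 ?mulr_ge0 ?exprn_ge0 ?nrm_ge0 //; last first.
  by rewrite ler_wpM2l ?sqr_ge0.
rewrite lef_pV2 ?posrE ?mulr_gt0 ?exprn_gt0 ?divr_gt0 //; last lra.
apply: ler_pM => //; first by rewrite exprn_ge0 // ltW.
- by rewrite exprn_ge0 // divr_ge0 // ltW.
- by rewrite lerXn2r // nnegrE ltW.
- by rewrite lerXn2r // nnegrE ?divr_ge0 ?nrm_ge0 // ltW.
by lra.
Qed.

Lemma onbd_cauchy_cont k x1 x2 y1 y2 w n : inrect x1 x2 y1 y2 w ->
  onbd x1 x2 y1 y2 (cont k) -> onbd x1 x2 y1 y2 (cont (fun z => k z * (z - w) ^- n)).
Proof.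
move=> /inrect_dist[r r0 rP] ck; apply: onbdS (onbdI rP ck) => z [rz cz].
apply: contM => //; apply: cdiff_cont; apply: cdiffV.
  by apply: cdiffX; apply: cdiffB; [exact: cdiff_id|exact: cdiff_cst].
by rewrite expf_neq0 // -nrm_gt0 (lt_le_trans r0).
Qed.

Lemma rectI_lin3 f g k (p q : C) x1 x2 y1 y2 : x1 <= x2 -> y1 <= y2 ->
  onbd x1 x2 y1 y2 (cont f) -> onbd x1 x2 y1 y2 (cont g) -> onbd x1 x2 y1 y2 (cont k) ->
  rectI (fun z => f z + (p * g z + q * k z)) x1 x2 y1 y2 =
  rectI f x1 x2 y1 y2 + (p * rectI g x1 x2 y1 y2 + q * rectI k x1 x2 y1 y2).
Proof.
move=> x12 y12 cf cg ck.
have cZ (a : C) (u : C -> C) : onbd x1 x2 y1 y2 (cont u) ->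
    onbd x1 x2 y1 y2 (cont (fun z => a * u z)).
  by apply: onbdS => z cz; apply: contM => //; exact: cont_cst.
have cD (u1 u2 : C -> C) : onbd x1 x2 y1 y2 (cont u1) -> onbd x1 x2 y1 y2 (cont u2) ->
    onbd x1 x2 y1 y2 (cont (fun z => u1 z + u2 z)).
  by move=> c1 c2; apply: onbdS (onbdI c1 c2) => z [? ?]; exact: contD.
have cg' := cZ p _ cg; have ck' := cZ q _ ck.
by rewrite rectID ?rectID ?rectIZ //; exact: cD.
Qed.

(** Differentiation under the integral sign. The last hypothesis is the Taylor estimate for u^-n at
    distance at least r from the pole. *)
Lemma isd_cauchyI k x1 x2 y1 y2 w (n : nat) (r K : R) (c : C) :
  x1 <= x2 -> y1 <= y2 ->
  onbd x1 x2 y1 y2 (cont k) -> inrect x1 x2 y1 y2 w -> 0 < r ->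
  onbd x1 x2 y1 y2 (fun z => r <= nrm (z - w)) ->
  (forall u h : C, r <= nrm u -> nrm h <= r / 2 ->
     nrm ((u - h) ^- n - u ^- n - h * (c * u ^- n.+1)) <= K * nrm h ^+ 2) ->
  isd (cauchyI k x1 x2 y1 y2 n) w (c * cauchyI k x1 x2 y1 y2 n.+1 w).
Proof.
move=> x12 y12 ck iw r0 rP HK.
have [M M0 MP] := onbd_bounded ck.
pose L := M * (2 * (x2 - x1 + (y2 - y1))) * K.
have [d1 d10 d1P] := (nearC w _).1 (inrect_near iw).
apply/isd_eps => e e0.
pose d := Num.min (Num.min d1 (r / 2)) (e / (1 + `|L|)).
have L1 : 0 < 1 + `|L| by rewrite ltr_pwDl.
have d0 : 0 < d by rewrite !lt_min d10 !divr_gt0.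
exists d => // v; rewrite !lt_min => /andP[/andP[vd vr] ve].
have iv := d1P v vd.
set h := v - w in vr ve *.
have cv := onbd_cauchy_cont n iv ck; have cw := onbd_cauchy_cont n iw ck.
have cw1 := onbd_cauchy_cont n.+1 iw ck.
pose rem z := k z * ((z - v) ^- n - (z - w) ^- n - h * (c * (z - w) ^- n.+1)).
have remE : rem = (fun z => k z * (z - v) ^- n +
     (-1 * (k z * (z - w) ^- n) + (- (h * c)) * (k z * (z - w) ^- n.+1))).
  by apply/funext => x; rewrite /rem; ring.
have crem : onbd x1 x2 y1 y2 (cont rem).
  rewrite remE; apply: onbdS (onbdI cv (onbdI cw cw1)) => z [c1 [c2 c3]].
  apply: contD; first exact: c1.
  by apply: contD; apply: contM => //; exact: cont_cst.
have -> : cauchyI k x1 x2 y1 y2 n v - cauchyI k x1 x2 y1 y2 n w -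
   c * cauchyI k x1 x2 y1 y2 n.+1 w * h = rectI rem x1 x2 y1 y2.
  have lin (u1 u2 u3 : C) : u1 - u2 - c * u3 * h = u1 + (-1 * u2 + (- (h * c)) * u3) by ring.
  have L3 := rectI_lin3 (-1) (- (h * c)) x12 y12 cv cw cw1.
  rewrite remE; apply: etrans (esym L3).
  exact: lin.
have remM : onbd x1 x2 y1 y2 (fun z => nrm (rem z) <= M * (K * nrm h ^+ 2)).
  apply: onbdS (onbdI MP rP) => z [Mz rz]; rewrite /rem nrmM.
  apply: ler_pM; rewrite ?nrm_ge0 //.
  have -> : z - v = z - w - h by rewrite /h; ring.
  by apply: HK => //; exact: ltW.
apply: le_trans (nrm_rectI x12 y12 crem remM) _.
have -> : M * (K * nrm h ^+ 2) * (2 * (x2 - x1 + (y2 - y1))) = L * nrm h * nrm h.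
  by rewrite /L; ring.
rewrite ler_wpM2r ?nrm_ge0 //.
apply: le_trans (_ : (1 + `|L|) * nrm h <= _).
  by rewrite ler_wpM2r ?nrm_ge0 //; have := ler_norm L; lra.
by move: ve; rewrite ltr_pdivlMr // mulrC => /ltW.
Qed.

Lemma isd_cauchyI1 k x1 x2 y1 y2 w : x1 <= x2 -> y1 <= y2 ->
  onbd x1 x2 y1 y2 (cont k) -> inrect x1 x2 y1 y2 w ->
  isd (cauchyI k x1 x2 y1 y2 1) w (cauchyI k x1 x2 y1 y2 2 w).
Proof.
move=> x12 y12 ck iw; have [r r0 rP] := inrect_dist iw.
rewrite -[cauchyI _ _ _ _ _ 2 w]mul1r.
apply: (isd_cauchyI (r := r) (K := 2 / r ^+ 3)) => // u h ru hr.
by rewrite mul1r !expr1; exact: inv_taylor1.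
Qed.

Lemma isd_cauchyI2 k x1 x2 y1 y2 w : x1 <= x2 -> y1 <= y2 ->
  onbd x1 x2 y1 y2 (cont k) -> inrect x1 x2 y1 y2 w ->
  isd (cauchyI k x1 x2 y1 y2 2) w (2 * cauchyI k x1 x2 y1 y2 3 w).
Proof.
move=> x12 y12 ck iw; have [r r0 rP] := inrect_dist iw.
by apply: (isd_cauchyI (r := r) (K := 16 / r ^+ 4)) => // u h ru hr; exact: inv_taylor2.
Qed.

Lemma Re_inv z : Re z^-1 = Re z / nrm z ^+ 2.
Proof. by rewrite nrm_sqr; case: z. Qed.
Lemma Im_inv z : Im z^-1 = - (Im z / nrm z ^+ 2).
Proof. by rewrite nrm_sqr; case: z. Qed.

(* Each edge of the rectangle turns counterclockwise around [w], so the imaginary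
   part of the integral of [1 / (z - w)] is positive; its value is not needed. *)
Lemma cauchyI_neq0 x1 x2 y1 y2 w : inrect x1 x2 y1 y2 w ->
  cauchyI (fun _ => 1) x1 x2 y1 y2 1 w != 0.
Proof.
move=> iw; have [/andP[a1 a2] /andP[b1 b2]] := iw.
have x12 : x1 <= x2 by lra.
have y12 : y1 <= y2 by lra.
have ck : onbd x1 x2 y1 y2 (cont (fun _ : C => 1 : C)) by split=> t _; exact: cont_cst.
have := onbd_cauchy_cont 1 iw ck.
have -> : (fun z => 1 * (z - w) ^- 1) = (fun z => (z - w)^-1).
  by apply/funext => z; rewrite expr1 mul1r.
move=> cc; suff : 0 < Im (cauchyI (fun _ => 1) x1 x2 y1 y2 1 w).
  by case: eqVneq => // ->; rewrite ltxx.
rewrite /cauchyI.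
have -> : (fun z => 1 * (z - w) ^- 1) = (fun z => (z - w)^-1).
  by apply/funext => z; rewrite expr1 mul1r.
have [h1 h2 v1 v2] := onbd_cont cc.
rewrite /rectI !cint_le // !ReIm /= !mul0r !add0r !mul1r.
set I1 := ru _ _ _; set I2 := ru _ _ _; set I3 := ru _ _ _; set I4 := ru _ _ _.
have p2 : I2 <= 0.
  rewrite /I2 -oppr_ge0 -mulN1r -ruZ; last exact: contI_Im.
  apply: ru_ge0 => t tt; rewrite Im_inv mulN1r opprK !ReIm /=.
  by rewrite divr_ge0 ?sqr_ge0 // subr_ge0 ltW.
have p3 : 0 <= I3.
  by apply: ru_ge0 => t tt; rewrite Re_inv !ReIm /= divr_ge0 ?sqr_ge0 // subr_ge0 ltW.
have p4 : I4 <= 0.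
  rewrite /I4 -oppr_ge0 -mulN1r -ruZ; last exact: contI_Re.
  apply: ru_ge0 => t tt; rewrite Re_inv mulN1r -mulNr !ReIm /=.
  by rewrite divr_ge0 ?sqr_ge0 // opprB subr_ge0 ltW.
have p1 : 0 < I1.
  have D0 : 0 < (x2 - x1 + (y2 - y1)) ^+ 2 by rewrite exprn_gt0 //; lra.
  pose m := (Im w - y1) / (x2 - x1 + (y2 - y1)) ^+ 2.
  have m0 : 0 < m by rewrite divr_gt0 // subr_gt0.
  apply: (@lt_le_trans _ _ (m * (x2 - x1))); first by rewrite mulr_gt0 //; lra.
  rewrite -ru_cst //; apply: ru_le; [exact: rcontI_cst|exact: contI_Im|].
  move=> t /andP[t1 t2]; rewrite Im_inv !ReIm /= -mulNr opprB /m.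
  have nz : 0 < nrm ((t +i* y1) - w).
    rewrite nrm_gt0; apply/negP => /eqP /(congr1 (@complex.Im R)).
    rewrite !ReIm /=; lra.
  rewrite ler_pM2l ?subr_gt0 // lef_pV2 ?posrE ?exprn_gt0 //.
  rewrite lerXn2r ?nnegrE ?nrm_ge0 //; first lra.
  apply: le_trans (nrm_le_ReIm _) _; rewrite !ReIm /=.
  by apply: lerD; rewrite ler_norml; apply/andP; split; lra.
lra.
lra.
Qed.

End Cauchy.

(** * Cauchy's formula and removable singularities *)

Section CauchyFormula.
Variable R : realType.
Local Notation C := R[i].
Implicit Types (x y t : R) (f g k : C -> C) (z w p q : C).

Lemma cauchy_formula g p x1 x2 y1 y2 w :
  onrect x1 x2 y1 y2 (cont g) -> onrect x1 x2 y1 y2 (fun z => z != p -> cdiff g z) ->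
  inrect x1 x2 y1 y2 w -> w != p ->
  cauchyI g x1 x2 y1 y2 1 w = g w * cauchyI (fun _ => 1) x1 x2 y1 y2 1 w.
Proof.
move=> cg dg iw wp; have [/andP[a1 a2] /andP[b1 b2]] := iw.
have x12 : x1 <= x2 by lra.
have y12 : y1 <= y2 by lra.
have [l [q [cq gq ql]]] : cdiff g w.
  by case: (w) a1 a2 b1 b2 wp => x y /= *; apply: dg => //; apply/andP; split; exact: ltW.
have qE z : z != w -> q z = (g z - g w) / (z - w).
  by move=> zw; rewrite gq addrAC subrr add0r mulrC mulKf // subr_eq0.
have Eq z : z != w -> \forall v \near z, (g v - g w) / (v - w) = q v.
  move=> zw; apply/nearC; exists (nrm (z - w)); first by rewrite nrm_gt0 subr_eq0.
  move=> v vz; rewrite qE //; apply: contraTneq vz => ->.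
  by rewrite nrm_distC ltxx.
have dq z : z != w -> cdiff g z -> cdiff q z.
  move=> zw dgz; apply: cdiff_near (Eq z zw) _; apply: cdiff_div.
  - by apply: cdiffB => //; exact: cdiff_cst.
  - by apply: cdiffB; [exact: cdiff_id|exact: cdiff_cst].
  - by rewrite subr_eq0.
have cqr : onrect x1 x2 y1 y2 (cont q).
  move=> x y xx yy; set z := x +i* y.
  have [->//|zw] := eqVneq z w.
  have cgz := cg x y xx yy.
  have : cont (fun v => (g v - g w) / (v - w)) z.
    apply: contM; first by apply: contB => //; exact: cont_cst.
    apply: cdiff_cont; apply: cdiffV; last by rewrite subr_eq0.
    by apply: cdiffB; [exact: cdiff_id|exact: cdiff_cst].
  move=> H e e0; apply: filterS2 (Eq z zw) (H e e0) => v Ev.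
  by rewrite (nbhs_singleton (Eq z zw)) -Ev.
(* The difference quotient is continuous at [w] and [p] and differentiable elsewhere, so Goursat
   applies with both points excepted. *)
have q0 : rectI q x1 x2 y1 y2 = 0.
  apply: (@goursat2 _ _ w p) => // x y xx yy zw zp.
  by apply: dq => //; exact: dg.
have [r r0 rP] := inrect_dist iw.
have cg1 : onbd x1 x2 y1 y2 (cont g) by exact: onrect_bd.
have c1 : onbd x1 x2 y1 y2 (cont (fun _ : C => 1 : C)) by split=> t _; exact: cont_cst.
have cc1 := onbd_cauchy_cont 1 iw c1.
rewrite /cauchyI -(rectIZ _ x12 y12 cc1).
rewrite -[RHS]add0r -q0 -rectID //; last 2 first.
- exact: onrect_bd.
- by apply: onbdS cc1 => z cz; apply: contM => //; exact: cont_cst.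
apply: rectI_ext => //; apply: onbdS rP => z rz.
have zw : z - w != 0 by rewrite -nrm_gt0 (lt_le_trans r0).
have zw' : z != w by rewrite -subr_eq0.
by rewrite (qE _ zw') !expr1 mul1r mulrBl addrC subrK.
Qed.

Definition square p (r : R) P := onrect (Re p - r) (Re p + r) (Im p - r) (Im p + r) P.

Lemma near_square p (P : set C) : (\forall z \near p, P z) -> exists2 r : R, 0 < r & square p r P.
Proof.
move=> /nearC[d d0 dP]; exists (d / 4); first by rewrite divr_gt0.
move=> x y /andP[? ?] /andP[? ?]; apply: dP.
apply: le_lt_trans (nrm_le_ReIm _) _; rewrite !ReIm /=.
apply: (@le_lt_trans _ _ (d / 4 + d / 4)); last lra.
by apply: lerD; rewrite ler_norml; apply/andP; split; lra.
Qed.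

Lemma inrect_square p (r : R) : 0 < r ->
  inrect (Re p - r) (Re p + r) (Im p - r) (Im p + r) p.
Proof. by move=> r0; split; apply/andP; split; lra. Qed.

(** Near [p], [g] is a quotient A / c of Cauchy integrals, both twice differentiable. Removable
    singularities and the differentiability of derivatives are read off this quotient. *)
Lemma cauchy_local g p : cont g p -> (\forall z \near p, z != p -> cdiff g z) ->
  exists A c A' c' : C -> C,
   [/\ \forall z \near p, isd A z (A' z) /\ cdiff A' z,
       \forall z \near p, isd c z (c' z) /\ cdiff c' z,
       \forall z \near p, c z != 0 & \forall z \near p, A z = g z * c z].
Proof.
move=> cg /near_square[r r0 rP].
pose x1 := Re p - r; pose x2 := Re p + r; pose y1 := Im p - r; pose y2 := Im p + r.
have x12 : x1 <= x2 by rewrite /x1 /x2; lra.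
have y12 : y1 <= y2 by rewrite /y1 /y2; lra.
have ip : inrect x1 x2 y1 y2 p by exact: inrect_square.
have cgr : onrect x1 x2 y1 y2 (cont g).
  move=> x y xx yy; set z := x +i* y; have [->//|zp] := eqVneq z p.
  by apply: cdiff_cont; exact: rP.
have cg1 := onrect_bd x12 y12 cgr.
have c1 : onbd x1 x2 y1 y2 (cont (fun _ : C => 1 : C)) by split=> t _; exact: cont_cst.
exists (cauchyI g x1 x2 y1 y2 1), (cauchyI (fun _ => 1) x1 x2 y1 y2 1).
exists (cauchyI g x1 x2 y1 y2 2), (cauchyI (fun _ => 1) x1 x2 y1 y2 2).
have nip := inrect_near ip.
split.
- apply: filterS nip => z iz; split; first exact: isd_cauchyI1.
  by eexists; exact: isd_cauchyI2.
- apply: filterS nip => z iz; split; first exact: isd_cauchyI1.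
  by eexists; exact: isd_cauchyI2.
- by apply: filterS nip => z iz; exact: cauchyI_neq0.
- have main z : inrect x1 x2 y1 y2 z -> z != p ->
     cauchyI g x1 x2 y1 y2 1 z = g z * cauchyI (fun _ => 1) x1 x2 y1 y2 1 z.
    by move=> iz zp; apply: (cauchy_formula (p := p)).
  (* Cauchy's formula excludes the point [p] itself, where it follows by continuity of both
     sides. *)
  suff main_p : cauchyI g x1 x2 y1 y2 1 p = g p * cauchyI (fun _ => 1) x1 x2 y1 y2 1 p.
    apply: filterS nip => z iz; have [->//|zp] := eqVneq z p; exact: main.
  pose D z := cauchyI g x1 x2 y1 y2 1 z - g z * cauchyI (fun _ => 1) x1 x2 y1 y2 1 z.
  have cD : cont D p.
    apply: contB; first by apply: cdiff_cont; eexists; exact: isd_cauchyI1.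
    by apply: contM => //; apply: cdiff_cont; eexists; exact: isd_cauchyI1.
  apply/eqP; rewrite -subr_eq0 -/(D p) -nrm_eq0; apply/negPn/negP => Dp.
  have Dp0 : 0 < nrm (D p) by rewrite lt_neqAle eq_sym Dp nrm_ge0.
  have [d d0 dP] := (nearC _ _).1 (filterI (cD _ Dp0) nip).
  have := dP (p + (d / 2)%:C); rewrite addrAC subrr add0r nrmR gtr0_norm ?divr_gt0 //.
  have d2 : d / 2 < d by lra.
  move=> /(_ d2) [H1 H2].
  have zp : p + (d / 2)%:C != p.
    rewrite -subr_eq0 addrAC subrr add0r -nrm_gt0 nrmR normr_gt0 gt_eqF // divr_gt0 //.
  by move: H1; rewrite {1}/D main // subrr sub0r nrmN ltxx.
Qed.

Theorem removable g p : cont g p -> (\forall z \near p, z != p -> cdiff g z) -> cdiff g p.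
Proof.
move=> cg dg; have [A [c [A' [c' [dA dc c0 E]]]]] := cauchy_local cg dg.
have [dAp _] := nbhs_singleton dA; have [dcp _] := nbhs_singleton dc.
have cp0 := nbhs_singleton c0.
apply: (@cdiff_near _ (fun z => A z / c z)).
  by apply: filterS2 E c0 => z -> cz; rewrite mulfK.
by apply: cdiff_div => //; eexists; eassumption.
Qed.

Lemma near_near (p : C) (P : set C) : (\forall z \near p, P z) ->
  \forall z \near p, \forall w \near z, P w.
Proof.
move=> /nearC[d d0 dP]; apply/nearC; exists (d / 2); first by rewrite divr_gt0.
move=> z zd; apply/nearC; exists (d / 2); first by rewrite divr_gt0.
move=> w wd; apply: dP; have -> : w - p = (w - z) + (z - p) by ring.
by apply: le_lt_trans (nrmD _ _) _; lra.
Qed.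

(** By uniqueness of derivatives g' is the quotient rule expression in A, A', c, c', whose
    ingredients are all differentiable. *)
Theorem cdiff_deriv g g' p : (\forall z \near p, isd g z (g' z)) -> cdiff g' p.
Proof.
move=> dg; have dgp := nbhs_singleton dg.
have [|A [c [A' [c' [dA dc c0 E]]]]] := @cauchy_local g p (isd_cont dgp).
  by apply: filterS dg => z dz _; exists (g' z).
apply: (@cdiff_near _ (fun z => (A' z * c z - A z * c' z) / c z ^+ 2)).
  have nE := near_near E; have nc := near_near c0.
  apply: filterS3 (filterI dA dc) (filterI c0 nE) (filterI nc dg) =>
    z [[dAz _] [dcz _]] [c0z Ez] [ncz dgz].
  have H := isdM dAz (isdV dcz c0z).
  apply: (isd_unique _ dgz); move: H.
  have -> : A' z / c z + A z * (- c' z / c z ^+ 2) = (A' z * c z - A z * c' z) / c z ^+ 2.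
    by field.
  apply: isd_near; apply: filterS2 Ez ncz => w -> cw; exact: mulfK.
have [dAp cA'] := nbhs_singleton dA; have [dcp cc'] := nbhs_singleton dc.
have cp0 := nbhs_singleton c0.
have cA : cdiff A p by eexists; eassumption.
have cc : cdiff c p by eexists; eassumption.
apply: cdiff_div; last by rewrite expf_neq0.
  by apply: cdiffB; apply: cdiffM.
exact: cdiffX.
Qed.

End CauchyFormula.

(** * Maximum and Phragmen-Lindelof principles *)

Section MaxPrinciple.
Variable R : realType.
Local Notation C := R[i].
Implicit Types (x y t : R) (f g k : C -> C) (z w p : C).

(** The difference quotient has a removable singularity at [p]. This is the device for dividing out
    zeros later. *)
Lemma quotient f p : (\forall z \near p, cdiff f z) ->
  exists q, [/\ forall z, f z = f p + (z - p) * q z,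
    forall z, cdiff f z -> cdiff q z & isd f p (q p)].
Proof.
move=> df; have [l [q [cq fq ql]]] := nbhs_singleton df.
have Eq z : z != p -> \forall v \near z, (f v - f p) / (v - p) = q v.
  move=> zp; apply/nearC; exists (nrm (z - p)); first by rewrite nrm_gt0 subr_eq0.
  move=> v vz; have vp : v != p.
    by apply: contraTneq vz => ->; rewrite nrm_distC ltxx.
  by rewrite fq addrAC subrr add0r mulrC mulKf // subr_eq0.
have dq z : z != p -> cdiff f z -> cdiff q z.
  move=> zp dfz; apply: cdiff_near (Eq z zp) _; apply: cdiff_div.
  - by apply: cdiffB => //; exact: cdiff_cst.
  - by apply: cdiffB; [exact: cdiff_id|exact: cdiff_cst].
  - by rewrite subr_eq0.
exists q; split => //; last by exists q.
move=> z dfz; have [->|zp] := eqVneq z p; last exact: dq.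
by apply: removable => //; apply: filterS df => v dv vp; exact: dq.
Qed.

Lemma peano2 f p : (\forall z \near p, cdiff f z) ->
  exists b k, cont k p /\ forall z, f z = f p + (z - p) * b + (z - p) ^+ 2 * k z.
Proof.
move=> df; have [q [fq dq _]] := quotient df.
have dqp := dq _ (nbhs_singleton df).
have [|k [qk dk _]] := @quotient q p; first by apply: filterS df => z /dq.
exists (q p), k; split; first exact/cdiff_cont/dk.
by move=> z; rewrite (fq z) (qk z); ring.
Qed.

Lemma continuousCR (v : C -> R) z : {for z, continuous v} <->
  forall e : R, 0 < e -> \forall w \near z, `|v w - v z| < e.
Proof.
split=> [H e e0 | H P /nearR[d d0 dP]].
  by apply: (H [set y | `|y - v z| < e]); apply/nearR; exists e.
by rewrite /fmap /=; apply: filterS (H d d0) => w; exact: dP.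
Qed.

Lemma EVT_square (v : C -> R) (K : R) : 0 <= K -> (forall z, {for z, continuous v}) ->
  exists2 c : C, `|Re c| <= K /\ `|Im c| <= K &
    forall z, `|Re z| <= K -> `|Im z| <= K -> v z <= v c.
Proof.
move=> K0 cv.
pose A : set (R * R) := `[-K, K]%classic `*` `[-K, K]%classic.
have cA : compact A by apply: compact_setX; exact: segment_compact.
have A0 : A !=set0 by exists (0, 0); split; rewrite /= in_itv /= oppr_le0 K0.
have cF : {within A, continuous (fun xy : R * R => v (xy.1 +i* xy.2))}.
  apply: continuous_in_subspaceT => -[x y] _.
  have /continuousCR H := cv (x +i* y); apply/cvgrPdist_lt => e e0.
  have /nearC[d d0 dP] := H e e0.
  have d20 : 0 < d / 2 by rewrite divr_gt0.
  exists (ball x (d / 2), ball y (d / 2)); first by split; exact: nbhsx_ballx.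
  move=> [x' y'] /= [bx by_]; rewrite distrC; apply: dP.
  apply: le_lt_trans (nrm_le_ReIm _) _; rewrite !ReIm /=.
  by rewrite (splitr d) ltrD // distrC.
have [[x y]] := compact_EVT_max A0 cA cF.
rewrite inE => -[/= xK yK] H; exists (x +i* y) => /=.
  by move: xK yK; rewrite !in_itv /= -!ler_norml.
move=> [x' y'] /= hx hy; apply: (H (x', y')).
by rewrite inE; split; rewrite /= in_itv /= -ler_norml.
Qed.

(* A finite mean value inequality over [p + r], [p + i r], [p - r], [p - i r]: the terms
   of order one and two in the expansion of [f] at [p] cancel in the average. *)
Lemma no_interior_max f p (e : R) : (\forall z \near p, cdiff f z) -> 0 < e ->
  ~ (\forall z \near p, nrm (f z) + e * nrm z ^+ 2 <= nrm (f p) + e * nrm p ^+ 2).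
Proof.
move=> df e0 Hmax; have [b [k [ck fk]]] := peano2 df.
have e20 : 0 < e / 2 by rewrite divr_gt0.
have [d d0 dP] := (nearC _ _).1 (filterI (ck _ e20) Hmax).
pose r := d / 2; have r0 : 0 < r by rewrite divr_gt0.
have rd : r < d by rewrite /r; lra.
have H (h : C) : nrm h = r -> exists2 s : C, nrm s <= e / 2 &
    f (p + h) = f p + h * b + h ^+ 2 * (k p + s) /\
    nrm (f (p + h)) + e * nrm (p + h) ^+ 2 <= nrm (f p) + e * nrm p ^+ 2.
  move=> hr; have E : p + h - p = h by ring.
  have := dP (p + h); rewrite E hr => /(_ rd) [H1 H2].
  exists (k (p + h) - k p); first exact: ltW.
  by split => //; rewrite (fk (p + h)) E; ring.
have [s1 n1 [F1 u1]] := H r%:C (etrans (nrmR r) (gtr0_norm r0)).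
have [|s2 n2 [F2 u2]] := H (- r%:C); first by rewrite nrmN nrmR gtr0_norm.
have [|s3 n3 [F3 u3]] := H ('i * r%:C); first by rewrite nrmM nrmi mul1r nrmR gtr0_norm.
have [|s4 n4 [F4 u4]] := H (- ('i * r%:C)).
  by rewrite nrmN nrmM nrmi mul1r nrmR gtr0_norm.
have S : 4%:R * f p = f (p + r%:C) + f (p + - r%:C) + (f (p + 'i * r%:C) + f (p + - ('i * r%:C)))
    - r%:C ^+ 2 * (s1 + s2 - (s3 + s4)).
  have ii : 'i * 'i = -1 :> C by rewrite -expr2 sqr_i.
  rewrite F1 F2 F3 F4.
  have -> : (- ('i * r%:C)) ^+ 2 = - r%:C ^+ 2 by rewrite sqrrN exprMn expr2 ii; ring.
  have -> : ('i * r%:C) ^+ 2 = - r%:C ^+ 2 by rewrite exprMn expr2 ii; ring.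
  ring.
have N : 4 * nrm (f p) <= nrm (f (p + r%:C)) + nrm (f (p + - r%:C)) +
    (nrm (f (p + 'i * r%:C)) + nrm (f (p + - ('i * r%:C)))) + r ^+ 2 * (2 * e).
  have : nrm (4%:R * f p) = 4 * nrm (f p).
    by rewrite nrmM -(rmorph_nat (real_complex R)) nrmR normr_nat.
  move=> <-; rewrite S.
  apply: le_trans (nrmB _ _) _; apply: lerD.
    by apply: le_trans (nrmD _ _) _; apply: lerD; exact: nrmD.
  rewrite nrmM nrmX nrmR gtr0_norm // ler_wpM2l ?sqr_ge0 //.
  have := nrmB (s1 + s2) (s3 + s4); have := nrmD s1 s2; have := nrmD s3 s4; lra.
have Q : nrm (p + r%:C) ^+ 2 + nrm (p + - r%:C) ^+ 2 + (nrm (p + 'i * r%:C) ^+ 2 +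
    nrm (p + - ('i * r%:C)) ^+ 2) = 4 * nrm p ^+ 2 + 4 * r ^+ 2.
  rewrite !nrm_sqr !ReIm /=; ring.
(* The squares of the moduli gain 4 e r^2 over the centre, while the second-order remainders cost at
   most 2 e r^2. *)
have P0 : 0 < e * r ^+ 2 by rewrite mulr_gt0 // exprn_gt0.
have := congr1 (fun x => e * x) Q; lra.
Qed.

(** Boundary values enter only as upper limits at adherent points outside [U], so [g] need not
    extend to the boundary. Adding e |z|^2 makes an interior maximum impossible. *)
Theorem max_principle (U : set C) g (M K : R) :
  (forall z, U z -> nrm z <= K) -> (forall z, U z -> \forall w \near z, U w) ->
  (forall z, U z -> cdiff g z) ->
  (forall p, ~ U p -> (forall d : R, 0 < d -> exists2 z, U z & nrm (z - p) < d) ->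
     forall e : R, 0 < e -> \forall z \near p, U z -> nrm (g z) <= M + e) ->
  forall z, U z -> nrm (g z) <= M.
Proof.
move=> UK oU dg bd z0 Uz0; rewrite leNgt; apply/negP => Mlt.
have bd' p : ~ U p -> forall e : R, 0 < e -> \forall z \near p, U z -> nrm (g z) <= M + e.
  move=> Up e e0; have [/bd|] :=
    pselect (forall d : R, 0 < d -> exists2 z, U z & nrm (z - p) < d); first by apply.
  move=> /existsNP[d] /not_implyP[d0 nex]; apply/nearC; exists d => // w wd Uw.
  by exfalso; apply: nex; exists w.
have K0 : 0 <= K by apply: le_trans (UK _ Uz0); exact: nrm_ge0.
pose D := nrm (g z0) - M; have D0 : 0 < D by rewrite subr_gt0.
pose e := D / (2 * (1 + K ^+ 2)).
have K1 : 0 < 1 + K ^+ 2 by rewrite ltr_pwDl // sqr_ge0.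
have e0 : 0 < e by rewrite divr_gt0 // mulr_gt0.
have eK : e * K ^+ 2 < D / 2.
  have -> : D / 2 = e * (1 + K ^+ 2) by rewrite /e; field; rewrite gt_eqF.
  by rewrite ltr_pM2l //; lra.
pose u z := nrm (g z) + e * nrm z ^+ 2.
(* A level above [u] near the boundary of [U] but below [u z0]. Truncating [u] at [l] and extending
   by [l] gives a continuous function on the plane, which attains its maximum on a square. *)
pose l := M + D / 4 + e * K ^+ 2.
have lz0 : l < u z0.
  have : 0 <= e * nrm z0 ^+ 2 by rewrite mulr_ge0 ?sqr_ge0 // ltW.
  by rewrite /l /u; rewrite /D in eK *; lra.
pose v z := if `[< U z >] then Num.max (u z) l else l.
have vU z : U z -> v z = Num.max (u z) l by move=> Uz; rewrite /v asboolT.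
have cv z : {for z, continuous v}.
  have [Uz|nUz] := pselect (U z).
  - have cu : {for z, continuous (fun z => Num.max (u z) l)}.
      apply: continuous_max; last exact: cst_continuous.
      apply: continuousD; first exact/cont_nrm/cdiff_cont/dg.
      apply: continuousM; first exact: cst_continuous.
      have cn : {for z, continuous (fun w : C => nrm w)} by exact/cont_nrm/cont_id.
      exact: (continuousM cn cn).
    move/continuousCR: cu => cu; apply/continuousCR => r r0.
    have [d1 d10 H1] := (nearC _ _).1 (oU _ Uz).
    have [d2 d20 H2] := (nearC _ _).1 (cu r r0).
    apply/nearC; exists (Num.min d1 d2); first by rewrite lt_min d10.
    move=> w; rewrite lt_min => /andP[w1 w2].
    by have := H2 w w2; rewrite !vU //; exact: H1.
  - apply/continuousCR => r r0.
    have D40 : 0 < D / 4 by rewrite divr_gt0.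
    apply: filterS (bd' _ nUz _ D40) => w Hw.
    have vz : v z = l by rewrite /v asboolF.
    rewrite vz /v; case: asboolP => [Uw|_]; last by rewrite subrr normr0.
    rewrite max_r ?subrr ?normr0 //.
    rewrite /u /l lerD ?Hw // ler_wpM2l ?(ltW e0) //.
    by rewrite lerXn2r ?nnegrE ?nrm_ge0 // UK.
have [c _ cmax] := EVT_square K0 cv.
have UKR z : U z -> v z <= v c.
  move=> Uz; apply: cmax; apply: le_trans (UK _ Uz); [exact: Re_le_nrm|exact: Im_le_nrm].
have vz0 : l < v c.
  by apply: lt_le_trans (UKR _ Uz0); rewrite vU // lt_max lz0.
have Uc : U c by apply: contrapT => nU; move: vz0; rewrite /v asboolF // ltxx.
have uc : v c = u c.
  by rewrite vU // in vz0 *; move: vz0; rewrite lt_max ltxx orbF => /ltW/max_l.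
apply: (@no_interior_max g c e) => //.
  by apply: filterS (oU _ Uc) => z; exact: dg.
apply: filterS (oU _ Uc) => z Uz; have := UKR z Uz.
by rewrite uc vU // ge_max => /andP[].
Qed.

End MaxPrinciple.

(** * Phragmen-Lindelof principles in the half-plane and the quadrant *)

Section PhragmenLindelof.
Variable R : realType.
Local Notation C := R[i].
Implicit Types (x y t : R) (f g k : C -> C) (z w p : C).

Definition adherent (P : set C) p :=
  forall d : R, 0 < d -> exists2 z, P z & nrm (z - p) < d.

Definition limsup_le (P : set C) g p (M : R) :=
  forall e : R, 0 < e -> \forall z \near p, P z -> nrm (g z) <= M + e.

(** Multiple of the sum of the Poisson kernels of the half-plane at r and -r. It is non-negative and
    harmonic, and on the circle |w| = r it equals r / Im w, which is the growth to be
    compensated. *)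
Definition barrier (r : R) w := r * (Im w / nrm (w - r%:C) ^+ 2 + Im w / nrm (w + r%:C) ^+ 2).

Definition damp (a r : R) w := expC (- 'i * (a * r)%:C * ((w - r%:C)^-1 + (w + r%:C)^-1)).

Lemma nrm_damp a r w : nrm (damp a r w) = expR (- (a * barrier r w)).
Proof.
rewrite nrm_expC; congr expR; rewrite /barrier !ReIm !Re_inv !Im_inv !ReIm /=.
by ring.
Qed.

Lemma barrier_ge0 (r : R) w : 0 < r -> 0 <= Im w -> 0 <= barrier r w.
Proof.
by move=> r0 w0; rewrite mulr_ge0 ?(ltW r0) // addr_ge0 // divr_ge0 // sqr_ge0.
Qed.

Lemma barrier_circle (r : R) w : 0 < r -> 0 < Im w -> nrm w = r -> barrier r w = r / Im w.
Proof.
move=> r0 w0 wr; have := nrm_sqr w; rewrite wr.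
rewrite /barrier !nrm_sqr !ReIm /=; case: w w0 {wr} => x y /= y0 E.
have E1 : (x - r) ^+ 2 + (y - 0) ^+ 2 = 2 * r * (r - x).
  have -> : (x - r) ^+ 2 + (y - 0) ^+ 2 = x ^+ 2 + y ^+ 2 + r ^+ 2 - 2 * x * r by ring.
  by rewrite -E; ring.
have E2 : (x + r) ^+ 2 + (y + 0) ^+ 2 = 2 * r * (r + x).
  have -> : (x + r) ^+ 2 + (y + 0) ^+ 2 = x ^+ 2 + y ^+ 2 + r ^+ 2 + 2 * x * r by ring.
  by rewrite -E; ring.
have y20 : 0 < y ^+ 2 by rewrite exprn_gt0.
have xr : (r - x) * (r + x) = y ^+ 2 by rewrite -subr_sqr E; ring.
have r1 : r - x != 0 by apply: contraTneq y20 => h; rewrite -xr h mul0r ltxx.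
have r2 : r + x != 0 by apply: contraTneq y20 => h; rewrite -xr h mulr0 ltxx.
have := oppr0; rewrite E1 E2 => _.
have -> : r * (y / (2 * r * (r - x)) + y / (2 * r * (r + x))) = r * y / ((r - x) * (r + x)).
  by field; rewrite r1 r2 gt_eqF.
by rewrite xr; field; rewrite gt_eqF.
Qed.

Lemma barrier_far (r : R) w : 0 < r -> 0 <= Im w -> nrm w <= r / 2 ->
  barrier r w <= 8 * Im w / r.
Proof.
move=> r0 w0 wr; have H (s : C) : r / 2 <= nrm s -> Im w / nrm s ^+ 2 <= 4 * Im w / r ^+ 2.
  move=> sr; have s0 : 0 < nrm s by lra.
  rewrite ler_pdivrMr ?exprn_gt0 // mulrAC ler_pdivlMr ?exprn_gt0 //.
  rewrite [4 * _]mulrC -mulrA ler_wpM2l //.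
  have : (r / 2) ^+ 2 <= nrm s ^+ 2 by rewrite lerXn2r // nnegrE ?nrm_ge0 // divr_ge0 // ltW.
  have -> : r ^+ 2 = 4 * (r / 2) ^+ 2 by field.
  lra.
have h1 : r / 2 <= nrm (w - r%:C).
  by rewrite nrm_distC; have := nrm_sub r%:C w; rewrite nrmR gtr0_norm //; lra.
have h2 : r / 2 <= nrm (w + r%:C).
  have -> : w + r%:C = r%:C - (- w) by rewrite opprK addrC.
  by have := nrm_sub r%:C (- w); rewrite nrmN nrmR gtr0_norm //; lra.
have -> : 8 * Im w / r = r * (4 * Im w / r ^+ 2 + 4 * Im w / r ^+ 2).
  by field; rewrite gt_eqF.
by rewrite ler_pM2l // lerD // H.
Qed.

(** The product of [g] with the damping factor is at most [M] on the part of [P] where |s| < r, by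
    the maximum principle. Well inside, the barrier is of order Im s / r and the damping costs
    little. The map [s] is the identity for the half-plane and the square for the quadrant. *)
Lemma two_constants (P : set C) (s : C -> C) g (M a r K : R) :
  (forall z, P z -> \forall w \near z, P w) -> (forall z, cdiff s z) ->
  (forall z, P z -> 0 < Im (s z)) -> (forall z, nrm (s z) < r -> nrm z <= K) ->
  (forall z, P z -> cdiff g z) ->
  (forall p, ~ P p -> adherent P p -> limsup_le P g p M) ->
  0 < r -> 0 <= a ->
  (forall z, P z -> nrm (s z) = r -> nrm (g z) <= M * expR (a * (r / Im (s z)))) ->
  forall z, P z -> nrm (s z) <= r / 2 -> nrm (g z) <= M * expR (8 * a * Im (s z) / r).
Proof.
move=> oP ds Is sK dg bd r0 a0 Hr.
pose U z := P z /\ nrm (s z) < r.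
pose G z := g z * damp a r (s z).
have sr0 z : P z -> s z - r%:C != 0 /\ s z + r%:C != 0.
  move=> /Is Isz; split; apply: contraTneq Isz => /(congr1 (@complex.Im R));
    by rewrite !ReIm /= ?subr0 ?addr0 => ->; rewrite ltxx.
have dG z : P z -> cdiff G z.
  move=> Pz; have [s1 s2] := sr0 z Pz.
  apply: cdiffM; first exact: dg.
  apply: cdiff_expC; apply: cdiffM; first exact: cdiff_cst.
  by apply: cdiffD; apply: cdiffV => //; [apply: cdiffB|apply: cdiffD] => //; exact: cdiff_cst.
have nG z : nrm (G z) = nrm (g z) * expR (- (a * barrier r (s z))).
  by rewrite nrmM nrm_damp.
have Gg z : P z -> nrm (G z) <= nrm (g z).
  move=> Pz; rewrite nG ler_piMr ?nrm_ge0 // expR_le1 // oppr_le0 mulr_ge0 //.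
  by rewrite barrier_ge0 // ltW // Is.
have cs z : cont s z by exact/cdiff_cont/ds.
have GM : forall z, U z -> nrm (G z) <= M.
  apply: (max_principle (K := K)).
  - by move=> z [_ /sK].
  - move=> z [Pz sz].
    have d0 : 0 < r - nrm (s z) by rewrite subr_gt0.
    apply: filterS2 (oP _ Pz) (cs z _ d0) => w Pw sw; split => //.
    by have := nrm_sub (s w) (s z); lra.
  - by move=> z [Pz _]; exact: dG.
  - move=> p Up aUp e e0; have [Pp|nPp] := pselect (P p); last first.
      apply: filterS (bd p nPp _ e e0) => [z Hz [Pz _]|d /aUp[z [Pz _] zd]].
        exact: le_trans (Gg _ Pz) (Hz Pz).
      by exists z.
    have sp : nrm (s p) = r.
      apply/eqP; rewrite eq_le; apply/andP; split; last first.
        by rewrite leNgt; apply/negP => h; apply: Up.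
      rewrite leNgt; apply/negP => h.
      have d0 : 0 < nrm (s p) - r by rewrite subr_gt0.
      have /nearC[d d00 dP] := cs p _ d0.
      have [z [_ sz] zd] := aUp d d00; have := dP z zd.
      by rewrite nrm_distC; have := nrm_sub (s p) (s z); lra.
    have Gp : nrm (G p) <= M.
      rewrite nG barrier_circle //; last exact: Is.
      by rewrite expRN ler_pdivrMr ?expR_gt0 // Hr.
    apply: filterS (cdiff_cont (dG _ Pp) e0) => z zG _.
    by have := nrm_sub (G z) (G p); lra.
move=> z Pz sz; have Uz : U z by split=> //; lra.
have := GM z Uz; rewrite nG expRN ler_pdivrMr ?expR_gt0 // => /le_trans; apply.
have Isz := Is _ Pz.
have M0 : 0 <= M by apply: le_trans (GM z Uz); exact: nrm_ge0.
rewrite ler_wpM2l // ler_expR.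
have -> : 8 * a * Im (s z) / r = a * (8 * Im (s z) / r) by ring.
by rewrite ler_wpM2l // barrier_far // ltW.
Qed.

Definition uhp z := 0 < Im z.

Lemma near_uhp z : uhp z -> \forall w \near z, uhp w.
Proof.
move=> z0; apply/nearC; exists (Im z) => // w.
have := Im_le_nrm (w - z); rewrite !ReIm ler_norml /uhp => /andP[? _]; lra.
Qed.

Lemma adherent_uhp p : ~ uhp p -> adherent uhp p -> Im p = 0.
Proof.
move=> np ap; apply/eqP; rewrite eq_le; apply/andP; split.
  by rewrite leNgt; apply/negP.
rewrite leNgt; apply/negP => p0; have d0 : 0 < - Im p by rewrite oppr_gt0.
have [z uz] := ap _ d0; have := Im_le_nrm (z - p).
rewrite !ReIm ler_norml /uhp in uz * => /andP[_ ?]; lra.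
Qed.

Definition axis_le g (M : R) := forall x, limsup_le uhp g x%:C M.

Lemma axis_bd g (M : R) : axis_le g M ->
  forall p, ~ uhp p -> adherent uhp p -> limsup_le uhp g p M.
Proof.
move=> gM p np ap; have := adherent_uhp np ap; case: (p) => x y /= ->; exact: gM.
Qed.

Lemma half_disc g (M a r : R) : (forall z, uhp z -> cdiff g z) -> axis_le g M ->
  0 < r -> 0 <= a ->
  (forall z, uhp z -> nrm z = r -> nrm (g z) <= M * expR (a * (r / Im z))) ->
  forall z, uhp z -> nrm z <= r / 2 -> nrm (g z) <= M * expR (8 * a * Im z / r).
Proof.
move=> dg gM r0 a0 Hr; apply: (@two_constants uhp id g M a r r) => //.
- exact: near_uhp.
- by move=> z; exact: cdiff_id.
- by move=> z /ltW.
- exact: axis_bd.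
Qed.

(** The hypothesis is the growth of functions of bounded type. It is quadratic on circles, so
    enlarging r removes only one order: exponential type remains, to be treated by the mean type. *)
Lemma PL_half_plane1 g (M K : R) : (forall z, uhp z -> cdiff g z) -> axis_le g M ->
  1 <= M -> 0 <= K ->
  (forall z, uhp z -> nrm (g z) <= expR (K * (1 + nrm z ^+ 2) / Im z)) ->
  forall z, uhp z -> nrm (g z) <= M * expR (16 * K * Im z).
Proof.
move=> dg gM M1 K0 HK z uz; pose r := 2 * nrm z + 1.
have nz := nrm_ge0 z; have r1 : 1 <= r by rewrite /r; lra.
have r0 : 0 < r by lra.
pose a := K * (1 + r ^+ 2) / r.
have r20 : 0 <= 1 + r ^+ 2 by rewrite addr_ge0 ?sqr_ge0.
have a0 : 0 <= a by rewrite divr_ge0 ?(ltW r0) // mulr_ge0.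
have zr : nrm z <= r / 2 by rewrite /r; lra.
have z0 : 0 < Im z by [].
have := half_disc dg gM r0 a0 _ uz zr.
have Hc w : uhp w -> nrm w = r -> nrm (g w) <= M * expR (a * (r / Im w)).
  move=> uw wr; apply: le_trans (HK w uw) _; rewrite wr.
  have -> : a * (r / Im w) = K * (1 + r ^+ 2) / Im w.
    by rewrite /a; field; rewrite !gt_eqF.
  by rewrite ler_peMl // expR_ge0.
move=> /(_ Hc) /le_trans; apply; rewrite ler_wpM2l //; first lra.
rewrite ler_expR /a.
have r2 : 1 <= r ^+ 2 by rewrite exprn_ege1.
have -> : 8 * (K * (1 + r ^+ 2) / r) * Im z / r = 8 * K * Im z * ((1 + r ^+ 2) / r ^+ 2).
  by field; rewrite gt_eqF.
have -> : 16 * K * Im z = 8 * K * Im z * 2 by ring.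
rewrite ler_wpM2l //; first by rewrite !mulr_ge0 // ltW.
rewrite ler_pdivrMr ?exprn_gt0 //; lra.
Qed.

(** Replaces the passage to the limit q -> 0 when only arbitrarily small upper estimates are at
    hand. *)
Lemma exp_limit (u M c : R) : 0 < M ->
  (forall r : R, 0 < r -> exists2 q : R, q < r & u <= M * expR (c * q)) -> 0 <= c -> u <= M.
Proof.
move=> M0 H c0; rewrite leNgt; apply/negP => uM.
pose d := ln (u / M).
have uM1 : 1 < u / M by rewrite ltr_pdivlMr // mul1r.
have d0 : 0 < d by rewrite ln_gt0.
have c1 : 0 < 1 + c by rewrite ltr_pwDl.
have [q qr] := H (d / (1 + c)) (divr_gt0 d0 c1).
rewrite mulrC -ler_pdivrMr // -ler_ln ?posrE ?expR_gt0 //; last lra.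
rewrite expRK -/d; move: qr; rewrite ltr_pdivlMr // => qr.
have [q0|q0] := leP 0 q; first nra.
have : c * q <= 0 by rewrite mulr_ge0_le0 // ltW.
lra.
Qed.

(** For bounded [g] the exponent [a] does not depend on r, so the loss 8 a Im z / r tends to 0. *)
Lemma PL_half_plane2 g (M K : R) : (forall z, uhp z -> cdiff g z) -> axis_le g M ->
  0 < M -> (forall z, uhp z -> nrm (g z) <= K) ->
  forall z, uhp z -> nrm (g z) <= M.
Proof.
move=> dg gM M0 HK z uz.
pose a := Num.max 0 (ln (K / M)).
have a0 : 0 <= a by rewrite le_max lexx.
have Ka : forall w, uhp w -> nrm (g w) <= M * expR a.
  move=> w uw; apply: le_trans (HK w uw) _.
  have [K0|K0] := leP K 0; first by apply: le_trans K0 _; rewrite mulr_ge0 ?expR_ge0 // ltW.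
  rewrite mulrC -ler_pdivrMr // -[leLHS]lnK ?posrE ?divr_gt0 // ler_expR.
  by rewrite le_max lexx orbT.
have z0 : 0 < Im z by [].
apply: (@exp_limit _ M (8 * a * Im z)) => //; last by rewrite !mulr_ge0 // ltW.
move=> e e0; pose r := 2 * nrm z + 1 + 2 / e.
have nz := nrm_ge0 z; have r2 : 2 / e < r by rewrite /r; lra.
have e20 : 0 < 2 / e by rewrite divr_gt0.
have r0 : 0 < r by lra.
have zr : nrm z <= r / 2 by rewrite /r; lra.
exists r^-1.
  rewrite invf_plt ?posrE //; apply: lt_trans r2; rewrite ltr_pdivlMr // mulVf ?gt_eqF //; lra.
apply: (half_disc dg gM r0 a0 _ uz zr) => w uw wr.
apply: le_trans (Ka w uw) _; rewrite ler_wpM2l ?(ltW M0) // ler_expR ler_peMr //.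
rewrite ler_pdivlMr // mul1r -wr; apply: le_trans (Im_le_nrm w); exact: ler_norm.
Qed.

Definition quadrant z := 0 < Re z /\ 0 < Im z.

Lemma near_quadrant z : quadrant z -> \forall w \near z, quadrant w.
Proof.
move=> [x0 y0]; apply/nearC; exists (Num.min (Re z) (Im z)); first by rewrite lt_min x0.
move=> w; rewrite lt_min => /andP[w1 w2].
have := Im_le_nrm (w - z); have := Re_le_nrm (w - z).
by rewrite !ReIm !ler_norml /quadrant => /andP[? _] /andP[? _]; split; lra.
Qed.

(** Squaring opens the quadrant to the half-plane and turns exponential type into order 1/2. On the
    circle of radius r^2 the exponent is only of order r, so it disappears in the limit. *)
Lemma PL_quadrant g (M K : R) : (forall z, quadrant z -> cdiff g z) ->
  (forall p, ~ quadrant p -> adherent quadrant p -> limsup_le quadrant g p M) ->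
  0 < M -> 0 <= K -> (forall z, quadrant z -> nrm (g z) <= M * expR (K * (1 + nrm z))) ->
  forall z, quadrant z -> nrm (g z) <= M.
Proof.
move=> dg gM M0 K0 HK z qz.
have Isq w : quadrant w -> 0 < Im (w ^+ 2).
  by move=> [x0 y0]; rewrite expr2 ImM addr_gt0 // mulr_gt0.
have z0 := Isq _ qz.
apply: (@exp_limit _ M (16 * K * Im (z ^+ 2))) => //; last by rewrite !mulr_ge0 // ltW.
move=> e e0; pose r := 2 * nrm z + 1 + 2 / e.
have nz := nrm_ge0 z; have r2 : 2 / e < r by rewrite /r; lra.
have e20 : 0 < 2 / e by rewrite divr_gt0.
have r1 : 1 <= r by rewrite /r; lra.
have r0 : 0 < r by lra.
pose a := K * (1 + r).
have a0 : 0 <= a by rewrite mulr_ge0 // addr_ge0 // ltW.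
have rr0 : 0 < r ^+ 2 by rewrite exprn_gt0.
exists r^-1.
  rewrite invf_plt ?posrE //; apply: lt_trans r2; rewrite ltr_pdivlMr // mulVf ?gt_eqF //; lra.
apply: (@le_trans _ _ (M * expR (8 * a * Im (z ^+ 2) / r ^+ 2))); last first.
  rewrite ler_wpM2l ?(ltW M0) // ler_expR /a.
  have -> : 8 * (K * (1 + r)) * Im (z ^+ 2) / r ^+ 2 =
     8 * K * Im (z ^+ 2) / r * ((1 + r) / r) by field; rewrite gt_eqF.
  have -> : 16 * K * Im (z ^+ 2) * r^-1 = 8 * K * Im (z ^+ 2) / r * 2 by ring.
  rewrite ler_wpM2l //; first by rewrite divr_ge0 ?mulr_ge0 // ltW.
  rewrite ler_pdivrMr //; lra.
have zr : nrm (z ^+ 2) <= r ^+ 2 / 2.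
  rewrite nrmX ler_pdivlMr //; have : r ^+ 2 >= (2 * nrm z) ^+ 2.
    by rewrite lerXn2r ?nnegrE ?mulr_ge0 // ?(ltW r0) // /r; lra.
  have := sqr_ge0 (nrm z); nra.
apply: (@two_constants quadrant (fun w => w ^+ 2) g M a (r ^+ 2) r) => //.
- exact: near_quadrant.
- by move=> w; apply: cdiffX; exact: cdiff_id.
- by move=> w; rewrite nrmX ltr_pXn2r ?nnegrE ?nrm_ge0 ?(ltW r0) // => /ltW.
- move=> w qw wr; apply: le_trans (HK w qw) _.
  have wr' : nrm w = r.
    by apply/eqP; rewrite -(@eqrXn2 _ 2) ?nrm_ge0 ?(ltW r0) // -nrmX; apply/eqP.
  rewrite wr' ler_wpM2l ?(ltW M0) // ler_expR ler_peMr //.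
  rewrite ler_pdivlMr ?Isq // mul1r -wr; apply: le_trans (Im_le_nrm _); exact: ler_norm.
Qed.

End PhragmenLindelof.

(** * Primitives and functions of bounded type *)

Section Primitive.
Variable R : realType.
Local Notation C := R[i].
Implicit Types (x y t : R) (f g k : C -> C) (z w p : C).

Lemma rectICx f x1 x2 y1 y2 : rectI f x2 x1 y1 y2 = - rectI f x1 x2 y1 y2.
Proof. by rewrite /rectI !(cintC x1 x2); ring. Qed.

Lemma rectICy f x1 x2 y1 y2 : rectI f x1 x2 y2 y1 = - rectI f x1 x2 y1 y2.
Proof. by rewrite /rectI !(cintC y1 y2); ring. Qed.

Lemma goursat_or f x1 x2 y1 y2 :
  onrect (Num.min x1 x2) (Num.max x1 x2) (Num.min y1 y2) (Num.max y1 y2) (cdiff f) ->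
  rectI f x1 x2 y1 y2 = 0.
Proof.
have [x12|/ltW x12] := leP x1 x2; have [y12|/ltW y12] := leP y1 y2 => df.
- exact: goursat.
- by rewrite rectICy goursat // oppr0.
- by rewrite rectICx goursat // oppr0.
- by rewrite rectICx rectICy goursat // !oppr0.
Qed.

Lemma cu_cst (a b : R) (c : C) : a <= b -> cu a b (fun _ => c) = c * (b - a)%:C.
Proof.
by move=> ab; apply: complex_eqP; rewrite !ReIm /= ru_cst //; ring.
Qed.

Lemma cint_cst (a b : R) (c : C) : cint a b (fun _ => c) = c * (b - a)%:C.
Proof.
have [ab|/ltW ab] := leP a b; first by rewrite cint_le // cu_cst.
by rewrite cintC cint_le // cu_cst // -mulrN -rmorphN opprB.
Qed.

(** Integral along the path that runs horizontally at height [b] and then vertically to [z]. *)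
Definition primC x0 b f z : C :=
  cint x0 (Re z) (fun t => f (t +i* b)) + 'i * cint b (Im z) (fun s => f (Re z +i* s)).

Lemma primC0 x0 b f : primC x0 b f (x0 +i* b) = 0.
Proof. by rewrite /primC /= /cint !subrr mulr0 addr0. Qed.

Lemma minmax_in (a b t u r : R) : Num.min a b <= t <= Num.max a b ->
  u - r <= a <= u + r -> u - r <= b <= u + r -> u - r <= t <= u + r.
Proof.
by case: (leP a b) => ab /andP[? ?] /andP[? ?] /andP[? ?]; apply/andP; split; lra.
Qed.

Lemma minmax_outside (a b c d s : R) : c <= b -> b <= d ->
  Num.min (Num.min a b) c <= s <= Num.max (Num.max a b) d -> ~~ (c <= s <= d) ->
  Num.min a b <= s <= Num.max a b.
Proof.
move=> cb bd; rewrite ge_min le_max => /andP[/orP[h1|h1] /orP[h2|h2]] h.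
- by rewrite h1.
- rewrite h1 le_max; apply/orP; right; case: (leP s b) h => // bs.
  by rewrite h2 andbT (le_trans cb (ltW bs)).
- rewrite h2 andbT ge_min; apply/orP; right; case: (leP b s) h => // sb.
  by rewrite h1 (le_trans (ltW sb) bd).
- by rewrite h1 h2 in h.
Qed.

Lemma minmax_dist (a b t : R) : Num.min a b <= t <= Num.max a b -> `|t - a| <= `|b - a|.
Proof.
case: (leP a b) => ab /andP[h1 h2].
  by rewrite !ger0_norm ?subr_ge0 //; lra.
by rewrite !ler0_norm ?subr_le0 //; lra.
Qed.

Lemma primC_isd x0 b f z (d : R) : 0 < d ->
  contI (Num.min x0 (Re z - d)) (Num.max x0 (Re z + d)) (fun t => f (t +i* b)) ->
  onrect (Re z - d) (Re z + d) (Num.min b (Im z)) (Num.max b (Im z)) (cdiff f) ->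
  onrect (Re z - d) (Re z + d) (Im z - d) (Im z + d) (cont f) ->
  isd (primC x0 b f) z (f z).
Proof.
move=> d0 H1 H2 H3.
have cz : cont f z.
  by case: (z) H3 => x y /= H3; apply: H3; apply/andP; split; lra.
apply/isd_eps => e e0; have e20 : 0 < e / 2 by rewrite divr_gt0.
have /nearC[d1 d10 dP] := cz _ e20.
exists (Num.min d (d1 / 2)); first by rewrite lt_min d0 divr_gt0.
case: z H1 H2 H3 cz dP => x y /= H1 H2 H3 cz dP [x' y'].
rewrite lt_min => /andP[vd vd1].
have := Re_le_nrm ((x' +i* y') - (x +i* y)); have := Im_le_nrm ((x' +i* y') - (x +i* y)).
rewrite !ReIm /= => hy hx.
have hxd : x - d <= x' <= x + d.
  by move: hx; rewrite ler_norml => /andP[? ?]; apply/andP; split; lra.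
have hyd : y - d <= y' <= y + d.
  by move: hy; rewrite ler_norml => /andP[? ?]; apply/andP; split; lra.
have xx : x - d <= x <= x + d by apply/andP; split; lra.
have yy : y - d <= y <= y + d by apply/andP; split; lra.
have C1 : cint x0 x' (fun t => f (t +i* b)) =
    cint x0 x (fun t => f (t +i* b)) + cint x x' (fun t => f (t +i* b)).
  apply: cint_chasles H1.
  - by rewrite ge_min lexx le_max lexx.
  - by rewrite ge_min le_max; apply/andP; split; apply/orP; right; lra.
  - by rewrite ge_min le_max; case/andP: hxd => *; apply/andP; split; apply/orP; right; lra.
have cvert : contI (Num.min (Num.min b y) (y - d)) (Num.max (Num.max b y) (y + d))
    (fun s => f (x' +i* s)).
  move=> s hs; apply: cont_v.
  have [sy|nsy] := boolP (y - d <= s <= y + d); first exact: H3.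
  apply: cdiff_cont; apply: H2 => //; move: hs nsy.
  by apply: minmax_outside; lra.
have C2 : cint b y' (fun s => f (x' +i* s)) =
    cint b y (fun s => f (x' +i* s)) + cint y y' (fun s => f (x' +i* s)).
  apply: cint_chasles cvert; rewrite !ge_min !le_max ?lexx ?orbT //=.
  by case/andP: hyd => *; apply/andP; split; apply/orP; right; lra.
(* The paths to two nearby points enclose this rectangle, so the increment reduces to two short
   sides near [z]. *)
have G0 : rectI f x x' b y = 0.
  apply: goursat_or => t s ht hs; apply: H2 => //; exact: minmax_in ht xx hxd.
have -> : primC x0 b f (x' +i* y') - primC x0 b f (x +i* y) - f (x +i* y) * ((x' +i* y') - (x +i* y))
   = (cint x x' (fun t => f (t +i* y)) - f (x +i* y) * (x' - x)%:C) +
     'i * (cint y y' (fun s => f (x' +i* s)) - f (x +i* y) * (y' - y)%:C).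
  have -> : (x' +i* y') - (x +i* y) = (x' - x)%:C + 'i * (y' - y)%:C.
    by apply: complex_eqP; rewrite !ReIm /=; ring.
  move: G0; rewrite /rectI /primC /= C1 C2 => G0.
  by apply/eqP; rewrite -subr_eq0 -[X in _ == X]G0; apply/eqP; ring.
have ch : contI (Num.min x x') (Num.max x x') (fun t => f (t +i* y)).
  by move=> t ht; apply: cont_h; apply: H3 => //; exact: minmax_in ht xx hxd.
have cv : contI (Num.min y y') (Num.max y y') (fun s => f (x' +i* s)).
  by move=> t ht; apply: cont_v; apply: H3 => //; exact: minmax_in ht yy hyd.
have ccst (a b' : R) (c : C) : contI a b' (fun _ => c) by move=> t _; exact: cont_cst.
rewrite -!cint_cst.
have sub (a a' : R) (u : R -> C) (c : C) : contI (Num.min a a') (Num.max a a') u ->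
    cint a a' u - cint a a' (fun _ => c) = cint a a' (fun t => u t + -1 * c).
  move=> cu_; have -> : -1 * c = - c by rewrite mulN1r.
  by rewrite (cintD cu_ (ccst _ _ _)) !cint_cst mulNr.
rewrite !sub //.
have bx : nrm (cint x x' (fun t => f (t +i* y) + -1 * f (x +i* y))) <= e / 2 * `|x' - x|.
  apply: nrm_cint_le => t ht.
    by apply: contD; [exact: ch|exact: cont_cst].
  rewrite mulN1r ltW // dP //; apply: le_lt_trans (nrm_le_ReIm _) _; rewrite !ReIm /= subrr normr0.
  by have := minmax_dist ht; lra.
have by_ : nrm (cint y y' (fun s => f (x' +i* s) + -1 * f (x +i* y))) <= e / 2 * `|y' - y|.
  apply: nrm_cint_le => t ht.
    by apply: contD; [exact: cv|exact: cont_cst].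
  rewrite mulN1r ltW // dP //; apply: le_lt_trans (nrm_le_ReIm _) _; rewrite !ReIm /=.
  by have := minmax_dist ht; lra.
apply: le_trans (nrmD _ _) _; rewrite nrmM nrmi mul1r.
apply: le_trans (lerD bx by_) _.
have := ler_wpM2l (ltW e20) hx; have := ler_wpM2l (ltW e20) hy; lra.
Qed.

(** The second hypothesis says that [U] contains the rectangle spanned by [p0] and each of its
    points, hence all the paths and the rectangles between them. *)
Lemma primitive_exists (U : set C) p0 f :
  (forall z, U z -> \forall w \near z, U w) ->
  (forall z, U z -> onrect (Num.min (Re p0) (Re z)) (Num.max (Re p0) (Re z))
     (Num.min (Im p0) (Im z)) (Num.max (Im p0) (Im z)) U) ->
  (forall z, U z -> cdiff f z) ->
  forall z, U z -> isd (primC (Re p0) (Im p0) f) z (f z).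
Proof.
move=> oU hU df z Uz; have [d d0 dP] := near_square (oU _ Uz).
have [zp zm] : U ((Re z + d) +i* Im z) /\ U ((Re z - d) +i* Im z).
  by split; apply: dP; apply/andP; split; lra.
have band x y : Re z - d <= x <= Re z + d ->
    Num.min (Im p0) (Im z) <= y <= Num.max (Im p0) (Im z) -> U (x +i* y).
  move=> /andP[h1 h2] hy; have [xp|xp] := leP (Re p0) x.
    by apply: (hU _ zp) => //=; rewrite ge_min le_max xp h2 orbT.
  by apply: (hU _ zm) => //=; rewrite ge_min le_max h1 (ltW xp) orbT.
apply: (primC_isd d0).
- move=> t ht; apply: cont_h; apply: cdiff_cont; apply: df.
  have [ht'|nht] := boolP (Re z - d <= t <= Re z + d).
    by apply: band => //; rewrite ge_min le_max lexx.
  have Upz := hU _ Uz; apply: Upz; last by rewrite ge_min le_max lexx.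
  move: ht nht; rewrite ge_min le_max => /andP[/orP[] ? /orP[] ?] /nandP[] => ?;
    by rewrite ge_min le_max; apply/andP; split; apply/orP; try (left; lra); right; lra.
- by move=> x y hx hy; apply: df; exact: band.
- by move=> x y hx hy; apply: cdiff_cont; apply: df; exact: dP.
Qed.

Lemma isd0_const (U : set C) g p :
  (forall z, U z -> onrect (Num.min (Re p) (Re z)) (Num.max (Re p) (Re z))
     (Num.min (Im p) (Im z)) (Num.max (Im p) (Im z)) U) ->
  (forall z, U z -> isd g z 0) -> forall z, U z -> g z = g p.
Proof.
move=> hU dg z Uz; case: z Uz => x y Uz; case: p hU => a b hU /=.
have hU' := hU _ Uz.
have cc : forall a b : R, contI a b (fun _ : R => 0 : C) by move=> ? ? t _; exact: cont_cst.
have inx : Num.min a x <= x <= Num.max a x by rewrite ge_min le_max !lexx !orbT.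
have iny : Num.min b y <= b <= Num.max b y by rewrite ge_min le_max !lexx.
have Eh : g (x +i* b) = g (a +i* b).
  have H t : Num.min a x <= t <= Num.max a x -> rderiv (fun s => g (s +i* b)) t 0.
    by move=> ht; apply: rderiv_h; apply: dg; exact: hU'.
  have [ax|/ltW ax] := leP a x.
    have := @cu_FTC _ a x (fun s => g (s +i* b)) (fun _ => 0) ax (cc _ _).
    rewrite cu_cst // mul0r => /(_ _) E; apply/eqP; rewrite -subr_eq0 -E // => t ht.
    by apply: H; rewrite (min_l ax) (max_r ax).
  have := @cu_FTC _ x a (fun s => g (s +i* b)) (fun _ => 0) ax (cc _ _).
  rewrite cu_cst // mul0r => /(_ _) E; apply/eqP; rewrite eq_sym -subr_eq0 -E // => t ht.
  by apply: H; rewrite (min_r ax) (max_l ax).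
rewrite -Eh.
have H t : Num.min b y <= t <= Num.max b y -> rderiv (fun s => g (x +i* s)) t 0.
  move=> ht; rewrite -(mulr0 'i); apply: rderiv_v; apply: dg; exact: hU'.
have [ax|/ltW ax] := leP b y.
  have := @cu_FTC _ b y (fun s => g (x +i* s)) (fun _ => 0) ax (cc _ _).
  rewrite cu_cst // mul0r => /(_ _) E; apply/eqP; rewrite -subr_eq0 -E // => t ht.
  by apply: H; rewrite (min_l ax) (max_r ax).
have := @cu_FTC _ y b (fun s => g (x +i* s)) (fun _ => 0) ax (cc _ _).
rewrite cu_cst // mul0r => /(_ _) E; apply/eqP; rewrite eq_sym -subr_eq0 -E // => t ht.
by apply: H; rewrite (min_r ax) (max_l ax).
Qed.

End Primitive.

(** * Growth of functions of bounded type *)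

Section BoundedType.
Variable R : realType.
Local Notation C := R[i].
Implicit Types (x y t : R) (f g k : C -> C) (z w p a : C).

Definition udisc z := nrm z < 1.

Lemma near_disc (r : R) z : nrm z < r -> \forall w \near z, nrm w < r.
Proof.
move=> zr; apply/nearC; exists (r - nrm z); first by rewrite subr_gt0.
by move=> w; have := nrm_sub w z; lra.
Qed.

Lemma adherent_disc p : ~ udisc p -> adherent udisc p -> nrm p = 1.
Proof.
rewrite /udisc => np ap; apply/eqP; rewrite eq_le; apply/andP; split; last first.
  by rewrite leNgt; apply/negP.
rewrite leNgt; apply/negP => h.
have [|z z1] := ap (nrm p - 1); first by rewrite subr_gt0.
by rewrite nrm_distC; have := nrm_sub p z; lra.
Qed.

Lemma disc_hull (r : R) z : nrm z < r ->
  onrect (Num.min 0 (Re z)) (Num.max 0 (Re z)) (Num.min 0 (Im z)) (Num.max 0 (Im z))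
    (fun w => nrm w < r).
Proof.
move=> zr x y hx hy; apply: le_lt_trans zr.
have := minmax_dist hx; have := minmax_dist hy; rewrite !subr0 => h1 h2.
rewrite -(@ler_pXn2r _ 2) ?nnegrE ?nrm_ge0 // !nrm_sqr /=.
by apply: lerD; rewrite -[leLHS]real_normK ?num_real // -[leRHS]real_normK ?num_real //
  lerXn2r // nnegrE.
Qed.

(** The Blaschke factor (z - a) / (1 - conj(a) z) is unimodular on the circle, so dividing by it
    does not raise the supremum. *)
Lemma blaschke_bound g a (M : R) : udisc a -> 0 <= M ->
  (forall z, udisc z -> cdiff g z) ->
  (forall z, udisc z -> nrm (g z) * nrm (z - a) <= M * nrm (1 - a^* * z)) ->
  forall z, udisc z -> nrm (g z) <= M.
Proof.
move=> a1 M0 dg H; apply: (max_principle (K := 1)) => //.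
- by move=> z /ltW.
- by move=> z; exact: near_disc.
move=> p np ap e e0; have p1 := adherent_disc np ap.
have pa : p - a != 0.
  by rewrite subr_eq0; apply: contraTneq a1 => <-; rewrite /udisc p1 ltxx.
have cb : cont (fun z => (1 - a^* * z) / (z - a)) p.
  apply: cdiff_cont; apply: cdiff_div => //.
    apply: cdiffB; first exact: cdiff_cst.
    by apply: cdiffM; [exact: cdiff_cst|exact: cdiff_id].
  by apply: cdiffB; [exact: cdiff_id|exact: cdiff_cst].
have b1 : nrm ((1 - a^* * p) / (p - a)) = 1.
  have pp : p^* * p = 1.
    have := nrm_sqr p; rewrite p1 expr1n; case: (p) => u v /= E.
    by apply: complex_eqP => /=; [rewrite mulNr opprK -!expr2|ring].
  have -> : 1 - a^* * p = (p - a)^* * p by rewrite rmorphB mulrBl pp.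
  by rewrite nrm_div nrmM nrm_conj p1 mulr1 divff // gt_eqF // nrm_gt0.
have e1 : 0 < e / (M + 1) by rewrite divr_gt0 // ltr_wpDl.
have npa : \forall z \near p, z - a != 0.
  apply/nearC; exists (nrm (p - a)); first by rewrite nrm_gt0.
  move=> z zp; rewrite subr_eq0; apply: contraTneq zp => ->.
  by rewrite nrm_distC ltxx.
apply: filterS2 (cb _ e1) npa => z cz za z1.
have za0 : 0 < nrm (z - a) by rewrite nrm_gt0.
have := H z z1; rewrite -ler_pdivlMr // -mulrA -nrm_div => /le_trans; apply.
have hb : nrm ((1 - a^* * z) / (z - a)) <= 1 + e / (M + 1).
  have := nrm_sub ((1 - a^* * z) / (z - a)) ((1 - a^* * p) / (p - a)); rewrite b1; lra.
apply: le_trans (ler_wpM2l M0 hb) _; rewrite mulrDr mulr1 lerD2l mulrCA ler_piMr ?(ltW e0) //.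
by rewrite ler_pdivrMr ?ltr_wpDl //; lra.
Qed.

Lemma quotient0 g a : (\forall z \near a, cdiff g z) -> g a = 0 ->
  exists q, (forall z, g z = (z - a) * q z) /\ (forall z, cdiff g z -> cdiff q z).
Proof.
move=> dg ga; have [q [gq dq _]] := quotient dg.
by exists q; split => // z; rewrite gq ga add0r.
Qed.

(** [L] is the primitive of g' / g, so that g exp(-L) has derivative 0. *)
Lemma hol_log g (r : R) : 0 < r -> (forall z, nrm z < r -> cdiff g z) ->
  (forall z, nrm z < r -> g z != 0) ->
  exists L : C -> C, [/\ L 0 = 0, forall z, nrm z < r -> cdiff L z &
    forall z, nrm z < r -> g z = g 0 * expC (L z)].
Proof.
move=> r0 dg g0.
have dg' z : nrm z < r -> isd g z (derive1 g z).
  by move=> /dg /cdiffP /derivable_isd.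
pose l z := derive1 g z / g z.
have dl z : nrm z < r -> cdiff l z.
  move=> zr; apply: cdiff_div; [|exact: dg|exact: g0].
  by apply: cdiff_deriv; apply: filterS (near_disc zr) => w; exact: dg'.
pose L := primC 0 0 l.
have dL z : nrm z < r -> isd L z (l z).
  move=> zr; have := @primitive_exists _ (fun z => nrm z < r) (0 : C) l; apply => //.
    by move=> w; exact: near_disc.
  by move=> w; exact: disc_hull.
have L0 : L 0 = 0 by exact: (primC0 0 0 l).
exists L; split => //; first by move=> z /dL; exists (l z).
have d0 z : nrm z < r -> isd (fun w => g w * expC (- L w)) z 0.
  move=> zr; have := isdM (dg' z zr) (isd_comp (isdN (dL z zr)) (isd_expC _)).
  rewrite /l; set u := derive1 g z; set v := expC _.
  have -> // : u * v + g z * (v * - (u / g z)) = 0 by field; exact: g0.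
move=> z zr.
have := @isd0_const _ (fun z => nrm z < r) _ (0 : C) _ d0 z zr.
rewrite L0 oppr0 expC0 mulr1 => <-; last by move=> w; exact: disc_hull.
by rewrite -mulrA -expCD addNr expC0 mulr1.
Qed.

Lemma harnack A (c r : R) : 0 < c -> 0 < r -> A 0 = c%:C ->
  (forall z, nrm z < r -> cdiff A z) -> (forall z, nrm z < r -> 0 < Re (A z)) ->
  forall z, nrm z < r -> Re (A z) <= (r + nrm z) / (r - nrm z) * c.
Proof.
move=> c0 r0 A0 dA Ap z zr.
(* The Cayley transform sends the right half-plane to the disc and c to 0, so Harnack's inequality
   reduces to Schwarz's lemma, which is [blaschke_bound] at the centre. *)
pose W w := (A (r%:C * w) - c%:C) / (A (r%:C * w) + c%:C).
have rw w : udisc w -> nrm (r%:C * w) < r.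
  by move=> w1; rewrite nrmM nrmR gtr0_norm // gtr_pMr.
have dAr w : udisc w -> cdiff (fun v => A (r%:C * v)) w.
  move=> w1; apply: (@cdiff_comp _ (fun v => r%:C * v)); last exact/dA/rw.
  by apply: cdiffM; [exact: cdiff_cst|exact: cdiff_id].
have den w : udisc w -> A (r%:C * w) + c%:C != 0.
  move=> /rw /Ap Aw; apply/negP => /eqP /(congr1 (@complex.Re R)); rewrite !ReIm /=; lra.
have dW w : udisc w -> cdiff W w.
  move=> w1; apply: cdiff_div; [apply: cdiffB|apply: cdiffD|exact: den];
    by [exact: dAr|exact: cdiff_cst].
have W0 : W 0 = 0 by rewrite /W mulr0 A0 subrr mul0r.
have [|q [Wq dq]] := @quotient0 W 0 _ W0.
  by apply: filterS (@near_disc 1 0 _) => [w|]; [exact: dW|rewrite nrm0].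
have q1 : forall w, udisc w -> nrm (q w) <= 1.
  apply: (@blaschke_bound q 0) => //; first by rewrite /udisc nrm0.
    by move=> w w1; apply: dq; exact: dW.
  move=> w w1; rewrite -nrmM mulrC -Wq rmorph0 mul0r subr0 nrm1 mulr1.
  rewrite /W nrm_div ler_pdivrMr ?mul1r ?nrm_gt0 ?den //.
  rewrite -(@ler_pXn2r _ 2) ?nnegrE ?nrm_ge0 // !nrm_sqr !ReIm /=.
  have := Ap _ (rw _ w1); nra.
pose w := r%:C^-1 * z.
have zw : r%:C * w = z by rewrite mulrA mulfV ?mul1r // -nrm_gt0 nrmR gtr0_norm.
have nw : nrm w = nrm z / r.
  by rewrite nrmM nrmV nrmR gtr0_norm // mulrC.
have w1 : udisc w by rewrite /udisc nw ltr_pdivrMr // mul1r.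
have := q1 w w1; have nw0 := nrm_ge0 w.
move=> /(ler_wpM2l nw0); rewrite -nrmM mulr1.
have := Wq w; rewrite subr0 => <-.
rewrite /W nrm_div ler_pdivrMr ?nrm_gt0 ?den // zw.
set u := Re (A z); have u0 : 0 < u by exact: Ap.
set s := nrm w in nw0 nw *; have s1 : s < 1 by [].
clearbody s; move=> H.
have H2 : u - c <= s * (u + c).
  have : (nrm (A z - c%:C)) ^+ 2 <= (s * nrm (A z + c%:C)) ^+ 2.
    by rewrite lerXn2r ?nnegrE ?mulr_ge0 ?nrm_ge0.
  rewrite exprMn !nrm_sqr !ReIm /= subr0 addr0 -/u => H3.
  have s2 : s ^+ 2 <= 1 by rewrite expr_le1 // ltW.
  have : (u - c) ^+ 2 <= (s * (u + c)) ^+ 2.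
    have : 0 <= (1 - s ^+ 2) * Im (A z) ^+ 2 by rewrite mulr_ge0 ?sqr_ge0 // subr_ge0.
    rewrite exprMn; lra.
  have [uc|uc] := leP (u - c) 0.
    by move=> _; apply: le_trans uc _; rewrite mulr_ge0 // addr_ge0 ?(ltW u0) ?(ltW c0).
  by rewrite ler_pXn2r ?nnegrE ?(ltW uc) ?mulr_ge0 ?addr_ge0 ?(ltW u0) ?(ltW c0).
have zE : nrm z = s * r by rewrite nw divfK // gt_eqF.
have -> : (r + nrm z) / (r - nrm z) * c = (1 + s) * c / (1 - s).
  by rewrite zE; field; rewrite ?gt_eqF // subr_gt0 // gtr_pMl.
rewrite ler_pdivlMr ?subr_gt0 //; lra.
Qed.

(* Zeros of [Q] in the smaller disc are divided out by Blaschke factors; each one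
   increases [|Q 0|] by at least [1 / rho], so that the process terminates. *)
Lemma growth_disc (rho : R) (n : nat) f Q : 0 < rho < 1 ->
  (forall z, udisc z -> cdiff f z) -> (forall z, udisc z -> cdiff Q z) ->
  (forall z, udisc z -> nrm (Q z) <= 1 / 2) ->
  (forall z, udisc z -> nrm (f z * Q z) <= 1 / 2) ->
  rho ^+ n < nrm (Q 0) -> forall z, nrm z < rho ->
  nrm (f z) <= expR ((rho + nrm z) / (rho - nrm z) * - ln (nrm (Q 0))).
Proof.
move=> /andP[rho0 rho1] df; elim: n Q => [|n IH] Q dQ Q1 fQ1 Qn.
  (* After n divisions the hypothesis would read 1 < |Q 0|, against the bound 1 / 2. *)
  have := Q1 0; rewrite /udisc nrm0 ltr01 => /(_ isT); rewrite expr0 in Qn; lra.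
have rD w : nrm w < rho -> udisc w by rewrite /udisc; lra.
have Q00 : 0 < nrm (Q 0) by apply: le_lt_trans Qn; rewrite exprn_ge0 // ltW.
have [[a [ar Qa]]|noz] := pselect (exists a, nrm a < rho /\ Q a = 0).
- have a1 := rD a ar.
  have [|q [Qq dq]] := @quotient0 Q a _ Qa.
    by apply: filterS (near_disc a1) => w; exact: dQ.
  pose Q' z := q z * (1 - a^* * z).
  have dlin z : cdiff (fun z => 1 - a^* * z) z.
    apply: cdiffB; first exact: cdiff_cst.
    by apply: cdiffM; [exact: cdiff_cst|exact: cdiff_id].
  have dQ' z : udisc z -> cdiff Q' z by move=> z1; apply: cdiffM => //; exact/dq/dQ.
  have Q'1 : forall z, udisc z -> nrm (Q' z) <= 1 / 2.
    apply: (blaschke_bound a1) => // z z1.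
    have -> : nrm (Q' z) * nrm (z - a) = nrm (Q z) * nrm (1 - a^* * z).
      by rewrite Qq /Q' !nrmM; ring.
    by rewrite ler_wpM2r ?nrm_ge0 // Q1.
  have fQ'1 : forall z, udisc z -> nrm (f z * Q' z) <= 1 / 2.
    apply: (blaschke_bound a1) => // [z z1|z z1].
      by apply: cdiffM; [exact: df|exact: dQ'].
    have -> : nrm (f z * Q' z) * nrm (z - a) = nrm (f z * Q z) * nrm (1 - a^* * z).
      by rewrite Qq /Q' !nrmM; ring.
    by rewrite ler_wpM2r ?nrm_ge0 // fQ1.
  have Q0E : nrm (Q 0) = nrm a * nrm (Q' 0).
    by rewrite Qq /Q' mulr0 subr0 mulr1 sub0r nrmM nrmN.
  have Q'0 : nrm (Q 0) <= rho * nrm (Q' 0).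
    by rewrite Q0E ler_wpM2r ?nrm_ge0 // ltW.
  have Q'n : rho ^+ n < nrm (Q' 0).
    by rewrite -(ltr_pM2l rho0) -exprS; apply: lt_le_trans Qn _.
  have Q'00 : 0 < nrm (Q' 0) by apply: le_lt_trans Q'n; rewrite exprn_ge0 // ltW.
  move=> z zr; apply: le_trans (IH Q' dQ' Q'1 fQ'1 Q'n z zr) _.
  rewrite ler_expR ler_wpM2l //.
    apply: divr_ge0; first by rewrite addr_ge0 ?nrm_ge0 ?(ltW rho0).
    by rewrite subr_ge0 ltW.
  rewrite lerN2 ler_ln ?posrE //; apply: le_trans Q'0 _.
  by rewrite ler_piMl ?nrm_ge0 // ltW.
- have nz z : nrm z < rho -> Q z != 0.
    by move=> zr; apply/negP => /eqP Qz; apply: noz; exists z.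
  have [|L [L0 dL QL]] := hol_log rho0 _ nz; first by move=> z /rD; exact: dQ.
  pose c := - ln (nrm (Q 0)).
  have Qh z : nrm z < rho -> nrm (Q z) <= 1 / 2 by move=> /rD; exact: Q1.
  have c0 : 0 < c.
    rewrite oppr_gt0 ln_lt0 // Q00; have := Qh 0; rewrite nrm0 => /(_ rho0); lra.
  (* Without zeros, -log |Q| is a positive harmonic function, the real part of [A]; Harnack bounds
     it and |f| <= 1 / |Q|. The bound 1 / 2 keeps it strictly positive. *)
  pose A z := c%:C - L z.
  have QA z : nrm z < rho -> nrm (Q z) = expR (- Re (A z)).
    move=> zr; rewrite (QL z zr) nrmM nrm_expC /A !ReIm /= opprB expRD.
    by rewrite /c opprK lnK ?posrE // mulrC.
  have Ap z : nrm z < rho -> 0 < Re (A z).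
    move=> zr; rewrite -oppr_lt0 -expR_lt1 -QA //; have := Qh z zr; lra.
  have dA z : nrm z < rho -> cdiff A z.
    by move=> zr; apply: cdiffB; [exact: cdiff_cst|exact: dL].
  have A0 : A 0 = c%:C by rewrite /A L0 subr0.
  move=> z zr; have HA := harnack c0 rho0 A0 dA Ap zr.
  have := fQ1 z (rD z zr); rewrite nrmM QA // expRN ler_pdivrMr ?expR_gt0 // => H.
  apply: (@le_trans _ _ (expR (Re (A z)))); last by rewrite ler_expR.
  by apply: le_trans H _; rewrite ler_piMl ?expR_ge0 //; lra.
Qed.

Lemma expr_small (r e : R) : 0 < r < 1 -> 0 < e -> exists n, r ^+ n < e.
Proof.
move=> /andP[r0 r1] e0.
have [n Hn] : exists n : nat, e^-1 * (r^-1 - 1)^-1 < n%:R.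
  by exists (Num.truncn (e^-1 * (r^-1 - 1)^-1)).+1; rewrite truncnS_gt.
have q0 : 0 < r^-1 - 1 by rewrite subr_gt0 invf_gt1.
exists n; rewrite -[ltRHS]invrK -[ltLHS]invrK ltf_pV2 ?posrE ?invr_gt0 ?exprn_gt0 //.
rewrite -exprVn; move: Hn; rewrite ltr_pdivrMr // => Hn; apply: lt_le_trans Hn _.
have : forall m : nat, 1 + m%:R * (r^-1 - 1) <= r^-1 ^+ m.
  elim=> [|m IH]; first by rewrite mul0r addr0 expr0.
  rewrite exprS -natr1; have m0 : 0 <= m%:R :> R by [].
  have ri : 0 < r^-1 by rewrite invr_gt0.
  have := ler_wpM2l (ltW ri) IH; have := sqr_ge0 (r^-1 - 1); nra.
by move=> /(_ n); lra.
Qed.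

(* The Cayley transform reduces to the disc; [f Q] plays the part of the numerator [P]. *)
Lemma bounded_type_growth f Q (M : R) z1 :
  (forall z, uhp z -> cdiff f z) -> (forall z, uhp z -> cdiff Q z) ->
  (forall z, uhp z -> nrm (Q z) <= M) -> (forall z, uhp z -> nrm (f z * Q z) <= M) ->
  uhp z1 -> Q z1 != 0 ->
  exists2 K : R, 0 <= K &
    forall z, uhp z -> nrm (f z) <= expR (K * (1 + nrm z ^+ 2) / Im z).
Proof.
move=> df dQ QM fQM u1 Qz1.
have M0 : 0 < M by apply: lt_le_trans (QM _ u1); rewrite nrm_gt0.
(* Maps the disc to the half-plane with 0 sent to [z1], where Q does not vanish; the inverse is (z -
   z1) / (z - conj z1). *)
pose cay w := z1 + (2 * Im z1)%:C * 'i * (w / (1 - w)).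
have w1 w : udisc w -> 1 - w != 0.
  by move=> w1; rewrite subr_eq0; apply: contraTneq w1 => <-; rewrite /udisc nrm1 ltxx.
have cayI w : udisc w -> uhp (cay w).
  move=> ww; have n1 : 0 < nrm (1 - w) ^+ 2 by rewrite exprn_gt0 // nrm_gt0 w1.
  rewrite /uhp /cay; have -> : Im (z1 + (2 * Im z1)%:C * 'i * (w / (1 - w))) =
     Im z1 * (1 - nrm w ^+ 2) / nrm (1 - w) ^+ 2.
    have iE (q : C) : Im (z1 + (2 * Im z1)%:C * 'i * q) = Im z1 + 2 * Im z1 * Re q.
      by rewrite !ReIm /=; ring.
    rewrite iE ReM Re_inv Im_inv !ReIm /=; set n := nrm (1 - w) ^+ 2 in n1 *.
    have nE : n = (1 - Re w) ^+ 2 + Im w ^+ 2 by rewrite /n nrm_sqr !ReIm /=; ring.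
    have n0 : n != 0 by rewrite gt_eqF.
    apply: (mulIf n0); rewrite divfK // nrm_sqr.
    transitivity (Im z1 * n + 2 * Im z1 * (Re w * (1 - Re w) - Im w ^+ 2)); first by field.
    by rewrite nE; ring.
  rewrite divr_gt0 // mulr_gt0 // subr_gt0 expr_lt1 // nrm_ge0 //.
have dcay w : udisc w -> cdiff cay w.
  move=> ww; apply: cdiffD; first exact: cdiff_cst.
  apply: cdiffM; first exact: cdiff_cst.
  apply: cdiff_div; [exact: cdiff_id| |exact: w1].
  by apply: cdiffB; [exact: cdiff_cst|exact: cdiff_id].
pose k : C := ((2 * M)^-1)%:C.
have kM (u : C) : nrm u <= M -> nrm (k * u) <= 1 / 2.
  move=> uM; rewrite nrmM nrmR gtr0_norm ?invr_gt0 ?mulr_gt0 //.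
  by rewrite mulrC ler_pdivrMr ?mulr_gt0 //; lra.
have cay0 : cay 0 = z1 by rewrite /cay mul0r mulr0 addr0.
pose Q1 w := k * Q (cay w).
have k0 : k != 0 by rewrite -nrm_gt0 nrmR normr_gt0 invr_neq0 // mulf_neq0 ?gt_eqF.
have Q10 : 0 < nrm (Q1 0) by rewrite nrm_gt0 /Q1 cay0 mulf_neq0.
pose L := - ln (nrm (Q1 0)).
have L0 : 0 <= L.
  rewrite oppr_ge0 ln_le0 //; have := kM _ (QM _ u1); rewrite /Q1 cay0; lra.
exists (4 * (1 + nrm z1 ^+ 2) / Im z1 * L).
  by rewrite mulr_ge0 // divr_ge0 ?(ltW u1) // mulr_ge0 // addr_ge0 // sqr_ge0.
move=> z uz; have zz1 : z - z1^* != 0.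
  apply/negP => /eqP /(congr1 (@complex.Im R)); case: (z1) (z) u1 uz => ? ? [? ?].
  rewrite /uhp /=; lra.
pose w := (z - z1) / (z - z1^*).
have nz : 0 < nrm (z - z1^*) ^+ 2 by rewrite exprn_gt0 // nrm_gt0.
have ws : 1 - nrm w ^+ 2 = 4 * Im z * Im z1 / nrm (z - z1^*) ^+ 2.
  rewrite nrm_div expr_div_n; apply: (mulIf (_ : nrm (z - z1^*) ^+ 2 != 0)).
    by rewrite gt_eqF.
  rewrite mulrBl !divfK ?gt_eqF // mul1r !nrm_sqr !ReIm.
  case: (z1) (z) => a b [x y] /=; ring.
have w1' : udisc w.
  rewrite /udisc -(@expr_lt1 _ 2) ?nrm_ge0 // -subr_gt0 ws divr_gt0 //.
  by rewrite !mulr_gt0.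
have cayw : cay w = z.
  have i2 : z1 - z1^* = (2 * Im z1)%:C * 'i.
    by case: (z1) => a b; apply: complex_eqP; rewrite !ReIm /=; ring.
  rewrite /cay -i2; have := w1 w w1'; have -> : 1 - w = (z1 - z1^*) / (z - z1^*).
    by rewrite /w; field.
  rewrite mulf_eq0 invr_eq0 negb_or => /andP[h1 h2].
  by rewrite /w; field; rewrite h1 h2.
set t := nrm w in w1' ws.
have t0 : 0 <= t by exact: nrm_ge0.
have t1 : t < 1 by [].
(* Midway between |w| and 1, so that the Harnack quotient is of order 1 / (1 - t^2), which is
   explicit in Im z. *)
pose rho := (1 + t) / 2.
have rho01 : 0 < rho < 1 by rewrite /rho; apply/andP; split; lra.
have [n Hn] := expr_small rho01 Q10.
have := @growth_disc rho n (fun w => f (cay w)) Q1 rho01 _ _ _ _ Hn w.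
rewrite cayw => H; have {H} := H _ _ _ _ _.
move=> H; have {H} : nrm (f z) <= expR ((rho + nrm w) / (rho - nrm w) * - ln (nrm (Q1 0))).
  apply: H.
  - by move=> v v1; apply: (@cdiff_comp _ cay); [exact: dcay|exact/df/cayI].
  - move=> v v1; apply: cdiffM; first exact: cdiff_cst.
    by apply: (@cdiff_comp _ cay); [exact: dcay|exact/dQ/cayI].
  - by move=> v v1; apply: kM; exact/QM/cayI.
  - by move=> v v1; rewrite /Q1 mulrCA; apply: kM; exact/fQM/cayI.
  - by rewrite -/t /rho; lra.
rewrite -/t -/L => /le_trans; apply; rewrite ler_expR.
have t2 : 0 < 1 - t ^+ 2 by rewrite subr_gt0 expr_lt1.
have E : (rho + t) / (rho - t) <= 8 / (1 - t ^+ 2).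
  have -> : (rho + t) / (rho - t) = (1 + 3 * t) * (1 + t) / (1 - t ^+ 2).
    have n1 : 1 - t != 0 by rewrite gt_eqF // subr_gt0.
    have n2 : 1 + t != 0 by rewrite gt_eqF //; lra.
    have -> : 1 - t ^+ 2 = (1 - t) * (1 + t) by ring.
    have -> : rho + t = (1 + 3 * t) / 2 by rewrite /rho; field.
    have -> : rho - t = (1 - t) / 2 by rewrite /rho; field.
    by field; rewrite n1 n2.
  rewrite ler_pM2r ?invr_gt0 //; nra.
apply: (@le_trans _ _ (8 / (1 - t ^+ 2) * L)); first by rewrite ler_wpM2r.
have -> : 8 / (1 - t ^+ 2) * L = L * (2 * nrm (z - z1^*) ^+ 2 / (Im z * Im z1)).
  by rewrite ws; field; rewrite !gt_eqF // -?nrm_gt0 ?nrm_gt0.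
have -> : 4 * (1 + nrm z1 ^+ 2) / Im z1 * L * (1 + nrm z ^+ 2) / Im z =
   L * (4 * (1 + nrm z1 ^+ 2) * (1 + nrm z ^+ 2) / (Im z * Im z1)).
  by field; rewrite !gt_eqF.
rewrite ler_wpM2l // ler_pM2r ?invr_gt0 ?mulr_gt0 //.
have : nrm (z - z1^*) ^+ 2 <= (nrm z + nrm z1) ^+ 2.
  rewrite lerXn2r ?nnegrE ?addr_ge0 ?nrm_ge0 //.
  by apply: le_trans (nrmB _ _) _; rewrite nrm_conj.
have := sqr_ge0 (nrm z - nrm z1); have := sqr_ge0 (nrm z * nrm z1); nra.
Qed.

End BoundedType.

(** * Integrals along the boundary of the half-plane *)

Section Contour.
Variable R : realType.
Local Notation C := R[i].
Implicit Types (x y t : R) (f g k : C -> C) (z w p : C).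

Definition chp z := 0 <= Im z.

(** Symmetric truncation of a principal value at 0. *)
Definition punct (f : R -> C) (d r : R) : C := cu (- r) (- d) f + cu d r f.

(** The segment from -d to d is replaced by three sides of the rectangle of height d above it, and
    the path is closed by three sides of the rectangle of height r. The outer sides have length 4 r
    and |V| <= C2 / r^2 there; the inner sides have length 4 d and |V| <= C1. *)
Lemma contour V (C1 C2 : R) :
  (forall z, chp z -> z != 0 -> cdiff V z) ->
  (forall z, chp z -> z != 0 -> nrm (V z) <= C1) ->
  (forall z, chp z -> z != 0 -> nrm (V z) <= C2 / nrm z ^+ 2) ->
  forall d r : R, 0 < d -> d <= r ->
    nrm (punct (fun t => V (t +i* 0)) d r) <= 4 * C2 / r + 4 * C1 * d.
Proof.
move=> dV V1 V2 d r d0 dr.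
have r0 : 0 < r by lra.
have c0 (x y : R) : 0 <= y -> x != 0 \/ y != 0 -> chp (x +i* y) /\ (x +i* y) != 0.
  move=> y0 xy; split => //; apply/negP => /eqP [xE yE].
  by case: xy; rewrite ?xE ?yE eqxx.
have dV' (x y : R) : 0 <= y -> x != 0 \/ y != 0 -> cdiff V (x +i* y).
  by move=> y0 xy; have [? ?] := c0 x y y0 xy; exact: dV.
have n0 (x y : R) : 0 <= y -> x != 0 \/ y != 0 -> nrm (V (x +i* y)) <= C1.
  by move=> y0 xy; have [? ?] := c0 x y y0 xy; exact: V1.
have C20 : 0 <= C2.
  have [h1 h2] := c0 r 0 (lexx _) (or_introl (lt0r_neq0 r0)).
  have := le_trans (nrm_ge0 _) (V2 _ h1 h2).
  by rewrite pmulr_lge0 // invr_gt0 exprn_gt0 // nrm_gt0.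
have far (x y : R) : 0 <= y -> r <= `|x| \/ r <= y -> nrm (V (x +i* y)) <= C2 / r ^+ 2.
  move=> y0 xy.
  have rn : r <= nrm (x +i* y).
    case: xy => h; first by apply: le_trans h (Re_le_nrm (x +i* y)).
    by apply: le_trans h _; apply: le_trans (Im_le_nrm (x +i* y)); exact: ler_norm.
  have [h1 h2] : chp (x +i* y) /\ (x +i* y) != 0.
    by split => //; rewrite -nrm_gt0; lra.
  apply: le_trans (V2 _ h1 h2) _; rewrite ler_wpM2l // lef_pV2 ?posrE ?exprn_gt0 //; last lra.
  by rewrite lerXn2r ?nnegrE ?nrm_ge0 // ltW.
have GA : rectI V (- r) (- d) 0 r = 0.
  apply: goursat => [||x y /andP[? ?] /andP[? ?]]; try lra.
  by apply: dV' => //; left; rewrite lt_eqF //; lra.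
have GB : rectI V (- d) d d r = 0.
  apply: goursat => [||x y /andP[? ?] /andP[? ?]]; try lra.
  by apply: dV'; [lra|right; rewrite gt_eqF //; lra].
have GC : rectI V d r 0 r = 0.
  apply: goursat => [||x y /andP[? ?] /andP[? ?]]; try lra.
  by apply: dV' => //; left; rewrite gt_eqF //; lra.
have ch (a b y : R) : 0 <= y -> (y != 0 \/ 0 < a \/ b < 0) -> contI a b (fun t => V (t +i* y)).
  move=> y0 H t /andP[ta tb]; apply: cont_h; apply: cdiff_cont; apply: dV' => //.
  by case: H => [|[|]] ?; [right|left; rewrite gt_eqF //; lra|left; rewrite lt_eqF //; lra].
have cv (a b x : R) : 0 <= a -> x != 0 -> contI a b (fun t => V (x +i* t)).
  by move=> a0 x0 t /andP[ta tb]; apply: cont_v; apply: cdiff_cont; apply: dV'; [lra|left].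
have dn0 : d != 0 by rewrite gt_eqF.
have dN0 : - d != 0 by rewrite oppr_eq0.
have rn0 : r != 0 by rewrite gt_eqF.
have rN0 : - r != 0 by rewrite oppr_eq0.
have r0' := ltW r0; have d0' := ltW d0.
have o1 : - r <= - d by rewrite lerN2.
have o2 : - d <= d by lra.
move: GA GB GC; rewrite /rectI !cint_le //.
rewrite (@cu_chasles _ 0 d r (fun y => V (- d +i* y))) ?(ltW d0) //; last exact: cv.
rewrite (@cu_chasles _ 0 d r (fun y => V (d +i* y))) ?(ltW d0) //; last exact: cv.
set I1 := cu (- r) (- d) (fun x => V (x +i* 0)).
set T1 := cu (- r) (- d) (fun x => V (x +i* r)).
set S1 := cu 0 d (fun y => V (- d +i* y)).
set S2 := cu d r (fun y => V (- d +i* y)).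
set S3 := cu 0 r (fun y => V (- r +i* y)).
set B2 := cu (- d) d (fun x => V (x +i* d)).
set T2 := cu (- d) d (fun x => V (x +i* r)).
set S4 := cu d r (fun y => V (d +i* y)).
set I3 := cu d r (fun x => V (x +i* 0)).
set T3 := cu d r (fun x => V (x +i* r)).
set S5 := cu 0 r (fun y => V (r +i* y)).
set S6 := cu 0 d (fun y => V (d +i* y)).
move=> GA GB GC.
have -> : punct (fun t => V (t +i* 0)) d r = (T1 + T2 + T3) + 'i * (S3 - S5) + (- B2 + 'i * (S6 - S1)).
  rewrite /punct -/I1 -/I3; apply/eqP; rewrite -subr_eq0; apply/eqP.
  have := congr2 +%R (congr2 +%R GA GB) GC; rewrite !addr0 => <-; ring.
have bT1 : nrm T1 <= C2 / r ^+ 2 * (- d - - r).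
  apply: nrm_cu_le; [exact: o1|apply: ch; [exact: r0'|by left]|].
  by move=> t _; apply: far; [exact: r0'|right].
have bT2 : nrm T2 <= C2 / r ^+ 2 * (d - - d).
  apply: nrm_cu_le; [exact: o2|apply: ch; [exact: r0'|by left]|].
  by move=> t _; apply: far; [exact: r0'|right].
have bT3 : nrm T3 <= C2 / r ^+ 2 * (r - d).
  apply: nrm_cu_le; [exact: dr|apply: ch; [exact: r0'|by left]|].
  by move=> t _; apply: far; [exact: r0'|right].
have bS3 : nrm S3 <= C2 / r ^+ 2 * (r - 0).
  apply: nrm_cu_le; [exact: r0'|exact: cv|].
  by move=> t /andP[? _]; apply: far => //; left; rewrite normrN gtr0_norm.
have bS5 : nrm S5 <= C2 / r ^+ 2 * (r - 0).
  apply: nrm_cu_le; [exact: r0'|exact: cv|].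
  by move=> t /andP[? _]; apply: far => //; left; rewrite gtr0_norm.
have bB2 : nrm B2 <= C1 * (d - - d).
  apply: nrm_cu_le; [exact: o2|apply: ch; [exact: d0'|by left]|].
  by move=> t _; apply: n0; [exact: d0'|right].
have bS6 : nrm S6 <= C1 * (d - 0).
  apply: nrm_cu_le; [exact: d0'|exact: cv|].
  by move=> t /andP[? _]; apply: n0 => //; left.
have bS1 : nrm S1 <= C1 * (d - 0).
  apply: nrm_cu_le; [exact: d0'|exact: cv|].
  by move=> t /andP[? _]; apply: n0 => //; left.
apply: le_trans (nrmD _ _) _; apply: lerD.
  apply: le_trans (nrmD _ _) _; rewrite nrmM nrmi mul1r.
  have := nrmB S3 S5; have := nrmD (T1 + T2) T3; have := nrmD T1 T2.
  have -> : 4 * C2 / r = C2 / r ^+ 2 * (4 * r) by field.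
  clearbody T1 T2 T3 S3 S5; clear -bT1 bT2 bT3 bS3 bS5; lra.
apply: le_trans (nrmD _ _) _; rewrite nrmN nrmM nrmi mul1r.
have := nrmB S6 S1; clearbody S6 S1 B2; clear -bB2 bS1 bS6; lra.
Qed.

(** The base path lies on the real axis, so values of the primitive there are integrals of [k] along
    the line. *)
Lemma closed_primitive k : (forall z, chp z -> \forall w \near z, cdiff k w) ->
  forall z, chp z -> isd (primC 0 0 k) z (k z).
Proof.
move=> dk z z0; have [d d0 dP] := near_square (dk z z0).
apply: (primC_isd d0).
- move=> t _; apply: cont_h; apply: cdiff_cont.
  by apply: (nbhs_singleton (dk (t +i* 0) _)); exact: lexx.
- move=> x y _; rewrite (min_l z0) (max_r z0) => /andP[y0 _].
  exact: (nbhs_singleton (dk (x +i* y) y0)).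
- by move=> x y hx hy; apply: cdiff_cont; exact: dP.
Qed.

End Contour.

(** * Growth of the primitive of an integrable boundary function *)

Section HalfPlanePrimitive.
Variable R : realType.
Local Notation C := R[i].
Implicit Types (x y t : R) (f g k : C -> C) (z w p : C).

Lemma exp_absorb (N K w q : R) : 0 <= N -> 0 <= K -> 2 <= w -> q <= expR (3 * w) ->
  N + expR (2 * K * w) * q <= expR (N * w + (2 * K + 4) * w).
Proof.
move=> N0 K0 w2 w3.
have e1 : expR (2 * K * w) * q <= expR ((2 * K + 3) * w).
  have -> : (2 * K + 3) * w = 2 * K * w + 3 * w by ring.
  by rewrite expRD ler_wpM2l ?expR_ge0.
have e2 : N <= expR (N * w).
  apply: le_trans (expR_ge1Dx _); have : N * 1 <= N * w by rewrite ler_wpM2l //; lra.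
  lra.
have -> : (2 * K + 4) * w = (2 * K + 3) * w + w by ring.
rewrite !expRD.
have e3 : 2 <= expR w by apply: le_trans (expR_ge1Dx _); lra.
have e4 : 1 <= expR (N * w) by rewrite -[leLHS]expR0 ler_expR mulr_ge0 //; lra.
have k3 : 0 <= 2 * K + 3 by lra.
have e5 : 1 <= expR ((2 * K + 3) * w) by rewrite -[leLHS]expR0 ler_expR (mulr_ge0 k3) //; lra.
set a := expR (N * w) in e2 e4 *; set b := expR ((2 * K + 3) * w) in e1 e5 *.
set c := expR w in e3 *.
have h1 : N + expR (2 * K * w) * q <= a + b by exact: lerD.
apply: le_trans h1 _.
have h2 : a * (b * 2) <= a * (b * c).
  rewrite ler_wpM2l //; first by lra.
  by rewrite ler_wpM2l //; lra.
apply: le_trans h2.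
have := mulr_ge0 (_ : 0 <= a - 1) (_ : 0 <= b - 1).
rewrite !subr_ge0 => /(_ e4 e5) h3.
have h4 : 0 <= (a - 1) * b by rewrite mulr_ge0 ?subr_ge0 //; lra.
lra.
Qed.

Section HalfPlaneBound.
Variables (k : C -> C) (M K : R) (x1 : R).
Hypothesis dk : forall z, chp z -> \forall w \near z, cdiff k w.
Hypothesis M1 : 1 <= M.
Hypothesis kM : forall a b : R, ru a b (fun t => nrm (k (t +i* 0))) <= M.
Hypothesis K0 : 0 <= K.
Hypothesis kK : forall z, uhp z -> nrm (k z) <= expR (K * (1 + nrm z ^+ 2) / Im z).
Hypothesis kmt : forall e : R, 0 < e -> exists Y : R, forall y, Y <= y ->
  nrm (k (x1 +i* y)) <= expR (e * y).

Let P := primC 0 0 k.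

Let dkc z : chp z -> cdiff k z.
Proof. by move=> /dk; exact: nbhs_singleton. Qed.

Let dP z : chp z -> isd P z (k z).
Proof. exact: closed_primitive. Qed.

Let cP z : chp z -> cont P z.
Proof. by move=> /dP /isd_cont. Qed.

Let uc z : uhp z -> chp z. Proof. exact: ltW. Qed.

Lemma prim_real x : nrm (P (x +i* 0)) <= M.
Proof.
rewrite /P /primC /= /cint subrr mulr0 addr0.
have cc (a b : R) : contI a b (fun t => k (t +i* 0)).
  by move=> t _; apply: cont_h; apply: cdiff_cont; apply: dkc; exact: lexx.
have [x0|/ltW x0] := leP 0 x.
  by rewrite (cu_eq0 _ x0) subr0; apply: le_trans (nrm_cu (cc _ _)) _; exact: kM.
by rewrite (cu_eq0 _ x0) sub0r nrmN; apply: le_trans (nrm_cu (cc _ _)) _; exact: kM.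
Qed.

Lemma prim_axis : axis_le P M.
Proof.
move=> x e e0; have cx : chp x%:C by exact: lexx.
apply: filterS (cP cx e0) => z zP _.
have := nrm_sub (P z) (P x%:C); have : nrm (P x%:C) <= M by exact: prim_real.
lra.
Qed.

Lemma prim_vdiff (x a b N : R) : 0 < a -> a <= b ->
  (forall s, a <= s <= b -> nrm (k (x +i* s)) <= N) ->
  nrm (P (x +i* b) - P (x +i* a)) <= N * (b - a).
Proof.
move=> a0 ab kN.
have cc : contI a b (fun s => k (x +i* s)).
  move=> t /andP[ta _]; apply: cont_v; apply: cdiff_cont; apply: dkc.
  by rewrite /chp /=; lra.
have := @cu_FTC _ a b (fun s => P (x +i* s)) (fun s => 'i * k (x +i* s)) ab.
rewrite cuZ // => <-.
- by rewrite nrmM nrmi mul1r; exact: nrm_cu_le.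
- by move=> t tt; apply: contM; [exact: cont_cst|exact: cc].
- move=> t /andP[ta _]; apply: rderiv_v; apply: dP.
  by rewrite /chp /=; lra.
Qed.

Lemma prim_hdiff (y a b N : R) : 0 < y -> a <= b ->
  (forall s, a <= s <= b -> nrm (k (s +i* y)) <= N) ->
  nrm (P (b +i* y) - P (a +i* y)) <= N * (b - a).
Proof.
move=> y0 ab kN; have yc x : chp (x +i* y) by exact: ltW.
have cc : contI a b (fun s => k (s +i* y)).
  by move=> t _; apply: cont_h; apply: cdiff_cont; exact: dkc.
rewrite -(@cu_FTC _ a b (fun s => P (s +i* y)) (fun s => k (s +i* y)) ab) //.
  exact: nrm_cu_le.
by move=> t _; apply: rderiv_h; exact: dP.
Qed.

(** Integration from i vertically to the height of z and then horizontally: along this path the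
    growth exponent is at most twice its value at z, and the length of the path is absorbed into the
    constant. *)
Lemma prim_growth : exists2 K' : R, 0 <= K' &
  forall z, uhp z -> nrm (P z) <= expR (K' * (1 + nrm z ^+ 2) / Im z).
Proof.
have HK0 := K0; pose N := nrm (P 'i); have N0 : 0 <= N by exact: nrm_ge0.
exists (N + 2 * K + 4); first by rewrite !addr_ge0 ?mulr_ge0.
case=> x y; rewrite /uhp /= => y0; set z := x +i* y.
pose w := (1 + nrm z ^+ 2) / y.
have nz := nrm_sqr z; rewrite /= in nz.
have nz0 : 0 <= nrm z by exact: nrm_ge0.
have yz : y <= nrm z by apply: le_trans (Im_le_nrm z); exact: ler_norm.
have xz : `|x| <= nrm z by exact: (Re_le_nrm z).
have w2 : 2 <= w by rewrite ler_pdivlMr //; have := sqr_ge0 (nrm z - 1); lra.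
have wz : nrm z <= w.
  by rewrite ler_pdivlMr //; have := ler_wpM2l nz0 yz; have := sqr_ge0 (nrm z); lra.
have -> : (N + 2 * K + 4) * (1 + nrm z ^+ 2) / y = N * w + (2 * K + 4) * w.
  by rewrite /w; ring.
have vert : nrm (P (0 +i* y) - P 'i) <= expR (2 * K * w) * `|y - 1|.
  have mid s : 0 < s -> (1 <= s <= y \/ y <= s <= 1) ->
      nrm (k (0 +i* s)) <= expR (2 * K * w).
    move=> s0 hs; apply: le_trans (kK (z := 0 +i* s) s0) _; rewrite ler_expR /=.
    have -> : nrm (0 +i* s) ^+ 2 = s ^+ 2 by rewrite nrm_sqr /= expr0n add0r.
    rewrite -mulrA -!mulrA [2 * _]mulrCA ler_wpM2l // ler_pdivrMr //.
    have -> : 2 * w * s = 2 * (1 + nrm z ^+ 2) * (s / y) by rewrite /w; ring.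
    have q : 1 + y ^+ 2 <= 1 + nrm z ^+ 2 by rewrite nz; have := sqr_ge0 x; lra.
    apply: (@le_trans _ _ (2 * (1 + y ^+ 2) * (s / y))); last first.
      by rewrite ler_wpM2r ?divr_ge0 ?(ltW s0) ?(ltW y0) //; lra.
    rewrite mulrA ler_pdivlMr //.
    have sy : 0 <= s * y by rewrite mulr_ge0 ?(ltW s0) ?(ltW y0).
    case: hs => /andP[h1 h2].
      have a1 : 0 <= y * (s - 1) by rewrite mulr_ge0 ?(ltW y0) // subr_ge0.
      have a2 : 0 <= s * y * (y - 1) by rewrite mulr_ge0 // subr_ge0; lra.
      have a3 : 0 <= s * y * (y - s) by rewrite mulr_ge0 // subr_ge0.
      lra.
    have a1 : 0 <= s * (1 - s * y).
      by rewrite mulr_ge0 ?(ltW s0) // subr_ge0 mulr_ile1 ?(ltW s0) ?(ltW y0) //; lra.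
    have a2 : 0 <= y ^+ 2 * s by rewrite mulr_ge0 ?sqr_ge0 ?(ltW s0).
    lra.
  have [y1|/ltW y1] := leP 1 y.
    rewrite ger0_norm ?subr_ge0 //; apply: prim_vdiff => // s /andP[s1 s2].
    by apply: mid; [lra|left; apply/andP].
  rewrite ler0_norm ?subr_le0 // opprB nrm_distC; apply: prim_vdiff => // s /andP[s1 s2].
  by apply: mid; [lra|right; apply/andP].
have horiz : nrm (P z - P (0 +i* y)) <= expR (2 * K * w) * `|x|.
  have mid s : `|s| <= `|x| -> nrm (k (s +i* y)) <= expR (2 * K * w).
    move=> sx; apply: le_trans (kK (z := s +i* y) y0) _; rewrite ler_expR /=.
    rewrite -mulrA [2 * K]mulrC -[leRHS]mulrA ler_wpM2l //.
    apply: (@le_trans _ _ w); last lra.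
    rewrite ler_pM2r ?invr_gt0 // lerD2l nz nrm_sqr /= lerD2r.
    by rewrite -[leLHS]real_normK ?num_real // -[leRHS]real_normK ?num_real // lerXn2r ?nnegrE.
  have [x0|/ltW x0] := leP 0 x.
    rewrite (ger0_norm x0) -[leRHS]/(_ * x) -[X in _ * X](subr0 x).
    apply: prim_hdiff => // s /andP[s1 s2].
    by apply: mid; rewrite !ger0_norm.
  rewrite (ler0_norm x0) nrm_distC -[X in _ * X]sub0r; apply: prim_hdiff => // s /andP[s1 s2].
  by apply: mid; rewrite !ler0_norm //; lra.
have tri : nrm (P z) <= N + expR (2 * K * w) * (`|y - 1| + `|x|).
  have t1 := nrm_sub (P z) (P (0 +i* y)); have t2 := nrm_sub (P (0 +i* y)) (P 'i).
  move: (le_trans t1 horiz) (le_trans t2 vert); rewrite !lerBlDr => t3 t4; rewrite mulrDr /N.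
  by apply: le_trans t3 _; rewrite [leRHS]addrC [_ + _ * `|x|]addrC -addrA lerD2l.
have w3 : `|y - 1| + `|x| <= expR (3 * w).
  apply: le_trans (expR_ge1Dx _).
  have : `|y - 1| <= nrm z + 1.
    by apply: le_trans (ler_normB _ _) _; rewrite normr1 (gtr0_norm y0) lerD2r.
  lra.
apply: le_trans tri _; exact: exp_absorb.
Qed.

End HalfPlaneBound.
End HalfPlanePrimitive.

(** * Boundedness of the primitive *)

Section MeanTypeBound.
Variable R : realType.
Local Notation C := R[i].
Implicit Types (x y t : R) (f g k : C -> C) (z w p : C).

Section HalfPlaneBound.
Variables (k : C -> C) (M K : R) (x1 : R).
Hypothesis dk : forall z, chp z -> \forall w \near z, cdiff k w.
Hypothesis M1 : 1 <= M.
Hypothesis kM : forall a b : R, ru a b (fun t => nrm (k (t +i* 0))) <= M.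
Hypothesis K0 : 0 <= K.
Hypothesis kK : forall z, uhp z -> nrm (k z) <= expR (K * (1 + nrm z ^+ 2) / Im z).
Hypothesis kmt : forall e : R, 0 < e -> exists Y : R, forall y, Y <= y ->
  nrm (k (x1 +i* y)) <= expR (e * y).

Let P := primC 0 0 k.

Let dkc z : chp z -> cdiff k z.
Proof. by move=> /dk; exact: nbhs_singleton. Qed.

Let dP z : chp z -> isd P z (k z).
Proof. exact: closed_primitive. Qed.

Let cP z : chp z -> cont P z.
Proof. by move=> /dP /isd_cont. Qed.

Let uc z : uhp z -> chp z. Proof. exact: ltW. Qed.

(** Bounded type gives exponential type for the primitive; the mean type makes it subexponential on
    one vertical line. That line and the real axis bound two quadrants, where exponential type is
    below the critical order, and a final appeal to the half-plane principle restores the constant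
    [M]. *)
Lemma prim_bounded z : uhp z -> nrm (P z) <= M.
Proof.
have HM1 := M1; have M0 : 0 < M by lra.
have [K' K'0 PK'] := prim_growth dk K0 kK.
have PM := PL_half_plane1 (fun z uz => ex_intro _ _ (dP (uc uz))) (prim_axis dk kM) M1 K'0 PK'.
pose c := 16 * K'.
have c0 : 0 <= c by rewrite mulr_ge0.
have PMc w : chp w -> nrm (P w) <= M * expR (c * Im w).
  case: w => x y; rewrite /chp /= le_eqVlt => /predU1P[<-|y0]; last exact: PM.
  by rewrite mulr0 expR0 mulr1; exact: (prim_real dk kM).
pose Q w := P (x1%:C + w).
have Imx w : Im (x1%:C + w) = Im w by rewrite ImD /= add0r.
have dQ w : chp w -> cdiff Q w.
  move=> cw; apply: (@cdiff_comp _ (fun w => x1%:C + w)).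
    by apply: cdiffD; [exact: cdiff_cst|exact: cdiff_id].
  by eexists; apply: dP; rewrite /chp Imx.
have QMc w : chp w -> nrm (Q w) <= M * expR (c * Im w).
  by move=> cw; rewrite -Imx; apply: PMc; rewrite /chp Imx.
(* Below [Y] the exponential type bound serves; above it, e is spent on the integrand and once more
   on the length of the path, whence 2 e. *)
have vaxis (e : R) : 0 < e -> exists2 N : R, M <= N & forall y, 0 <= y ->
    nrm (Q (0 +i* y)) <= N * expR (2 * e * y).
  move=> e0; have [Y0 HY0] := kmt e0; pose Y := Num.max 1 Y0.
  have Y1 : 1 <= Y by rewrite le_max lexx.
  have HY y : Y <= y -> nrm (k (x1 +i* y)) <= expR (e * y).
    by move=> Yy; apply: HY0; apply: le_trans Yy; rewrite le_max lexx orbT.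
  exists (M * expR (c * Y) + e^-1).
    rewrite ler_wpDr ?invr_ge0 ?(ltW e0) // ler_peMr ?(ltW M0) //.
    by rewrite -[leLHS]expR0 ler_expR mulr_ge0 //; lra.
  have Qlow y : 0 <= y -> y <= Y -> nrm (Q (0 +i* y)) <= M * expR (c * Y).
    move=> y0 yY; apply: le_trans (QMc (0 +i* y) y0) _ => /=.
    by rewrite ler_wpM2l ?(ltW M0) // ler_expR ler_wpM2l.
  move=> y y0; have ee : 1 <= expR (2 * e * y).
    by rewrite -[leLHS]expR0 ler_expR !mulr_ge0 // ltW.
  have p0 : 0 <= M * expR (c * Y) by rewrite mulr_ge0 ?expR_ge0 // ltW.
  have [yY|/ltW yY] := leP y Y.
    apply: le_trans (Qlow y y0 yY) _; rewrite mulrDl.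
    rewrite ler_wpDr ?mulr_ge0 ?invr_ge0 ?expR_ge0 ?(ltW e0) //.
    by rewrite ler_peMr.
  have E s : x1%:C + (0 +i* s) = x1 +i* s by apply: complex_eqP; rewrite !ReIm /= ?addr0 ?add0r.
  have Ydiff : nrm (Q (0 +i* y) - Q (0 +i* Y)) <= expR (e * y) * (y - Y).
    rewrite /Q !E; apply: (prim_vdiff dk) => //; first lra.
    move=> s /andP[s1 s2]; apply: le_trans (HY s s1) _.
    by rewrite ler_expR ler_wpM2l // ltW.
  have := nrm_sub (Q (0 +i* y)) (Q (0 +i* Y)).
  have := Qlow Y (le_trans ler01 Y1) (lexx _).
  have -> : expR (2 * e * y) = expR (e * y) * expR (e * y) by rewrite -expRD; congr expR; ring.
  have ey : y - Y <= e^-1 * expR (e * y).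
    rewrite -ler_pdivrMl ?invr_gt0 // invrK.
    apply: le_trans (expR_ge1Dx _); have : e * (y - Y) <= e * y by rewrite ler_pM2l //; lra.
    lra.
  have := ler_wpM2l (expR_ge0 (e * y)) ey => h1 h2 h3.
  have ee2 : M * expR (c * Y) <= M * expR (c * Y) * (expR (e * y) * expR (e * y)).
    rewrite ler_peMr // -expRD -[leLHS]expR0 ler_expR addr_ge0 // mulr_ge0 ?(ltW e0) //.
  lra.
have main (e : R) : 0 < e -> forall w, uhp w -> nrm (Q w) <= M * expR (2 * e * Im w).
  move=> e0; have [N MN HN] := vaxis e e0.
  have N0 : 0 < N by apply: lt_le_trans MN.
  (* The factor has modulus exp(-2 e Im w): it is 1 on the real axis and cancels the growth on the
     vertical one. *)
  pose g w := Q w * expC ((2 * e)%:C * 'i * w).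
  have ng w : nrm (g w) = nrm (Q w) * expR (- (2 * e * Im w)).
    by rewrite nrmM nrm_expC; congr (_ * expR _); rewrite !ReIm /=; ring.
  have dg w : chp w -> cdiff g w.
    move=> cw; apply: cdiffM; first exact: dQ.
    by apply: cdiff_expC; apply: cdiffM; [exact: cdiff_cst|exact: cdiff_id].
  have greal x : nrm (g (x +i* 0)) <= M.
    rewrite ng /= mulr0 oppr0 expR0 mulr1.
    by have := QMc (x +i* 0) (lexx _); rewrite /= mulr0 expR0 mulr1.
  have gvert y : 0 <= y -> nrm (g (0 +i* y)) <= N.
    by move=> y0; rewrite ng expRN ler_pdivrMr ?expR_gt0 //; exact: HN.
  have ggrow w : chp w -> nrm (g w) <= N * expR (c * (1 + nrm w)).
    move=> cw; apply: (@le_trans _ _ (nrm (Q w))).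
      rewrite ng ler_piMr ?nrm_ge0 // -[leRHS]expR0 ler_expR oppr_le0 !mulr_ge0 // ltW //.
    apply: le_trans (QMc w cw) _; apply: ler_pM; rewrite ?expR_ge0 ?(ltW M0) //.
    rewrite ler_expR ler_wpM2l //.
    have := Im_le_nrm w; have := ler_norm (Im w); lra.
  have qbd (s : C -> C) : (forall w, cdiff s w) -> (forall w, quadrant w -> uhp (s w)) ->
      (forall w, nrm (s w) = nrm w) ->
      (forall p, ~ quadrant p -> adherent (@quadrant R) p ->
        exists t, 0 <= t /\ (s p = t +i* 0 \/ s p = (- t) +i* 0 \/ s p = 0 +i* t)) ->
      forall w, quadrant w -> nrm (g (s w)) <= N.
    move=> ds us ns bs; apply: (@PL_quadrant _ (fun w => g (s w)) N c) => //.
    - move=> w qw; apply: cdiff_comp => //; apply: dg; exact/uc/us.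
    - move=> p np ap; have [t [t0 st]] := bs p np ap.
      have [gp csp] : nrm (g (s p)) <= N /\ chp (s p).
        case: st => [->|[->|->]]; split; rewrite /chp /= ?lexx //.
        + by apply: le_trans MN; exact: greal.
        + by apply: le_trans MN; exact: greal.
        + exact: gvert.
      have cgp : cont (fun w => g (s w)) p.
        by apply: cdiff_cont; apply: cdiff_comp => //; exact: dg.
      move=> r r0; apply: filterS (cgp r r0) => w gw _.
      have := nrm_sub (g (s w)) (g (s p)); lra.
    - by move=> w qw; rewrite -(ns w); apply: ggrow; exact/uc/us.
  have adq p : ~ quadrant p -> adherent (@quadrant R) p ->
      0 <= Re p /\ 0 <= Im p /\ (Re p = 0 \/ Im p = 0).
    move=> np ap.
    have h1 : 0 <= Re p.
      rewrite leNgt; apply/negP => h; have [|w [w1 w2]] := ap (- Re p); first by rewrite oppr_gt0.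
      have := Re_le_nrm (w - p); rewrite !ReIm ler_norml => /andP[_ ?]; lra.
    have h2 : 0 <= Im p.
      rewrite leNgt; apply/negP => h; have [|w [w1 w2]] := ap (- Im p); first by rewrite oppr_gt0.
      have := Im_le_nrm (w - p); rewrite !ReIm ler_norml => /andP[_ ?]; lra.
    split => //; split => //; move: h1; rewrite le_eqVlt => /predU1P[<-|h1]; first by left.
    move: h2; rewrite le_eqVlt => /predU1P[<-|h2]; first by right.
    by exfalso; apply: np.
  have q1 : forall w, quadrant w -> nrm (g w) <= N.
    apply: (qbd (fun w => w)) => //; first by move=> w; exact: cdiff_id.
      by move=> w [].
    move=> [a b] np ap; have [/= a0 [b0 [ab|ab]]] := adq _ np ap.
      by exists b; split => //; right; right; rewrite ab.
    by exists a; split => //; left; rewrite ab.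
  (* Multiplication by i carries the first quadrant to the second. *)
  have q2 : forall w, quadrant w -> nrm (g ('i * w)) <= N.
    apply: (qbd (fun w => 'i * w)).
    - by move=> w; apply: cdiffM; [exact: cdiff_cst|exact: cdiff_id].
    - by move=> [a b] [/= a0 b0]; rewrite /uhp !ReIm /=; lra.
    - by move=> w; rewrite nrmM nrmi mul1r.
    - move=> [a b] np ap; have [/= a0 [b0 [ab|ab]]] := adq _ np ap.
        exists b; split => //; right; left.
        by rewrite ab; apply: complex_eqP; rewrite !ReIm /=; ring.
      exists a; split => //; right; right.
      by rewrite ab; apply: complex_eqP; rewrite !ReIm /=; ring.
  have gN w : uhp w -> nrm (g w) <= N.
    case: w => a b b0; have [a0|a0|a0] := ltgtP 0 a.
    - exact: q1.
    - have -> : a +i* b = 'i * (b +i* (- a)) by apply: complex_eqP; rewrite !ReIm /=; ring.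
      by apply: q2; split => //=; rewrite oppr_gt0.
    - by rewrite -a0; apply: gvert; exact: ltW.
  have gM : axis_le g M.
    move=> x r r0; have cx : cont g x%:C by apply/cdiff_cont/dg; exact: lexx.
    apply: filterS (cx r r0) => w gw _.
    have := nrm_sub (g w) (g x%:C); have : nrm (g x%:C) <= M by exact: greal.
    lra.
  move=> w uw; have := PL_half_plane2 (fun z uz => dg z (uc uz)) gM M0 gN uw.
  by rewrite ng expRN ler_pdivrMr ?expR_gt0.
move=> uz.
have -> : P z = Q (z - x1%:C) by rewrite /Q addrC subrK.
have uz' : uhp (z - x1%:C) by rewrite /uhp !ReIm /= subr0.
apply: (@exp_limit _ _ M (Im (z - x1%:C))) => //; last exact: ltW.
move=> r r0; exists (r / 2); first lra.
have r40 : 0 < r / 4 by rewrite divr_gt0.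
apply: le_trans (main _ r40 _ uz') _; rewrite ler_wpM2l ?(ltW M0) // ler_expR.
by apply: le_of_eq; field.
Qed.

End HalfPlaneBound.
End MeanTypeBound.

(** * Principal value integrals that vanish in the limit *)

Section PuncturedIntegral.
Variable R : realType.
Local Notation C := R[i].
Implicit Types (x y t : R) (f g k : C -> C) (z w p : C).

(** Integration by parts turns k / z into P / z^2, P being the bounded primitive. The latter is O(1)
    at 0, since k vanishes there, and O(|z|^-2) at infinity, as the contour estimate requires; the
    boundary terms are O(d) and O(1 / r). *)
Theorem punctured_integral k (M K : R) (x1 : R) :
  (forall z, chp z -> \forall w \near z, cdiff k w) -> k 0 = 0 -> 1 <= M ->
  (forall a b : R, ru a b (fun t => nrm (k (t +i* 0))) <= M) -> 0 <= K ->
  (forall z, uhp z -> nrm (k z) <= expR (K * (1 + nrm z ^+ 2) / Im z)) ->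
  (forall e : R, 0 < e -> exists Y : R, forall y, Y <= y ->
     nrm (k (x1 +i* y)) <= expR (e * y)) ->
  exists2 c : R, 0 <= c & forall d r : R, 0 < d -> d <= r ->
    nrm (punct (fun t => k (t +i* 0) / (t +i* 0)) d r) <= c * (d + r^-1).
Proof.
move=> dk k0 M1 kM K0 kK kmt.
pose P := primC 0 0 k.
have dP z : chp z -> isd P z (k z) by exact: closed_primitive.
have dkc z : chp z -> cdiff k z by move=> /dk; exact: nbhs_singleton.
have PM z : chp z -> nrm (P z) <= M.
  rewrite /chp le_eqVlt => /predU1P[z0|z0]; last exact: (prim_bounded dk M1 kM K0 kK kmt).
  by case: z z0 => x y /= <-; exact: (prim_real dk kM).
have c00 : chp (0 : C) by exact: lexx.
have [l /isd_eps/(_ 1 ltr01)[d1 d10 dl]] := dkc 0 c00.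
pose L := nrm l + 1.
have L0 : 0 < L by rewrite ltr_wpDl // nrm_ge0.
have kL z : nrm z < d1 -> nrm (k z) <= L * nrm z.
  move=> zd; have := dl z; rewrite subr0 k0 subr0 => /(_ zd) H.
  have := nrm_sub (k z) (l * z); rewrite nrmM /L; lra.
have PL z : chp z -> nrm z < d1 -> nrm (P z) <= 2 * L * nrm z ^+ 2.
  case: z => x y z0 zd.
  have sub s t : `|s| <= `|x| -> `|t| <= `|y| -> nrm (k (s +i* t)) <= L * nrm (x +i* y).
    move=> sx ty; have st : nrm (s +i* t) <= nrm (x +i* y).
      rewrite -(@ler_pXn2r _ 2) ?nnegrE ?nrm_ge0 // !nrm_sqr /=.
      by apply: lerD; rewrite -[leLHS]real_normK ?num_real // -[leRHS]real_normK ?num_real //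
        lerXn2r ?nnegrE.
    apply: le_trans (kL _ (le_lt_trans st zd)) _; rewrite ler_wpM2l ?(ltW L0) //.
  have ch : contI (Num.min 0 x) (Num.max 0 x) (fun t => k (t +i* 0)).
    by move=> t _; apply: cont_h; apply: cdiff_cont; apply: dkc; exact: lexx.
  have cv : contI (Num.min 0 y) (Num.max 0 y) (fun s => k (x +i* s)).
    rewrite (min_l z0) (max_r z0) => t /andP[t0 _].
    by apply: cont_v; apply: cdiff_cont; exact: dkc.
  rewrite /P /primC /=; apply: le_trans (nrmD _ _) _; rewrite nrmM nrmi mul1r.
  have h1 : nrm (cint 0 x (fun t => k (t +i* 0))) <= L * nrm (x +i* y) * `|x - 0|.
    apply: nrm_cint_le => // t /minmax_dist; rewrite !subr0 => tx.
    by apply: sub; rewrite // normr0.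
  have h2 : nrm (cint 0 y (fun t => k (x +i* t))) <= L * nrm (x +i* y) * `|y - 0|.
    by apply: nrm_cint_le => // t /minmax_dist; rewrite !subr0 => ty; exact: sub.
  rewrite !subr0 in h1 h2.
  have q0 : 0 <= L * nrm (x +i* y) by rewrite mulr_ge0 ?nrm_ge0 // ltW.
  have := ler_wpM2l q0 (Re_le_nrm (x +i* y)); have := ler_wpM2l q0 (Im_le_nrm (x +i* y)).
  move=> /= a1 a2; clear -h1 h2 a1 a2; lra.
pose C1 := 2 * L + M / d1 ^+ 2.
have M0 : 0 <= M by lra.
have Md0 : 0 <= M / d1 ^+ 2 by rewrite divr_ge0 // sqr_ge0.
pose V z := P z / z ^+ 2.
have V2 z : chp z -> z != 0 -> nrm (V z) <= M / nrm z ^+ 2.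
  by move=> cz z0; rewrite nrm_div nrmX ler_wpM2r ?invr_ge0 ?sqr_ge0 // PM.
have V1 z : chp z -> z != 0 -> nrm (V z) <= C1.
  move=> cz z0; have nz : 0 < nrm z by rewrite nrm_gt0.
  have [zd|zd] := ltP (nrm z) d1.
    apply: (@le_trans _ _ (2 * L)); last by rewrite lerDl.
    by rewrite nrm_div nrmX ler_pdivrMr ?exprn_gt0 // PL.
  apply: (@le_trans _ _ (M / d1 ^+ 2)); last by rewrite lerDr mulr_ge0 // ltW.
  apply: le_trans (V2 z cz z0) _; rewrite ler_wpM2l // lef_pV2 ?posrE ?exprn_gt0 //.
  by rewrite lerXn2r ?nnegrE ?nrm_ge0 // ltW.
have dV z : chp z -> z != 0 -> cdiff V z.
  move=> cz z0; apply: cdiff_div; last by rewrite expf_neq0.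
    by exists (k z); exact: dP.
  by apply: cdiffX; exact: cdiff_id.
have C10 : 0 <= C1 by rewrite addr_ge0 // mulr_ge0 // ltW.
exists (6 * (C1 + M)); first by rewrite mulr_ge0 // addr_ge0.
move=> d r d0 dr; have r0 : 0 < r by lra.
have HV := contour dV V1 V2 d0 dr.
have tn0 t : t != 0 -> (t +i* 0 : C) != 0 by move=> t0; apply/negP => /eqP[] /eqP; exact/negP.
have piece (a b : R) : a <= b -> (forall t, a <= t <= b -> t != 0) ->
    cu a b (fun t => k (t +i* 0) / (t +i* 0)) =
    cu a b (fun t => V (t +i* 0)) + (P (b +i* 0) / (b +i* 0) - P (a +i* 0) / (a +i* 0)).
  move=> ab nt.
  have ct t : a <= t <= b -> cont (fun z => k z / z) (t +i* 0).
    move=> tt; apply: cdiff_cont; apply: cdiff_div; [apply: dkc; exact: lexx|exact: cdiff_id|].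
    by apply: tn0; exact: nt.
  have cV : contI a b (fun t => V (t +i* 0)).
    move=> t tt; apply: cont_h; apply: cdiff_cont; apply: dV; first exact: lexx.
    by apply: tn0; exact: nt.
  have cV' : contI a b (fun t => -1 * V (t +i* 0)).
    by move=> t tt; apply: contM; [exact: cont_cst|exact: cV].
  have ck : contI a b (fun t => k (t +i* 0) / (t +i* 0)).
    by move=> t tt; apply: (@cont_h _ (fun z => k z / z)); exact: ct.
  have F := @cu_FTC _ a b (fun t => P (t +i* 0) / (t +i* 0))
    (fun t => k (t +i* 0) / (t +i* 0) + -1 * V (t +i* 0)) ab.
  rewrite -F; first by rewrite cuD // cuZ //; ring.
    by move=> t tt; apply: contD; [exact: ck|exact: cV'].
  move=> t tt; apply: (@rderiv_h _ (fun z => P z / z)).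
  have zt := tn0 t (nt t tt).
  have := isdM (dP (t +i* 0) (lexx _)) (isd_inv zt).
  by congr (isd _ _ _); rewrite /V; ring.
have n1 t : - r <= t <= - d -> t != 0 by move=> /andP[? ?]; rewrite lt_eqF //; lra.
have n2 t : d <= t <= r -> t != 0 by move=> /andP[? ?]; rewrite gt_eqF //; lra.
have rd : - r <= - d by rewrite lerN2.
rewrite /punct (piece _ _ rd n1) (piece _ _ dr n2).
set V3 := cu (- r) (- d) _ in HV *; set V4 := cu d r _ in HV *.
have bd t : t != 0 -> nrm (P (t +i* 0) / (t +i* 0)) <= C1 * `|t| /\
    nrm (P (t +i* 0) / (t +i* 0)) <= M / `|t|.
  move=> t0; have nt : nrm (t +i* 0) = `|t| by rewrite -nrmR.
  have at0 : 0 < `|t| by rewrite normr_gt0.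
  split; last by rewrite nrm_div nt ler_wpM2r ?invr_ge0 // PM //; exact: lexx.
  have := V1 (t +i* 0) (lexx _) (tn0 _ t0); rewrite /V !nrm_div nrmX nt => H.
  have -> : nrm (P (t +i* 0)) / `|t| = nrm (P (t +i* 0)) / `|t| ^+ 2 * `|t|.
    by field; rewrite gt_eqF.
  by rewrite ler_wpM2r.
have [_] := bd r (lt0r_neq0 r0); rewrite (gtr0_norm r0).
have [|_] := bd (- r); first by rewrite oppr_eq0 lt0r_neq0.
rewrite normrN (gtr0_norm r0).
have [+ _] := bd d (lt0r_neq0 d0); rewrite (gtr0_norm d0).
have [|+ _] := bd (- d); first by rewrite oppr_eq0 lt0r_neq0.
rewrite normrN (gtr0_norm d0).
set p1 := P (- d +i* 0) / _; set p2 := P (d +i* 0) / _.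
set p3 := P (- r +i* 0) / _; set p4 := P (r +i* 0) / _ => b1 b2 b3 b4.
have -> : V3 + (p1 - p3) + (V4 + (p4 - p2)) = (V3 + V4) + ((p1 - p3) + (p4 - p2)) by ring.
have HV' : nrm (V3 + V4) <= 4 * M / r + 4 * C1 * d by exact: HV.
have t1 := nrmD (V3 + V4) ((p1 - p3) + (p4 - p2)).
have t2 := nrmD (p1 - p3) (p4 - p2).
have t3 := nrmB p1 p3; have t4 := nrmB p4 p2.
have ri : 0 < r^-1 by rewrite invr_gt0.
have s1 : 0 <= C1 * r^-1 by rewrite mulr_ge0 // ltW.
have s2 : 0 <= M * d by rewrite mulr_ge0 // ltW.
clear -HV' t1 t2 t3 t4 b1 b2 b3 b4 s1 s2; lra.
Qed.

End PuncturedIntegral.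

(** * Poisson integrals and choices of parameters *)

Section RealIntegrals.
Variable R : realType.
Implicit Types (a b t x y : R) (u v : R -> R).

Lemma ru_shift u x a b : (forall t, {for t, continuous u}) -> a <= b ->
  ru a b (fun t => u (x + t)) = ru (x + a) (x + b) u.
Proof.
(* The base point lies strictly to the left of x + a, so that [U] is differentiable at both ends. *)
move=> cu_ ab; pose m := x + a - 1; pose U s := ru m s u.
have dU s : m < s -> is_derive s (1 : R) U (u s).
  move=> ms; have iu : (@lebesgue_measure R).-integrable `[m, s + 1] (EFin \o u).
    by apply: ru_integrable => t _; exact: cu_.
  have ss : s < s + 1 by rewrite ltrDl.
  have [d1 d2] := @continuous_FTC1_closed R u m s (s + 1) ss iu ms (cu_ s).
  by split; [exact: d1|rewrite -derive1E; exact: d2].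
have ux t : {for t, continuous (fun t => u (x + t))}.
  apply: (@continuous_comp _ _ _ (fun t => x + t) u); last exact: cu_.
  apply: continuousD; first exact: cst_continuous.
  by move=> ?; apply.
apply: etrans (@ru_FTC _ a b (fun t => U (x + t)) _ ab _ _) _ => //; last first.
- have : ru m (x + b) u = ru m (x + a) u + ru (x + a) (x + b) u.
    by apply: ru_chasles => //; rewrite /m; lra.
  by rewrite /U => ->; rewrite addrAC subrr add0r.
- move=> t /andP[ta tb]; have mt : m < x + t by rewrite /m; lra.
  apply/realD_eps => e e0; have [d d0 dP] := (realD_eps _ _ _).1 (dU _ mt) e e0.
  by exists d => // h hd; rewrite addrA; exact: dP.
Qed.

Lemma is_derive_poisson (n : R) t : 0 < n ->
  is_derive t (1 : R) (fun s => n^-1 * atan (s / n)) (t ^+ 2 + n ^+ 2)^-1.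
Proof.
move=> n0.
have d1 : is_derive t (1 : R) (fun s : R => s / n) (n^-1).
  apply: (is_derive_eq (is_deriveM (is_derive_id t 1) (is_derive_cst n^-1 t 1))).
  by rewrite scaler0 add0r; exact: mulr1.
have d2 := @is_derive1_comp _ _ (fun s : R => s / n) t _ _ (is_derive1_atan (t / n)) d1.
apply: (is_derive_eq (is_deriveZ (n^-1) d2)).
change (n^-1 * ((1 + (t / n) ^+ 2)^-1 * n^-1) = (t ^+ 2 + n ^+ 2)^-1).
have h : t ^+ 2 + n ^+ 2 != 0 by rewrite gt_eqF // ltr_wpDl ?sqr_ge0 // exprn_gt0.
by field; rewrite h gt_eqF.
Qed.

Lemma continuous_poisson (n : R) t : 0 < n ->
  {for t, continuous (fun s : R => (s ^+ 2 + n ^+ 2)^-1)}.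
Proof.
move=> n0; apply: continuousV; first by rewrite gt_eqF // ltr_wpDl ?sqr_ge0 // exprn_gt0.
apply: continuousD; last exact: cst_continuous.
exact: exprn_continuous.
Qed.

Lemma ru_poisson (n : R) a b : 0 < n -> a <= b ->
  ru a b (fun s => (s ^+ 2 + n ^+ 2)^-1) = n^-1 * (atan (b / n) - atan (a / n)).
Proof.
move=> n0 ab; apply: etrans (@ru_FTC _ a b (fun s => n^-1 * atan (s / n)) _ ab _ _) _; last ring.
- by move=> t _; exact: continuous_poisson.
- by move=> t _; exact: is_derive_poisson.
Qed.

Lemma ru_poisson_le (n : R) a b : 0 < n ->
  ru a b (fun s => (s ^+ 2 + n ^+ 2)^-1) <= pi / n.
Proof.
move=> n0; have [ab|/ltW ab] := leP a b; last by rewrite ru_eq0 // divr_ge0 ?pi_ge0 // ltW.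
rewrite ru_poisson // mulrC ler_pM2r ?invr_gt0 //.
have := atan_ltpi2 (b / n); have := atan_gtNpi2 (a / n); lra.
Qed.

Lemma is_derive_sqpoisson t :
  is_derive t (1 : R) (fun s => 2^-1 * (atan s + s * (s ^+ 2 + 1)^-1)) ((t ^+ 2 + 1) ^- 2).
Proof.
have h : t ^+ 2 + 1 != 0 by rewrite gt_eqF // ltr_wpDl ?sqr_ge0.
have d0 : is_derive t (1 : R) (fun s : R => s * s + 1) (2 * t).
  apply: (is_derive_eq (is_deriveD (is_deriveM (is_derive_id t 1) (is_derive_id t 1))
    (is_derive_cst (1 : R) t 1))).
  by change (t * 1 + t * 1 + 0 = 2 * t); ring.
have h' : t * t + 1 != 0 by [].
have d1 := @is_deriveV _ (fun s : R => s * s + 1) t _ 1 h' d0.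
have d2 := is_deriveM (is_derive_id t (1 : R)) d1.
apply: (is_derive_eq (is_deriveZ (2^-1) (is_deriveD (is_derive1_atan t) d2))).
change (2^-1 * ((1 + t ^+ 2)^-1 + (t * (- (t ^+ 2 + 1) ^- 2 * (2 * t)) + (t ^+ 2 + 1)^-1 * 1)) =
  (t ^+ 2 + 1) ^- 2).
by rewrite (addrC 1); field.
Qed.

Lemma ru_sqpoisson a b : a <= b -> ru a b (fun s => (s ^+ 2 + 1) ^- 2) =
  2^-1 * (atan b + b / (b ^+ 2 + 1)) - 2^-1 * (atan a + a / (a ^+ 2 + 1)).
Proof.
move=> ab.
apply: (@ru_FTC _ a b (fun s => 2^-1 * (atan s + s * (s ^+ 2 + 1)^-1))); first exact: ab.
- move=> t _; apply: continuousV; first by rewrite expf_neq0 // gt_eqF // ltr_wpDl ?sqr_ge0.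
  have c1 : {for t, continuous (fun s : R => s ^+ 2 + 1)}.
    by apply: continuousD; [exact: exprn_continuous|exact: cst_continuous].
  exact: (continuousM c1 c1).
- by move=> t _; exact: is_derive_sqpoisson.
Qed.

Definition rpunct u (d r : R) := ru (- r) (- d) u + ru d r u.

Lemma small_params (c e d1 r1 : R) : 0 <= c -> 0 < e -> 0 < d1 ->
  exists d r : R, [/\ 0 < d, d <= d1, d <= r, r1 <= r & [/\ c * (d + r^-1) <= e,
    `|atan r - atan d - pi / 2| <= e & d <= e]].
Proof.
move=> c0 e0 d10.
have e20 : 0 < e / 2 by rewrite divr_gt0.
have c1 : 0 < 1 + c by rewrite ltr_pwDl.
have [dd dd0 ddP] : exists2 d : R, 0 < d & forall h, `|h| < d -> `|atan h| <= e / 2.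
  have /cvgrPdist_le H := @continuous_atan R 0.
  have /nearR[d d0 dP] := H _ e20; exists d => // h hd.
  by have := dP h; rewrite subr0 atan0 sub0r normrN; apply.
have [rr rrP] : exists rr : R, forall r, rr <= r -> `|pi / 2 - atan r| <= e / 2.
  have /cvgrPdist_le H := @cvgy_atan R; have [m [_ mP]] := H _ e20.
  by exists (m + 1) => r mr; apply: mP; lra.
pose q := e / (1 + c) / 2.
have q0 : 0 < q by rewrite !divr_gt0.
pose d := Num.min (Num.min d1 (dd / 2)) (Num.min q e).
have d0 : 0 < d by rewrite !lt_min d10 q0 e0 !divr_gt0.
pose r := Num.max (Num.max r1 rr) (Num.max d q^-1).
exists d, r.
have dd1 : d <= d1 by rewrite !ge_min lexx.
have dd2 : d <= dd / 2 by rewrite !ge_min lexx orbT.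
have dq : d <= q by rewrite !ge_min lexx !orbT.
have de : d <= e by rewrite !ge_min lexx !orbT.
have rr1 : r1 <= r by rewrite !le_max lexx.
have rr2 : rr <= r by rewrite !le_max lexx !orbT.
have rd : d <= r by rewrite !le_max lexx !orbT.
have rq : q^-1 <= r by rewrite !le_max lexx !orbT.
split => //; split => //.
- have r0 : 0 < r by lra.
  have : r^-1 <= q by rewrite invf_ple ?posrE.
  move=> rq'; have : c * (d + r^-1) <= (1 + c) * (q + q).
    apply: ler_pM => //; last exact: lerD.
    + by rewrite addr_ge0 ?invr_ge0 ?(ltW d0) ?(ltW r0).
    + by rewrite lerDr.
  have -> : (1 + c) * (q + q) = e by rewrite /q; field; rewrite gt_eqF.
  by [].
- have -> : atan r - atan d - pi / 2 = - (pi / 2 - atan r) - atan d by ring.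
  apply: le_trans (ler_normB _ _) _; rewrite normrN (splitr e); apply: lerD; first exact: rrP.
  by apply: ddP; rewrite gtr0_norm //; lra.
Qed.

Lemma rpunct_mono u (d r d' r' : R) : (forall t, t != 0 -> {for t, continuous u}) ->
  (forall t, 0 <= u t) -> 0 < d' -> d' <= d -> d <= r -> r <= r' ->
  rpunct u d r <= rpunct u d' r'.
Proof.
move=> cu_ u0 d0 dd dr rr.
have cn (a b : R) : b < 0 -> rcontI a b u.
  by move=> b0 t /andP[_ tb]; apply: cu_; rewrite lt_eqF //; lra.
have cp (a b : R) : 0 < a -> rcontI a b u.
  by move=> b0 t /andP[tb _]; apply: cu_; rewrite gt_eqF //; lra.
apply: lerD.
- rewrite (@ru_chasles _ (- r') (- r) (- d')) ?lerN2 //; [|lra|by apply: cn; lra].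
  rewrite (@ru_chasles _ (- r) (- d) (- d')) ?lerN2 //; [|by apply: cn; lra].
  by rewrite addrCA lerDl addr_ge0 // ru_ge0.
- rewrite (@ru_chasles _ d' d r') //; [|lra|by apply: cp; lra].
  rewrite (@ru_chasles _ d r r') //; [|by apply: cp; lra].
  by rewrite addrCA lerDl addr_ge0 // ru_ge0.
Qed.

(** Recovers the Cauchy-Schwarz form from the weighted inequality. The weight is l = v / N; when N =
    0, l = (S + 1) / v is large enough for a contradiction. *)
Lemma quad_min (v N S : R) : 0 <= v -> 0 <= N -> 0 <= S ->
  (forall l : R, 0 < l -> v <= (l * N + S / l) / 2) -> v ^+ 2 <= N * S.
Proof.
move=> v0 N0 S0 H; have [->|vn] := eqVneq v 0; first by rewrite expr0n /= mulr_ge0.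
have vp : 0 < v by rewrite lt_neqAle eq_sym vn.
have [N00|Nn] := eqVneq N 0.
  have l0 : 0 < (S + 1) / v by rewrite divr_gt0 // ltr_wpDl.
  have S1 : 0 < S + 1 by rewrite ltr_wpDl.
  have := H _ l0; rewrite N00 mulr0 add0r mul0r invf_div mulrA.
  rewrite ler_pdivlMr // ler_pdivlMr // => h; have := mulr_ge0 v0 S0.
  clear -h vp; lra.
have Np : 0 < N by rewrite lt_neqAle eq_sym Nn.
have l0 : 0 < v / N by rewrite divr_gt0.
have := H _ l0; rewrite divfK // invf_div => h.
have : v * v <= (v + S * (N / v)) / 2 * v by rewrite ler_wpM2r.
have -> : (v + S * (N / v)) / 2 * v = (v * v + N * S) / 2 by field.
rewrite expr2; lra.
Qed.

End RealIntegrals.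

(** * The reproducing kernel estimate *)

Section HardyKernel.
Variable R : realType.
Local Notation C := R[i].
Implicit Types (x y t : R) (f g k h : C -> C) (z w p : C).

Definition cont_off0 (f : R -> C) := forall t, t != 0 -> cont f t.

Lemma cont_off0_n (f : R -> C) (d r : R) : cont_off0 f -> 0 < d -> contI (- r) (- d) f.
Proof. by move=> cf d0 t /andP[_ td]; apply: cf; rewrite lt_eqF //; lra. Qed.

Lemma cont_off0_p (f : R -> C) (d r : R) : cont_off0 f -> 0 < d -> contI d r f.
Proof. by move=> cf d0 t /andP[td _]; apply: cf; rewrite gt_eqF //; lra. Qed.

Lemma punctD (f g : R -> C) (d r : R) : cont_off0 f -> cont_off0 g -> 0 < d ->
  punct (fun t => f t + g t) d r = punct f d r + punct g d r.
Proof.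
move=> cf cg d0; rewrite /punct !cuD; try (by apply: cont_off0_n); try (by apply: cont_off0_p).
ring.
Qed.

Lemma punctZ (f : R -> C) (c : C) (d r : R) : cont_off0 f -> 0 < d ->
  punct (fun t => c * f t) d r = c * punct f d r.
Proof.
by move=> cf d0; rewrite /punct !cuZ ?mulrDr //; [exact: cont_off0_p|exact: cont_off0_n].
Qed.

Lemma cu_conj (f : R -> C) (a b : R) : contI a b f -> cu a b (fun t => (f t)^* ) = (cu a b f)^*.
Proof.
move=> cf; have cI := contI_Im cf; apply: complex_eqP => /=.
  by apply: ru_ext => t _; case: (f t).
by rewrite -mulN1r -ruZ //; apply: ru_ext => t _; rewrite mulN1r; case: (f t).
Qed.

Lemma punct_conj (f : R -> C) (d r : R) : cont_off0 f -> 0 < d ->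
  punct (fun t => (f t)^* ) d r = (punct f d r)^*.
Proof.
move=> cf d0; rewrite /punct rmorphD /= !cu_conj //; [exact: cont_off0_p|exact: cont_off0_n].
Qed.

Lemma punct_ext (f g : R -> C) (d r : R) : 0 < d -> (forall t, t != 0 -> f t = g t) ->
  punct f d r = punct g d r.
Proof.
move=> d0 fg; congr (_ + _); apply: cu_ext => t /andP[t1 t2]; apply: fg.
  by rewrite lt_eqF //; lra.
by rewrite gt_eqF //; lra.
Qed.

Lemma rpunct_le (u v : R -> R) (d r : R) : 0 < d ->
  (forall t, t != 0 -> {for t, continuous u}) -> (forall t, t != 0 -> {for t, continuous v}) ->
  (forall t, t != 0 -> u t <= v t) -> rpunct u d r <= rpunct v d r.
Proof.
move=> d0 cu_ cv uv; apply: lerD; apply: ru_le => t /andP[t1 t2];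
  ((apply: cu_ || apply: cv || apply: uv); rewrite ?lt_eqF ?gt_eqF //; lra) ||
  idtac.
all: by (apply: cu_ || apply: cv || apply: uv); (rewrite gt_eqF //; lra) || (rewrite lt_eqF //; lra).
Qed.

Lemma nrm_punct (f : R -> C) (d r : R) : cont_off0 f -> 0 < d ->
  nrm (punct f d r) <= rpunct (fun t => nrm (f t)) d r.
Proof.
move=> cf d0; apply: le_trans (nrmD _ _) _; apply: lerD; apply: nrm_cu.
  exact: cont_off0_n.
exact: cont_off0_p.
Qed.

Lemma rpunct_full (u : R -> R) (d r : R) : 0 < d -> d <= r ->
  (forall t, {for t, continuous u}) -> (forall t, 0 <= u t) ->
  rpunct u d r <= ru (- r) r u.
Proof.
move=> d0 dr cu_ u0; have cI (a b : R) : rcontI a b u by move=> t _.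
rewrite (@ru_chasles _ (- r) (- d) r) //; [|lra|lra].
rewrite (@ru_chasles _ (- d) d r) //; last lra.
by rewrite lerD2l lerDr ru_ge0.
Qed.

(** A multiplier with value 1 at 0, modulus at most 1 in the half-plane and square integrable on the
    line: it makes Hardy functions integrable there. Large n makes its effect on the estimates
    negligible. *)
Definition cauchy_mult (n : R) z : C := 'i * n%:C / (z + 'i * n%:C).
(** An integrable function with value 1 at 0, used to subtract the value of a Hardy function at the
    pole; its own contribution is computed explicitly. *)
Definition double_pole z : C := - (z + 'i) ^- 2.

Lemma shift_i (n : R) z : 0 < n -> chp z -> n <= nrm (z + 'i * n%:C).
Proof.
move=> n0 z0; apply: le_trans (Im_le_nrm _); rewrite !ReIm /=.
by rewrite ger0_norm; rewrite /chp in z0; lra.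
Qed.

Lemma shift_i1 z : chp z -> 1 <= nrm (z + 'i).
Proof. by move=> z0; have := shift_i ltr01 z0; rewrite mulr1. Qed.

Lemma cauchy_mult_le1 (n : R) z : 0 < n -> chp z -> nrm (cauchy_mult n z) <= 1.
Proof.
move=> n0 z0; have h := shift_i n0 z0.
rewrite nrm_div nrmM nrmi mul1r nrmR gtr0_norm // ler_pdivrMr ?mul1r //; lra.
Qed.

Lemma double_pole_le1 z : chp z -> nrm (double_pole z) <= 1.
Proof.
move=> /shift_i1 h; rewrite nrmN nrmV nrmX invf_le1 ?exprn_ege1 //.
by rewrite exprn_gt0 //; lra.
Qed.

Lemma near_nz (c : C) z : z + c != 0 -> \forall w \near z, w + c != 0.
Proof.
move=> zc; apply/nearC; exists (nrm (z + c)); first by rewrite nrm_gt0.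
move=> w wz; rewrite -nrm_gt0.
have := nrm_sub (z + c) (w + c).
have -> : z + c - (w + c) = z - w by ring.
rewrite nrm_distC; lra.
Qed.

Lemma cdiff_cauchy_mult (n : R) z : z + 'i * n%:C != 0 -> cdiff (cauchy_mult n) z.
Proof.
move=> h; apply: cdiff_div => //; first exact: cdiff_cst.
by apply: cdiffD; [exact: cdiff_id|exact: cdiff_cst].
Qed.

Lemma cdiff_double_pole z : z + 'i != 0 -> cdiff double_pole z.
Proof.
move=> h; apply: cdiffN; apply: cdiffV; last by rewrite expf_neq0.
by apply: cdiffX; apply: cdiffD; [exact: cdiff_id|exact: cdiff_cst].
Qed.

Lemma nrm2_real_shift (n t : R) : nrm (t%:C + 'i * n%:C) ^+ 2 = t ^+ 2 + n ^+ 2.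
Proof. by rewrite nrm_sqr !ReIm /=; ring. Qed.

Lemma nrm2_cauchy_mult (n t : R) : 0 < n ->
  nrm (cauchy_mult n t%:C) ^+ 2 = n ^+ 2 * (t ^+ 2 + n ^+ 2)^-1.
Proof.
move=> n0; rewrite nrm_div expr_div_n nrm2_real_shift nrmM nrmi mul1r nrmR.
by rewrite gtr0_norm.
Qed.

Lemma nrm_double_pole (t : R) : nrm (double_pole t%:C) = (t ^+ 2 + 1 ^+ 2)^-1.
Proof. by rewrite nrmN nrmV nrmX -(nrm2_real_shift 1) mulr1. Qed.

(** What remains of the Hardy class for quotients by B: square integrals along the line, growth of
    bounded type, and mean type. The latter is recorded on the line Re z = [x1], because translating
    the point of evaluation to 0 moves the imaginary axis. *)
Record hardy h (x1 N : R) : Prop := Hardy {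
  hardy_cdiff : forall z, chp z -> \forall w \near z, cdiff h w;
  hardy_L2 : forall a b : R, ru a b (fun t => nrm (h t%:C) ^+ 2) <= N;
  hardy_growth : exists2 K : R, 0 <= K &
    forall z, uhp z -> nrm (h z) <= expR (K * (1 + nrm z ^+ 2) / Im z);
  hardy_mean : forall e : R, 0 < e -> exists Y : R, forall y, Y <= y ->
    nrm (h (x1 +i* y)) <= expR (e * y) }.

Lemma chp_real (t : R) : chp (t%:C : C).
Proof. exact: lexx. Qed.

Lemma cont_real_line f t : cont f t%:C -> cont (fun s : R => f s%:C) t.
Proof. by move=> cf; apply: (@cont_h _ f t 0). Qed.

Lemma hardy_cont h (x1 N : R) t : hardy h x1 N -> cont (fun s : R => h s%:C) t.
Proof.
move=> Hh; apply: cont_real_line; apply: cdiff_cont.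
exact: (nbhs_singleton (hardy_cdiff Hh (chp_real t))).
Qed.

Lemma continuousX2 (u : R -> R) t : {for t, continuous u} -> {for t, continuous (fun s => u s ^+ 2)}.
Proof. by move=> ct; exact: (continuousM ct ct). Qed.

Lemma hardy_kernel h (x1 N n : R) : hardy h x1 N -> 0 < n ->
  exists2 c : R, 0 <= c & forall d r : R, 0 < d -> d <= r ->
    nrm (punct (fun t => (h t%:C * cauchy_mult n t%:C - h 0 * double_pole t%:C) / t%:C) d r)
      <= c * (d + r^-1).
Proof.
move=> Hh n0; have [K K0 HK] := hardy_growth Hh.
(* Both multipliers are 1 at 0, so [k] vanishes there, and it is integrable on the line. *)
pose k z := h z * cauchy_mult n z - h 0 * double_pole z.
pose H := nrm (h 0); have H0 : 0 <= H by exact: nrm_ge0.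
have nz z : chp z -> z + 'i * n%:C != 0.
  by move=> z0; rewrite -nrm_gt0; have := shift_i n0 z0; lra.
have nz1 z : chp z -> z + 'i != 0.
  by move=> z0; rewrite -nrm_gt0; have := shift_i1 z0; lra.
have dk z : chp z -> \forall w \near z, cdiff k w.
  move=> z0; apply: filterS3 (hardy_cdiff Hh z0) (near_nz (nz z z0)) (near_nz (nz1 z z0)).
  move=> w dh w1 w2; apply: cdiffB; apply: cdiffM => //; first exact: cdiff_cauchy_mult.
    exact: cdiff_cst.
  exact: cdiff_double_pole.
have k0 : k 0 = 0.
  have n00 : n%:C != 0 :> C by rewrite -nrm_gt0 nrmR normr_gt0 gt_eqF.
  have i0 : 'i != 0 :> C by rewrite -nrm_gt0 nrmi.
  rewrite /k /cauchy_mult /double_pole !add0r sqr_i divff ?mulf_neq0 // invrN1 opprK; ring.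
have kle z : chp z -> nrm (k z) <= nrm (h z) + H.
  move=> z0; apply: le_trans (nrmB _ _) _; rewrite (nrmM (h _)) (nrmM (h 0)); apply: lerD.
    by rewrite ler_piMr ?nrm_ge0 // cauchy_mult_le1.
  by rewrite ler_piMr ?nrm_ge0 // double_pole_le1.
have ch t : cont (fun s : R => h s%:C) t by exact: hardy_cont Hh.
have ck t : cont (fun s : R => k s%:C) t.
  apply: cont_real_line; apply: cdiff_cont.
  exact: (nbhs_singleton (dk _ (chp_real t))).
have cp (m : R) t : 0 < m -> {for t, continuous (fun s : R => (s ^+ 2 + m ^+ 2)^-1)}.
  by move=> m0; exact: continuous_poisson.
have ch2 t : {for t, continuous (fun s : R => nrm (h s%:C) ^+ 2)}.
  by apply: continuousX2; exact: cont_nrm.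
pose W := (N + n ^+ 2 * (pi / n)) / 2 + H * pi.
have kM (a b : R) : ru a b (fun t => nrm (k t%:C)) <= W.
  pose v1 (t : R) := 2^-1 * (nrm (h t%:C) ^+ 2 + n ^+ 2 * (t ^+ 2 + n ^+ 2)^-1).
  pose v2 (t : R) := H * (t ^+ 2 + 1 ^+ 2)^-1.
  have cv0 (a' b' : R) : rcontI a' b' (fun t => n ^+ 2 * (t ^+ 2 + n ^+ 2)^-1).
    by move=> t _; apply: continuousM; [exact: cst_continuous|exact: cp].
  have cv00 (a' b' : R) : rcontI a' b' (fun t => nrm (h t%:C) ^+ 2 + n ^+ 2 * (t ^+ 2 + n ^+ 2)^-1).
    by move=> t tt; apply: continuousD; [exact: ch2|exact: cv0 tt].
  have cv1 (a' b' : R) : rcontI a' b' v1.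
    by move=> t tt; apply: continuousM; [exact: cst_continuous|exact: cv00 tt].
  have cv2 (a' b' : R) : rcontI a' b' v2.
    by move=> t _; apply: continuousM; [exact: cst_continuous|exact: cp].
  have c12 : rcontI a b (fun t => v1 t + v2 t).
    by move=> t tt; apply: continuousD; [exact: cv1 tt|exact: cv2 tt].
  apply: (@le_trans _ _ (ru a b (fun t => v1 t + v2 t))).
    apply: ru_le => // [t _|t _]; first exact: cont_nrm.
    apply: le_trans (nrmB _ _) _; rewrite (nrmM (h _)) (nrmM (h 0)); apply: lerD; last first.
      by rewrite nrm_double_pole.
    rewrite /v1 -nrm2_cauchy_mult //.
    have := sqr_ge0 (nrm (h t%:C) - nrm (cauchy_mult n t%:C)); lra.
  rewrite ruD // /W; apply: lerD.
    rewrite /v1 (ruZ _ (cv00 a b)) mulrC ler_pM2r ?invr_gt0 // (ruD (fun t _ => ch2 t) (cv0 a b)).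
    apply: lerD; first exact: (hardy_L2 Hh).
    rewrite (ruZ _ (fun t _ => cp n t n0)).
    by rewrite ler_wpM2l ?sqr_ge0 // ru_poisson_le.
  rewrite /v2 (ruZ _ (fun t _ => cp 1 t ltr01)).
  by rewrite ler_wpM2l //; have := @ru_poisson_le R 1 a b ltr01; rewrite divr1.
pose M := Num.max 1 W.
have M1 : 1 <= M by rewrite le_max lexx.
have kM' (a b : R) : ru a b (fun t => nrm (k (t +i* 0))) <= M.
  by apply: le_trans (kM a b) _; rewrite le_max lexx orbT.
(* The additive constant |h(0)| moves into the exponent, which preserves both the growth and the
   mean type condition. *)
have absorb (u : R) : H + expR u <= expR (u + (H + 1)) \/ u < 0.
  have [u0|u0] := leP 0 u; [left|by right].
  rewrite expRD; have e1 : 1 <= expR u by rewrite -[leLHS]expR0 ler_expR.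
  have e2 := expR_ge1Dx (H + 1).
  apply: (@le_trans _ _ (expR u * (1 + (H + 1)))); last by rewrite ler_wpM2l ?expR_ge0.
  by have := ler_wpM2r H0 e1; lra.
have kK z : uhp z -> nrm (k z) <= expR ((K + H + 1) * (1 + nrm z ^+ 2) / Im z).
  move=> uz; have z0 : 0 < Im z by [].
  apply: le_trans (kle z (ltW uz)) _; rewrite addrC.
  apply: le_trans (lerD (lexx _) (HK z uz)) _.
  pose w := (1 + nrm z ^+ 2) / Im z.
  have w1 : 1 <= w.
    rewrite ler_pdivlMr // mul1r; have := ler_norm (Im z); have := Im_le_nrm z.
    by have := sqr_ge0 (nrm z - 1); have := sqr_ge0 (nrm z); lra.
  rewrite -!mulrA -/w; have [h1|] := absorb (K * w); last first.
    by rewrite ltNge mulr_ge0 //; lra.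
  apply: le_trans h1 _; rewrite ler_expR.
  have : (H + 1) * 1 <= (H + 1) * w by rewrite ler_wpM2l //; lra.
  lra.
have kmt (e : R) : 0 < e -> exists Y : R, forall y, Y <= y -> nrm (k (x1 +i* y)) <= expR (e * y).
  move=> e0; have e20 : 0 < e / 2 by rewrite divr_gt0.
  have [Y HY] := hardy_mean Hh e20.
  exists (Num.max Y (Num.max 0 ((H + 1) / (e / 2)))) => y; rewrite !ge_max => /and3P[y1 y2 y3].
  apply: le_trans (kle _ _) _; first exact: y2.
  rewrite addrC; apply: le_trans (lerD (lexx _) (HY y y1)) _.
  have [h1|] := absorb (e / 2 * y); last by rewrite ltNge mulr_ge0 // ltW.
  apply: le_trans h1 _; rewrite ler_expR.
  by move: y3; rewrite ler_pdivrMr // => y3; lra.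
have KH0 : 0 <= K + H + 1 by rewrite !addr_ge0.
exact: punctured_integral dk k0 M1 kM' KH0 kK kmt.
Qed.

End HardyKernel.

Section Multipliers.
Variable R : realType.
Local Notation C := R[i].
Implicit Types (x y t : R) (f g k h : C -> C) (z w p : C).

(** The source of the constant 2 pi: the integral of (t^2 + 1)^-2 over the line is pi / 2, and 4 i
    times this is 2 pi i. It stands in for the residue. *)
Lemma double_pole_diff (t : R) : t != 0 ->
  (double_pole t%:C - (double_pole t%:C)^* ) / t%:C = (4%:R * 'i) * ((t ^+ 2 + 1) ^- 2)%:C.
Proof.
move=> t0; have t0' : t%:C != 0 :> C by rewrite -nrm_gt0 nrmR normr_gt0.
have h1 : t%:C + 'i != 0 :> C by rewrite -nrm_gt0; have := shift_i1 (chp_real t); lra.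
have h2 : t%:C - 'i != 0 :> C.
  by rewrite -nrm_gt0; apply: lt_le_trans (Im_le_nrm _); rewrite !ReIm /= sub0r normrN1.
have h3 : ((t ^+ 2 + 1)%:C : C) = (t%:C + 'i) * (t%:C - 'i).
  by apply: complex_eqP; rewrite !ReIm /=; ring.
have -> : (double_pole t%:C)^* = - (t%:C - 'i) ^- 2.
  have <- : (t%:C + 'i)^* = t%:C - 'i :> C by apply: complex_eqP; rewrite !ReIm /=; ring.
  by rewrite /double_pole rmorphN fmorphV rmorphXn.
rewrite fmorphV rmorphXn /= h3 /double_pole.
have E : (t%:C + 'i) ^+ 2 - (t%:C - 'i) ^+ 2 = 4%:R * 'i * t%:C :> C by ring.
transitivity (((t%:C + 'i) ^+ 2 - (t%:C - 'i) ^+ 2) / (((t%:C + 'i) * (t%:C - 'i)) ^+ 2 * t%:C)).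
  by field; rewrite t0' h1 h2.
by rewrite E; field; rewrite t0' h1 h2.
Qed.

Lemma cu_real (u : R -> R) (a b : R) : cu a b (fun t => (u t)%:C) = (ru a b u)%:C.
Proof.
apply: complex_eqP => //=; have [ab|/ltW ab] := leP a b; last by rewrite ru_eq0.
by rewrite ru_cst // mul0r.
Qed.

Lemma rpunct_sqpoisson (d r : R) : 0 < d -> d <= r ->
  rpunct (fun t => (t ^+ 2 + 1) ^- 2) d r =
  (atan r - atan d) + (r / (r ^+ 2 + 1) - d / (d ^+ 2 + 1)).
Proof.
move=> d0 dr; rewrite /rpunct !ru_sqpoisson ?lerN2 // !sqrrN !atanN !mulNr; lra.
Qed.

(** The imaginary part of the multiplier vanishes at t = 0, which cancels the pole 1 / t in the
    cross term. *)
Lemma cauchy_mult_conj (n t : R) : 0 < n ->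
  nrm (cauchy_mult n t%:C - (cauchy_mult n t%:C)^* ) = 2 * n * `|t| * (t ^+ 2 + n ^+ 2)^-1.
Proof.
move=> n0.
have h0 : t ^+ 2 + n ^+ 2 != 0 by rewrite gt_eqF // ltr_wpDl ?sqr_ge0 // exprn_gt0.
have h : t%:C + 'i * n%:C != 0 :> C.
  by rewrite -nrm_gt0; have := shift_i n0 (chp_real t); lra.
have E : cauchy_mult n t%:C = (n ^+ 2 +i* (n * t)) * ((t ^+ 2 + n ^+ 2)^-1)%:C.
  by rewrite /cauchy_mult; apply: (canLR (mulfK h)); apply: complex_eqP; rewrite !ReIm /=; field.
rewrite E; set z := (_ * _); have -> : z - z^* = 'i * (2 * Im z)%:C.
  by case: z => a b; apply: complex_eqP; rewrite !ReIm /=; ring.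
rewrite nrmM nrmi mul1r nrmR /z !ReIm /= mulr0 add0r !normrM normr_nat gtr0_norm //.
have h1 : 0 <= (t ^+ 2 + n ^+ 2)^-1 by rewrite invr_ge0 addr_ge0 ?sqr_ge0.
by rewrite (ger0_norm h1) !mulrA.
Qed.

End Multipliers.

Section CrossTerm.
Variable R : realType.
Local Notation C := R[i].
Implicit Types (x y t : R) (f g k h : C -> C) (z w p : C).

Definition rcont_off0 (u : R -> R) := forall t, t != 0 -> {for t, continuous u}.

Lemma rpunctD (u v : R -> R) (d r : R) : rcont_off0 u -> rcont_off0 v -> 0 < d ->
  rpunct (fun t => u t + v t) d r = rpunct u d r + rpunct v d r.
Proof.
move=> hu hv d0.
have cn (w : R -> R) : rcont_off0 w -> rcontI (- r) (- d) w.
  by move=> hw t /andP[_ tb]; apply: hw; rewrite lt_eqF //; lra.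
have cp (w : R -> R) : rcont_off0 w -> rcontI d r w.
  by move=> hw t /andP[tb _]; apply: hw; rewrite gt_eqF //; lra.
rewrite /rpunct (ruD (cn u hu) (cn v hv)) (ruD (cp u hu) (cp v hv)); ring.
Qed.

Lemma rpunctZ (u : R -> R) (c : R) (d r : R) : rcont_off0 u -> 0 < d ->
  rpunct (fun t => c * u t) d r = c * rpunct u d r.
Proof.
move=> hu d0.
have cn : rcontI (- r) (- d) u by move=> t /andP[_ tb]; apply: hu; rewrite lt_eqF //; lra.
have cp : rcontI d r u by move=> t /andP[tb _]; apply: hu; rewrite gt_eqF //; lra.
by rewrite /rpunct (ruZ _ cn) (ruZ _ cp) mulrDr.
Qed.

Lemma rcont_off0Z (c : R) u : rcont_off0 u -> rcont_off0 (fun t => c * u t).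
Proof. by move=> hu t /hu ct; apply: continuousM => //; exact: cst_continuous. Qed.
Lemma rcont_off0D u v : rcont_off0 u -> rcont_off0 v -> rcont_off0 (fun t => u t + v t).
Proof. by move=> hu hv t t0; apply: continuousD; [exact: hu|exact: hv]. Qed.
Lemma amgm (l u v : R) : 0 < l -> u * v <= (l * u ^+ 2 + v ^+ 2 / l) / 2.
Proof.
move=> l0; have := mulr_ge0 (ltW l0) (sqr_ge0 (u - v / l)).
have -> : l * (u - v / l) ^+ 2 = l * u ^+ 2 + v ^+ 2 / l - 2 * (u * v).
  by field; rewrite gt_eqF.
lra.
Qed.

Lemma mul_conj_nrm z : z * z^* = (nrm z ^+ 2)%:C.
Proof. by rewrite nrm_sqr; case: z => a c; apply: complex_eqP; rewrite !ReIm /=; ring. Qed.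

(* On the line [T] is unimodular, so [bar b bar f2 = b f bar T] and the
   integrand is [b f (r (1 - bar T) + bar T (r - bar r)) / t]. *)
Lemma cross_bound (b u u2 T : C) (n l m t : R) :
  b^* * u2^* * T = b * u -> nrm T = 1 -> 0 < n -> 0 < l -> 0 < m -> t != 0 ->
  nrm ((b * (u * cauchy_mult n t%:C) - b^* * (u2 * cauchy_mult n t%:C)^* ) / t%:C) <=
  nrm b * (l / 2 * nrm u ^+ 2 + (l^-1 / 2) * (nrm (1 - T) ^+ 2 / t ^+ 2)
    + (m * nrm u ^+ 2 + m^-1 * (t ^+ 2 + n ^+ 2)^-1)).
Proof.
move=> bu T1 n0 l0 m0 t0; set r := cauchy_mult n t%:C.
have TT : T * T^* = 1.
  by rewrite mul_conj_nrm T1 expr1n.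
have t1 : 0 < `|t| by rewrite normr_gt0.
have E : b * (u * r) - b^* * (u2 * r)^* = b * u * (r * (1 - T^* ) + T^* * (r - r^* )).
  have -> : b^* * (u2 * r)^* = b * u * T^* * r^*.
    by rewrite -bu -!mulrA (mulrA T) TT mul1r rmorphM.
  ring.
have rle : nrm r <= 1 by exact: cauchy_mult_le1 (chp_real t).
have cT : nrm (1 - T^* ) = nrm (1 - T) by rewrite -[RHS]nrm_conj rmorphB rmorph1.
have t2 : 0 < t ^+ 2 + n ^+ 2 by rewrite ltr_wpDl ?sqr_ge0 // exprn_gt0.
set p := (t ^+ 2 + n ^+ 2)^-1; have p0 : 0 < p by rewrite invr_gt0.
have np : n ^+ 2 * p <= 1 by rewrite ler_pdivrMr // mul1r lerDr sqr_ge0.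
pose A := nrm (1 - T) / `|t|; have AE : nrm (1 - T) = A * `|t| by rewrite divfK ?gt_eqF.
have A2 : nrm (1 - T) ^+ 2 / t ^+ 2 = A ^+ 2 by rewrite expr_div_n real_normK ?num_real.
rewrite E A2 nrm_div nrmR (nrmM (b * u)) (nrmM b) -(mulrA (nrm b)) -(mulrA (nrm b)) ler_wpM2l ?nrm_ge0 //.
have h1 : nrm (r * (1 - T^* ) + T^* * (r - r^* )) <= (A + 2 * (n * p)) * `|t|.
  apply: le_trans (nrmD _ _) _; rewrite (nrmM r) (nrmM (T^* )) nrm_conj T1 mul1r cT AE mulrDl.
  rewrite /r cauchy_mult_conj // -/r -/p; apply: lerD; last by rewrite le_eqVlt; apply/orP; left; apply/eqP; ring.
  by rewrite ler_piMl // mulr_ge0 // divr_ge0 ?nrm_ge0 // ltW.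
apply: (@le_trans _ _ (nrm u * (A + 2 * (n * p)))).
  by rewrite -mulrA ler_wpM2l ?nrm_ge0 // ler_pdivrMr.
have h2 := amgm (nrm u) A l0; have h3 := amgm (nrm u) (n * p) m0.
(* One factor n^2 p is at most 1, leaving a Poisson kernel of integral pi / n. *)
have h4 : (n * p) ^+ 2 / m <= m^-1 * p.
  rewrite mulrC ler_wpM2l ?invr_ge0 ?(ltW m0) //.
  have -> : (n * p) ^+ 2 = n ^+ 2 * p * p by ring.
  by rewrite ler_piMl // ltW.
rewrite mulrDr; have -> : nrm u * (2 * (n * p)) = 2 * (nrm u * (n * p)) by ring.
lra.
Qed.

End CrossTerm.

Section Reproducing.
Variable R : realType.
Local Notation C := R[i].
Implicit Types (x y t : R) (f g k h : C -> C) (z w p : C).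

Lemma conj_M z w : (z * w)^* = z^* * w^*.
Proof. exact: rmorphM. Qed.
Lemma conj_B z w : (z - w)^* = z^* - w^*.
Proof. exact: rmorphB. Qed.
Lemma conj_div z w : (z / w)^* = z^* / w^*.
Proof. exact: fmorph_div. Qed.
Lemma conj_real t : (t%:C)^* = t%:C :> C.
Proof. by apply: complex_eqP; rewrite /= ?oppr0. Qed.

Lemma punct_real (u : R -> R) (d r : R) : punct (fun t => (u t)%:C) d r = (rpunct u d r)%:C.
Proof. by rewrite /punct !cu_real -rmorphD. Qed.

Lemma continuous_sqpoisson t : {for t, continuous (fun s : R => (s ^+ 2 + 1) ^- 2)}.
Proof.
have c1 : {for t, continuous (fun s : R => s ^+ 2 + 1)}.
  by apply: continuousD; [exact: exprn_continuous|exact: cst_continuous].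
by apply: continuousV (continuousX2 c1); rewrite expf_neq0 // gt_eqF // ltr_wpDl ?sqr_ge0.
Qed.

(* [X] is integrated over the punctured line. Up to two integrals of functions of the Hardy
   class, which vanish in the limit, it is [b f(0)] times [2 pi i]; Cauchy-Schwarz, in the form
   of the weighted inequality between means, bounds it by the product of [N] and [S]. *)
Theorem reproducing f f2 (T : R -> C) (b : C) (x1 N S : R) :
  hardy f x1 N -> hardy f2 x1 N -> 0 <= N -> 0 <= S ->
  (forall t, b^* * (f2 t%:C)^* * T t = b * f t%:C) ->
  (forall t, nrm (T t) = 1) -> T 0 = 1 -> (forall t, cont T t) ->
  (forall d r : R, 0 < d -> d <= r -> rpunct (fun t => nrm (1 - T t) ^+ 2 / t ^+ 2) d r <= S) ->
  (2 * pi * nrm (b * f 0)) ^+ 2 <= nrm b ^+ 2 * (N * S).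
Proof.
move=> Hf Hf2 N0 S0 ff2 T1 T0 cT HS.
set g0 := b * f 0; have pi0 : 0 < pi :> R by exact: pi_gt0.
have G0 : 0 <= nrm g0 by exact: nrm_ge0.
have B0 : 0 <= nrm b by exact: nrm_ge0.
(* The weight l is optimised by [quad_min]. *)
suff main (l : R) : 0 < l -> 2 * pi * nrm g0 <= nrm b * ((l * N + S / l) / 2).
  have [b0|b0] := eqVneq (nrm b) 0.
    by rewrite /g0 nrmM b0 mul0r mulr0 expr0n /= mul0r.
  have bp : 0 < nrm b by rewrite lt_neqAle eq_sym b0.
  have v0 : 0 <= 2 * pi * nrm g0 / nrm b by rewrite divr_ge0 // !mulr_ge0 // ltW.
  have := quad_min v0 N0 S0; rewrite expr_div_n ler_pdivrMr ?exprn_gt0 // => h.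
  by rewrite [leRHS]mulrC; apply: h => l l0; rewrite ler_pdivrMr // [leRHS]mulrC main.
move=> l0.
have cf t : cont (fun s : R => f s%:C) t by exact: hardy_cont Hf.
have cf2 t : cont (fun s : R => f2 s%:C) t by exact: hardy_cont Hf2.
have cr (n t : R) : 0 < n -> cont (fun s : R => cauchy_mult n s%:C) t.
  move=> n0; apply: cont_real_line; apply: cdiff_cont; apply: cdiff_cauchy_mult.
  by rewrite -nrm_gt0; have := shift_i n0 (chp_real t); lra.
have cq t : cont (fun s : R => double_pole s%:C) t.
  apply: cont_real_line; apply: cdiff_cont; apply: cdiff_double_pole.
  by rewrite -nrm_gt0; have := shift_i1 (chp_real t); lra.
have cinv : cont_off0 (fun s : R => (s%:C)^-1 : C).
  move=> t t0; apply: (@cont_real_line _ (fun z : C => z^-1)); apply: cdiff_cont; apply: cdiffV.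
    exact: cdiff_id.
  by rewrite -nrm_gt0 nrmR normr_gt0.
have cfn : rcont_off0 (fun t => nrm (f t%:C) ^+ 2).
  by move=> t _; apply: continuousX2; exact: cont_nrm.
have cTn : rcont_off0 (fun t => nrm (1 - T t) ^+ 2 / t ^+ 2).
  move=> t t0; apply: continuousM.
    by apply: continuousX2; apply: cont_nrm; apply: contB => //; exact: cont_cst.
  by apply: continuousV; [rewrite expf_neq0|exact: exprn_continuous].
have f20 : b^* * (f2 0)^* = g0 by have := ff2 0; rewrite T0 mulr1.
(* The constants subtracted from the two Hardy functions agree after multiplication by b and
   conj(b), so they combine into b f(0) times the explicit integrand. *)
have lin (b0 bc f0 f20c F F2c q qc ti : C) : bc * f20c = b0 * f0 ->
    (b0 * F - bc * F2c) * ti = b0 * f0 * ((q - qc) * ti)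
      + (b0 * ((F - f0 * q) * ti) + - bc * ((F2c - f20c * qc) * ti)).
  move=> h; apply/eqP; rewrite -subr_eq0; apply/eqP.
  transitivity ((b0 * f0 - bc * f20c) * (qc * ti)); first ring.
  by rewrite h subrr mul0r.
suff step e : 0 < e -> 2 * pi * nrm g0 <=
    nrm b * ((l * N + S / l) / 2) + e * (8 * nrm g0 + 4 * nrm b).
  set L := 8 * nrm g0 + 4 * nrm b in step.
  have L0 : 0 <= L by rewrite addr_ge0 // mulr_ge0.
  apply/ler_addgt0Pr => e e0; have L1 : 0 < 1 + L by rewrite ltr_pwDl.
  apply: le_trans (step _ (divr_gt0 e0 L1)) _; rewrite lerD2l mulrAC ler_pdivrMr //.
  by rewrite ler_wpM2l ?(ltW e0) // lerDr.
(* With this m and n = pi / (m e), the last two terms of the cross bound integrate to at most m N <=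
   e and pi / (m n) = e. *)
move=> e0; set m := e / (1 + N); have N1 : 0 < 1 + N by rewrite ltr_pwDl.
have m0 : 0 < m by rewrite divr_gt0.
set n := pi / (m * e); have n0 : 0 < n by rewrite divr_gt0 // mulr_gt0.
have [c1 c10 H1] := hardy_kernel Hf n0; have [c2 c20 H2] := hardy_kernel Hf2 n0.
have [d [r [d0 _ dr _ [cdr atn de]]]] := small_params 1 (addr_ge0 c10 c20) e0 ltr01.
set kf := (fun t : R => (f t%:C * cauchy_mult n t%:C - f 0 * double_pole t%:C) / t%:C) in H1.
set kf2 := (fun t : R => (f2 t%:C * cauchy_mult n t%:C - f2 0 * double_pole t%:C) / t%:C) in H2.
pose X (t : R) := (b * (f t%:C * cauchy_mult n t%:C)
   - b^* * (f2 t%:C * cauchy_mult n t%:C)^* ) / t%:C.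
have ckf : cont_off0 kf.
  by move=> t t0; apply: contM (cinv t t0); apply: contB; apply: contM => //;
    [exact: cr|exact: cont_cst].
have ckf2 : cont_off0 kf2.
  by move=> t t0; apply: contM (cinv t t0); apply: contB; apply: contM => //;
    [exact: cr|exact: cont_cst].
have cX : cont_off0 X.
  move=> t t0; apply: contM (cinv t t0); apply: contB; apply: contM; try exact: cont_cst.
    by apply: contM => //; exact: cr.
  by apply: cont_conj; apply: contM => //; exact: cr.
pose P (t : R) := (double_pole t%:C - (double_pole t%:C)^* ) / t%:C.
have cP : cont_off0 P.
  by move=> t t0; apply: contM (cinv t t0); apply: contB => //; exact: cont_conj.
have ckc : cont_off0 (fun t => (kf2 t)^* ) by move=> t t0; apply: cont_conj; exact: ckf2.
have XE : punct X d r = g0 * punct P d r + (b * punct kf d r + - b^* * (punct kf2 d r)^* ).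
  have cZ (h : R -> C) (k : C) : cont_off0 h -> cont_off0 (fun t => k * h t).
    by move=> ch t t0; apply: contM; [exact: cont_cst|exact: ch].
  have z1 := cZ _ g0 cP; have z2 := cZ _ b ckf; have z3 := cZ _ (- b^* ) ckc.
  have z23 : cont_off0 (fun t => b * kf t + - b^* * (kf2 t)^* ).
    by move=> t t0; apply: contD; [exact: z2|exact: z3].
  rewrite -(punct_conj r ckf2 d0) -(punctZ g0 r cP d0) -(punctZ b r ckf d0).
  rewrite -(punctZ _ r ckc d0) -(punctD r z2 z3 d0) -(punctD r z1 z23 d0).
  apply: punct_ext => // t t0; rewrite /X /P /kf /kf2.
  have -> : ((f2 t%:C * cauchy_mult n t%:C - f2 0 * double_pole t%:C) / t%:C)^*
      = ((f2 t%:C * cauchy_mult n t%:C)^* - (f2 0)^* * (double_pole t%:C)^* ) / t%:C.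
    by rewrite conj_div conj_B conj_real; congr ((_ - _) / _); exact: conj_M.
  exact: lin f20.
have PE : punct P d r = 4%:R * 'i * (rpunct (fun t => (t ^+ 2 + 1) ^- 2) d r)%:C.
  rewrite -punct_real -punctZ //; last first.
    by move=> t _; apply: cont_ReIm => /=; [exact: continuous_sqpoisson|exact: cst_continuous].
  by apply: punct_ext => // t t0; exact: double_pole_diff.
have Pge : 2 * pi - 8 * e <= nrm (punct P d r).
  rewrite PE nrmM nrmM nrmi mulr1 nrmR.
  have -> : nrm (4%:R : C) = 4 by rewrite -(rmorph_nat (real_complex R)) nrmR normr_nat.
  apply: (@le_trans _ _ (4 * (pi / 2 - 2 * e))); first lra.
  rewrite ler_wpM2l //; apply: le_trans (ler_norm _); rewrite rpunct_sqpoisson //.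
  have h1 : 0 <= r / (r ^+ 2 + 1).
    by rewrite divr_ge0 ?addr_ge0 ?sqr_ge0 // (le_trans _ dr) // ltW.
  have h2 : d / (d ^+ 2 + 1) <= d.
    by rewrite ler_pdivrMr ?ltr_wpDl ?sqr_ge0 // ler_peMr ?(ltW d0) // lerDr sqr_ge0.
  move: atn; rewrite ler_norml => /andP[]; lra.
have cpo : rcont_off0 (fun t => (t ^+ 2 + n ^+ 2)^-1).
  by move=> t _; exact: continuous_poisson.
have Xle : nrm (punct X d r) <= nrm b * ((l * N + S / l) / 2 + 2 * e).
  have cv1 := rcont_off0Z (c := l / 2) cfn; have cv2 := rcont_off0Z (c := l^-1 / 2) cTn.
  have cv3 := rcont_off0Z (c := m) cfn; have cv4 := rcont_off0Z (c := m^-1) cpo.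
  have cv := rcont_off0D (rcont_off0D cv1 cv2) (rcont_off0D cv3 cv4).
  apply: le_trans (nrm_punct r cX d0) _.
  apply: le_trans (@rpunct_le _ _ _ _ r d0 _ (rcont_off0Z (c := nrm b) cv) _) _.
  - by move=> t t0; apply: cont_nrm; exact: cX.
  - by move=> t t0; exact: cross_bound.
  rewrite (rpunctZ (nrm b) r cv d0) ler_wpM2l //.
  rewrite (rpunctD r (rcont_off0D cv1 cv2) (rcont_off0D cv3 cv4) d0) (rpunctD r cv1 cv2 d0).
  rewrite (rpunctD r cv3 cv4 d0) !(rpunctZ _ r _ d0) //.
  have hN : rpunct (fun t => nrm (f t%:C) ^+ 2) d r <= N.
    apply: le_trans (rpunct_full d0 dr _ _) (hardy_L2 Hf _ _) => t; last exact: sqr_ge0.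
    by apply: continuousX2; exact: cont_nrm.
  have hp : rpunct (fun t => (t ^+ 2 + n ^+ 2)^-1) d r <= pi / n.
    apply: le_trans (rpunct_full d0 dr _ _) (ru_poisson_le _ _ n0) => t.
      exact: continuous_poisson.
    by rewrite invr_ge0 addr_ge0 ?sqr_ge0.
  have h1 : l / 2 * rpunct (fun t => nrm (f t%:C) ^+ 2) d r <= l / 2 * N.
    by rewrite ler_wpM2l // divr_ge0 // ltW.
  have h2 : l^-1 / 2 * rpunct (fun t => nrm (1 - T t) ^+ 2 / t ^+ 2) d r <= l^-1 / 2 * S.
    by rewrite ler_wpM2l ?HS // divr_ge0 // invr_ge0 ltW.
  have h3 : m * rpunct (fun t => nrm (f t%:C) ^+ 2) d r <= e.
    apply: (@le_trans _ _ (m * N)); first by rewrite ler_wpM2l // ltW.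
    by rewrite /m mulrAC ler_pdivrMr // ler_wpM2l ?(ltW e0) // lerDr.
  have h4 : m^-1 * rpunct (fun t => (t ^+ 2 + n ^+ 2)^-1) d r <= e.
    apply: (@le_trans _ _ (m^-1 * (pi / n))); first by rewrite ler_wpM2l // invr_ge0 ltW.
    have -> : pi / n = m * e by rewrite /n invf_div mulrCA divff ?gt_eqF ?mulr1.
    by rewrite mulKf ?gt_eqF.
  by lra.
have nE : nrm g0 * (2 * pi - 8 * e) <= nrm (punct X d r) + nrm b * e.
  apply: (@le_trans _ _ (nrm (g0 * punct P d r))); first by rewrite nrmM ler_wpM2l.
  have -> : g0 * punct P d r = punct X d r - (b * punct kf d r + - b^* * (punct kf2 d r)^* ).
    by rewrite XE addrK.
  apply: le_trans (nrmB _ _) _; rewrite lerD2l; apply: le_trans (nrmD _ _) _.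
  rewrite !nrmM nrmN !nrm_conj -mulrDr ler_wpM2l //.
  by apply: le_trans (lerD (H1 _ _ d0 dr) (H2 _ _ d0 dr)) _; rewrite -mulrDl.
have := le_trans nE (lerD Xle (lexx _)); have := mulr_ge0 B0 (ltW e0).
by clear; move: (nrm g0) (nrm b) => G B; lra.
Qed.
End Reproducing.

(** * The square integral of the difference quotient of an inner function *)

Section InnerFunction.
Variable R : realType.
Local Notation C := R[i].
Implicit Types (x y t : R) (f g k h : C -> C) (z w p : C).

Lemma isd_peano2 f p l : (\forall z \near p, cdiff f z) -> isd f p l ->
  exists2 k, cont k p & forall z, f z = f p + (z - p) * l + (z - p) ^+ 2 * k z.
Proof.
move=> df fl; have [b [k [ck fk]]] := peano2 df; exists k => // z.
suff -> : l = b by exact: fk.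
apply: (isd_unique fl); exists (fun z => b + (z - p) * k z); split; last 2 first.
- by move=> w; rewrite fk; ring.
- by rewrite subrr mul0r addr0.
apply: contD; first exact: cont_cst.
by apply: contM => //; apply: contB; [exact: cont_id|exact: cont_cst].
Qed.

Lemma nrm_shift_ge z : chp z -> nrm z <= nrm (z + 'i).
Proof.
rewrite /chp => z0; rewrite -(@ler_pXn2r _ 2) ?nnegrE ?nrm_ge0 // !nrm_sqr !ReIm /=.
rewrite addr0 lerD2l; have := sqr_ge0 (Im z); rewrite !expr2; lra.
Qed.

(* Since [|1 - f|^2 = 2 Re (1 - f)] on the line, the integral is read off that of
   [(1 - f + i tau w) / z^2]; [w = i z / (z + i)] makes the singularity at 0 removable. *)
Lemma inner_integral f (tau : R) :
  (forall z, chp z -> \forall w \near z, cdiff f w) ->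
  (forall z, chp z -> nrm (f z) <= 1) -> (forall t, nrm (f t%:C) = 1) ->
  f 0 = 1 -> isd f 0 ('i * tau%:C) ->
  forall d r : R, 0 < d -> d <= r ->
    rpunct (fun t => nrm (1 - f t%:C) ^+ 2 / t ^+ 2) d r <= 2 * pi * tau.
Proof.
move=> df f1 fu f0 fl d r d0 dr.
have chp0 : chp (0 : C) by exact: chp_real.
have [k ck fk] := isd_peano2 (df _ chp0) fl.
have i1 z : chp z -> z + 'i != 0 by move=> /shift_i1 h; rewrite -nrm_gt0; lra.
pose w z : C := 'i * z / (z + 'i).
pose V z := (1 - f z + 'i * tau%:C * w z) / z ^+ 2.
have dV z : chp z -> z != 0 -> cdiff V z.
  move=> z0 zn; apply: cdiff_div; last by rewrite expf_neq0.
    apply: cdiffD; first by apply: cdiffB; [exact: cdiff_cst|exact: (nbhs_singleton (df z z0))].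
    apply: cdiffM; first exact: cdiff_cst.
    apply: cdiff_div; last exact: i1.
      by apply: cdiffM; [exact: cdiff_cst|exact: cdiff_id].
    by apply: cdiffD; [exact: cdiff_id|exact: cdiff_cst].
  by apply: cdiffX; exact: cdiff_id.
pose a := `|tau|; have a0 : 0 <= a by exact: normr_ge0.
have V2 z : chp z -> z != 0 -> nrm (V z) <= (2 + a) / nrm z ^+ 2.
  move=> z0 zn; rewrite nrm_div nrmX ler_wpM2r ?invr_ge0 ?sqr_ge0 //.
  apply: le_trans (nrmD _ _) _; apply: lerD.
    by apply: le_trans (nrmB _ _) _; rewrite nrm1; have := f1 z z0; lra.
  rewrite !nrmM nrmi mul1r nrmR -/a nrmV mul1r ler_piMr //.
  rewrite ler_pdivrMr ?mul1r ?nrm_shift_ge //.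
  by rewrite nrm_gt0 i1.
have Vk z : chp z -> z != 0 -> V z = - k z - 'i * tau%:C / (z + 'i).
  move=> z0 zn; rewrite /V /w fk f0 subr0.
  by have := i1 z z0 => zi; field; rewrite zn zi.
(* Near 0 the second-order expansion of [f] bounds [V]; away from 0 the decay does. *)
have [C1 V1] : exists C1 : R, forall z, chp z -> z != 0 -> nrm (V z) <= C1.
  have [e e0 ke] := (nearC _ _).1 (ck 1 ltr01).
  exists (Num.max (nrm (k 0) + 1 + a) ((2 + a) / e ^+ 2)) => z z0 zn.
  rewrite le_max; have [ze|ze] := ltP (nrm z) e; apply/orP; [left|right].
    rewrite Vk //; apply: le_trans (nrmB _ _) _; rewrite nrmN; apply: lerD.
      have := nrmD (k 0) (k z - k 0); rewrite addrC subrK.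
      have := ke z; rewrite subr0 => /(_ ze); lra.
    rewrite nrm_div nrmM nrmi mul1r nrmR -/a ler_pdivrMr; last by rewrite nrm_gt0 i1.
    by rewrite ler_peMr // shift_i1.
  apply: le_trans (V2 z z0 zn) _; rewrite ler_wpM2l //; first by lra.
  rewrite lef_pV2 ?posrE ?exprn_gt0 ?(lt_le_trans e0 ze) //.
  by rewrite ler_pXn2r ?nnegrE ?nrm_ge0 ?(ltW e0).
have C0 : 0 <= C1.
  by apply: le_trans (nrm_ge0 (V 1)) (V1 1 (chp_real 1) _); exact: oner_neq0.
pose u t := nrm (1 - f t%:C) ^+ 2 / t ^+ 2.
have cf t : cont (fun s : R => f s%:C) t.
  by apply: cont_real_line; apply: cdiff_cont; exact: (nbhs_singleton (df _ (chp_real t))).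
have cu_ : rcont_off0 u.
  move=> t t0; apply: continuousM.
    by apply: continuousX2; apply: cont_nrm; apply: contB => //; exact: cont_cst.
  by apply: continuousV; [rewrite expf_neq0|exact: exprn_continuous].
have u0 t : 0 <= u t by rewrite divr_ge0 ?sqr_ge0.
have cV : cont_off0 (fun t => V t%:C).
  move=> t t0; apply: cont_real_line; apply: cdiff_cont; apply: dV; first exact: chp_real.
  by rewrite -nrm_gt0 nrmR normr_gt0.
(* The compensating term i tau w / t^2 has real part -tau / (t^2 + 1). As the contour estimate makes
   the integral of V vanish in the limit, the bound 2 pi tau comes from this Poisson kernel
   alone. *)
have uV t : t != 0 -> u t = 2 * Re (V t%:C) + 2 * tau * (t ^+ 2 + 1 ^+ 2)^-1.
  move=> t0; have t2 : t ^+ 2 + 1 != 0 by rewrite gt_eqF // ltr_wpDl ?sqr_ge0.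
  have wE : w t%:C = (t / (t ^+ 2 + 1)) +i* (t ^+ 2 / (t ^+ 2 + 1)).
    apply: (canLR (mulfK (i1 _ (chp_real t)))); apply: complex_eqP; rewrite !ReIm /=; field; exact: t2.
  have VE : V t%:C = (1 - f t%:C + 'i * tau%:C * w t%:C) * ((t ^- 2)%:C).
    by rewrite /V -rmorphXn -fmorphV.
  have h := fu t; have := nrm_sqr (f t%:C); rewrite h expr1n VE wE /u nrm_sqr !ReIm /=.
  move=> h1; apply/eqP; rewrite -subr_eq0; apply/eqP.
  transitivity ((Re (f t%:C) ^+ 2 + Im (f t%:C) ^+ 2 - 1) / t ^+ 2).
    by field; rewrite t0 t2.
  by rewrite -h1 subrr mul0r.
have cV' : rcont_off0 (fun t => Re (V t%:C)) by move=> t /cV; exact: cont_Re.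
have cpo : rcont_off0 (fun t => (t ^+ 2 + 1 ^+ 2)^-1).
  by move=> t _; exact: continuous_poisson.
pose c := 2 * (4 * (2 + a) + 4 * C1).
have c0 : 0 <= c by rewrite /c; lra.
apply/ler_addgt0Pr => e e0; have a1 : 0 < 4 * a + 1 by lra.
have e10 : 0 < e / (4 * a + 1) by rewrite divr_gt0.
have [d' [r' [d'0 dd d'r' rr [cdr atn _]]]] := small_params r c0 e10 d0.
have r'0 : 0 < r' by lra.
apply: le_trans (rpunct_mono cu_ u0 d'0 dd dr rr) _.
have -> : rpunct u d' r' = 2 * rpunct (fun t => Re (V t%:C)) d' r'
    + 2 * tau * rpunct (fun t => (t ^+ 2 + 1 ^+ 2)^-1) d' r'.
  rewrite -(rpunctZ 2 r' cV' d'0) -(rpunctZ (2 * tau) r' cpo d'0).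
  rewrite -(rpunctD r' (rcont_off0Z (c := 2) cV') (rcont_off0Z (c := 2 * tau) cpo) d'0).
  congr (_ + _); apply: ru_ext => t /andP[t1 t2]; apply: uV.
    by rewrite lt_eqF //; lra.
  by rewrite gt_eqF //; lra.
have -> : rpunct (fun t => (t ^+ 2 + 1 ^+ 2)^-1) d' r' = 2 * (atan r' - atan d').
  rewrite /rpunct !ru_poisson ?lerN2 // ?invr1 ?divr1 ?mulr1 !atanN; lra.
have h1 : rpunct (fun t => Re (V t%:C)) d' r' <= 4 * (2 + a) / r' + 4 * C1 * d'.
  apply: le_trans (contour dV V1 V2 d'0 d'r'); apply: le_trans (ler_norm _) _.
  exact: le_trans (Re_le_nrm (punct (fun t => V t%:C) d' r')).
have h2 : 2 * (4 * (2 + a) / r' + 4 * C1 * d') <= c * (d' + r'^-1).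
  have h3 : 0 <= (2 + a) * d' by rewrite mulr_ge0 ?(ltW d'0) //; lra.
  have h4 : 0 <= C1 * r'^-1 by rewrite mulr_ge0 // invr_ge0 ltW.
  rewrite /c; lra.
have h5 : tau * (atan r' - atan d' - pi / 2) <= a * (e / (4 * a + 1)).
  by apply: le_trans (ler_norm _) _; rewrite normrM ler_pM.
have h6 : e = e / (4 * a + 1) + 4 * (a * (e / (4 * a + 1))) by field; rewrite gt_eqF.
set e1 := e / _ in cdr h5 h6 *; rewrite h6; lra.
Qed.
End InnerFunction.

(** * De Branges spaces *)

Section LineIntegrals.
Variable R : realType.
Local Notation C := R[i].
Implicit Types (x y t a b : R) (u v : R -> R) (E F : C -> C) (z w : C).
Local Notation mu := (@lebesgue_measure R).

(** On the zero set of [v] the quotient is constantly 0 by convention, and on the open complement it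
    is continuous. *)
Lemma measurable_ratio u v : continuous u -> continuous v ->
  measurable_fun setT (fun x => u x / v x).
Proof.
move=> cu_ cv; have oV : open [set x | v x != 0].
  rewrite openE => x /= vx; exact: cvgr_neq0 (cv x) vx.
have -> : [set: R] = [set x | v x != 0] `|` [set x | v x = 0].
  by apply/seteqP; split => x //= _; have [|] := eqVneq (v x) 0; [right|left].
have mC : measurable [set x | v x = 0].
  have -> : [set x | v x = 0] = ~` [set x | v x != 0].
    by apply/seteqP; split => x /= h; [rewrite h eqxx|exact/eqP/negPn/negP].
  by apply: measurableC; exact: open_measurable.
apply/measurable_funU => //; first exact: open_measurable.
split.
  apply: open_continuous_measurable_fun => // x; rewrite inE /= => vx.
  by apply: continuousM (cu_ x) _; apply: continuousV => //; exact: cv.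
have H : {in [set x | v x = 0], (fun=> 0) =1 (fun x => u x / v x)}.
  by move=> x; rewrite inE /= => ->; rewrite invr0 mulr0.
by apply: (eq_measurable_fun _ H); exact: measurable_cst.
Qed.

Lemma measurable_sqratio E F : (forall z, cdiff E z) -> (forall z, cdiff F z) ->
  measurable_fun setT (fun x : R => ((nrm (F x%:C) / nrm (E x%:C)) ^+ 2)%:E).
Proof.
move=> dE dF; apply/measurable_EFinP; apply: measurable_funX; apply: measurable_ratio => x.
  by apply: cont_nrm; apply: cont_real_line; exact: cdiff_cont.
by apply: cont_nrm; apply: cont_real_line; exact: cdiff_cont.
Qed.

Lemma line_integral_ge u a b : (forall x, 0 <= u x) -> measurable_fun setT u ->
  (\int[mu]_(x in setT) (u x)%:E < +oo)%E ->
  ru a b u <= fine (\int[mu]_(x in setT) (u x)%:E).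
Proof.
move=> u0 mu_ fin; rewrite /ru /Rintegral.
have m1 : measurable_fun setT (fun x => (u x)%:E) by exact/measurable_EFinP.
have h : (\int[mu]_(x in `[a, b]) (u x)%:E <= \int[mu]_(x in setT) (u x)%:E)%E.
  by apply: ge0_subset_integral => // x _; rewrite lee_fin.
have g0 (A : set R) : (0 <= \int[mu]_(x in A) (u x)%:E)%E.
  by apply: integral_ge0 => x _; rewrite lee_fin.
by apply: fine_le => //; rewrite ge0_fin_numE //; exact: le_lt_trans fin.
Qed.

(** Monotone convergence along [-n, n] links the norm, an extended integral, to the compact
    integrals estimated above. *)
Lemma line_integral_le u (X : R) : (forall x, 0 <= u x) -> continuous u ->
  (forall r : R, 0 < r -> ru (- r) r u <= X) -> (\int[mu]_(x in setT) (u x)%:E <= X%:E)%E.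
Proof.
move=> u0 cu_ uX.
have m1 : measurable_fun setT (fun x => (u x)%:E).
  by apply/measurable_EFinP; exact: continuous_measurable_fun.
pose F (n : nat) : set R := [set` `[- n%:R, n%:R]].
have : (\int[mu]_(x in F i) (u x)%:E)%E @[i --> \oo] --> (\int[mu]_(x in \bigcup_i F i) (u x)%:E)%E.
  apply: ge0_nondecreasing_set_cvg_integral.
  - move=> m n mn; rewrite subsetEset => x; rewrite /F /= !in_itv /= => /andP[x1 x2].
    have h : m%:R <= n%:R :> R by rewrite ler_nat.
    by apply/andP; split; lra.
  - by move=> i; exact: measurable_itv.
  - by move=> i; exact: measurable_funTS.
  - by move=> i x _; rewrite lee_fin.
rewrite bigcup_itvT => H; rewrite -(cvg_lim _ H) //; apply: lime_le; first exact: cvgP H.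
near=> n.
have n0 : 0 < n%:R :> R by rewrite ltr0n; near: n; exists 1%N.
have := uX _ n0; rewrite /ru /Rintegral -lee_fin fineK //.
have : mu.-integrable `[- n%:R, n%:R] (EFin \o u) by apply: ru_integrable => t _; exact: cu_.
by move=> /integrable_fin_num; apply.
Unshelve. all: by end_near.
Qed.

End LineIntegrals.

Section DeBrangesFacts.
Variable R : realType.
Local Notation C := R[i].
Implicit Types (x y t a b : R) (E F G : C -> C) (z w : C).

Lemma nrm_lt z w : (`|z| < `|w|) = (nrm z < nrm w).
Proof. by rewrite !normCE ltcR. Qed.

Lemma star_real F t : star F t%:C = (F t%:C)^*.
Proof. by rewrite /star conj_real. Qed.

Lemma starK F : star (star F) = F.
Proof. by apply/funext => z; rewrite /star !conjCK. Qed.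

Lemma isd_star F z l : isd F z^* l -> isd (star F) z l^*.
Proof.
move=> /isd_eps H; apply/isd_eps => e e0; have [d d0 dP] := H e e0.
exists d => // w wz; have E : w^* - z^* = (w - z)^* by rewrite conj_B.
have := dP w^*; rewrite E nrm_conj => /(_ wz) h; apply: le_trans h.
by rewrite -[leLHS]nrm_conj /star !conj_B conj_M !conjCK E.
Qed.

Lemma cdiff_star F z : cdiff F z^* -> cdiff (star F) z.
Proof. by case=> l /isd_star h; exists l^*. Qed.

Lemma entire_cdiff F : entire F -> forall z, cdiff F z.
Proof. by move=> dF z; apply/cdiffP; exact: dF. Qed.

Lemma holomorphic_cdiff G : holomorphic_on (@upper_half_plane R) G <->
  forall z, uhp z -> cdiff G z.
Proof. by split => dG z uz; apply/cdiffP; apply: dG. Qed.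

Lemma mean_type_le0 G (e : R) : (mean_type G <= 0)%E -> 0 < e ->
  exists Y : R, forall y, Y <= y -> nrm (G (y *i)) <= expR (e * y).
Proof.
move=> mG e0; have : (mean_type G < e%:E)%E by apply: le_lt_trans mG _; rewrite lte_fin.
move=> /ereal_inf_lt[_ [V [Y [_ VY]] <-] sV].
exists (Num.max 1 (Y + 1)) => y; rewrite ge_max => /andP[y1 y2].
have Vy : V y by apply: VY; lra.
have y0 : 0 < y by lra.
have : ((y^-1)%:E * lne (nrm (G (y *i)))%:E < e%:E)%E.
  by apply: le_lt_trans sV; apply: ereal_sup_ubound; exists y.
have [->|Gn] := eqVneq (nrm (G (y *i))) 0; first by move=> _; exact: expR_ge0.
have G0 : 0 < nrm (G (y *i)) by rewrite lt_neqAle eq_sym Gn nrm_ge0.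
rewrite lne_EFin // -EFinM lte_fin mulrC ltr_pdivrMr // => h.
by rewrite -(lnK (x := nrm _)) ?posrE // ler_expR ltW.
Qed.

Lemma mean_type_bounded G (M : R) : (forall z, uhp z -> nrm (G z) <= M) ->
  (mean_type G <= 0)%E.
Proof.
move=> GM; apply/lee_addgt0Pr => e e0; rewrite add0e.
pose M1 := Num.max 1 M; have M11 : 1 <= M1 by rewrite le_max lexx.
pose Y := Num.max 1 (ln M1 / e).
pose V : set R := [set y | Y < y].
have VI : (pinfty_nbhs R) V by exists Y; split => //; rewrite num_real.
apply: (@le_trans _ _ (ereal_sup [set ((y^-1)%:E * lne (nrm (G (y *i)))%:E)%E | y in V])).
  by apply: ereal_inf_lbound; exists V.
apply: ub_ereal_sup => _ [y Vy <-].
have [y1 y2] : 1 < y /\ ln M1 / e < y by move: Vy; rewrite /V /= gt_max => /andP.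
have y0 : 0 < y by apply: lt_trans y1.
have GM1 : nrm (G (y *i)) <= M1 by rewrite le_max GM ?orbT.
have [G0|Gn] := eqVneq (nrm (G (y *i))) 0.
  by rewrite G0 le0_lneNy // gt0_muleNy ?leNye // lte_fin invr_gt0.
have G0 : 0 < nrm (G (y *i)) by rewrite lt_neqAle eq_sym Gn nrm_ge0.
rewrite lne_EFin // -EFinM lee_fin mulrC ler_pdivrMr //.
apply: (@le_trans _ _ (ln M1)); first by rewrite ler_ln ?posrE // (lt_le_trans ltr01).
by move: y2; rewrite ltr_pdivrMr // mulrC => /ltW.
Qed.

Lemma bounded_type_bounded G (M : R) : (forall z, uhp z -> cdiff G z) ->
  (forall z, uhp z -> nrm (G z) <= M) -> bounded_type G.
Proof.
move=> dG GM; have hG := (holomorphic_cdiff G).2 dG; split => //.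
exists G, (fun=> 1); split.
- by split; [exact: hG|apply: (holomorphic_cdiff _).2 => z _; exact: cdiff_cst].
- exists (Num.max 1 M) => z uz; rewrite !normCE !lecR nrm1 !le_max lexx.
  by rewrite GM // orbT.
- by exists 'i; [rewrite /upper_half_plane /= ltr01|exact: oner_neq0].
- by move=> z _ _; rewrite divr1.
Qed.

Lemma bounded_type_growth' G : bounded_type G -> (forall z, uhp z -> cdiff G z) /\
  exists2 K : R, 0 <= K &
    forall z, uhp z -> nrm (G z) <= expR (K * (1 + nrm z ^+ 2) / Im z).
Proof.
move=> [/holomorphic_cdiff dG [P [Q [[_ /holomorphic_cdiff dQ] [M PQM] [z1 uz1 Qz1] GPQ]]]].
split => //; apply: (@bounded_type_growth _ G Q M z1) => // z uz.
  by have [_] := PQM z uz; rewrite normCE lecR.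
have [+ _] := PQM z uz; rewrite normCE lecR => PM.
have [Q0|Qn] := eqVneq (Q z) 0; last by rewrite GPQ // divfK.
by rewrite Q0 mulr0 nrm0; apply: le_trans PM; exact: nrm_ge0.
Qed.
End DeBrangesFacts.

(** * Point evaluation on the real line *)

Section EvaluationBound.
Variable R : realType.
Local Notation C := R[i].
Implicit Types (x y t a b : R) (F G : C -> C) (z w : C).

(* Besides the Hermite-Biehler inequality, zeros on the real line are excluded. *)
Record hb (B : C -> C) : Prop := Hb {
  hb_cdiff : forall z, cdiff B z;
  hb_neq0 : forall z, chp z -> B z != 0;
  hb_le : forall z, chp z -> nrm (star B z) <= nrm (B z) }.

Variable B : C -> C.
Hypothesis hB : hb B.

Lemma de_Branges_star F : de_Branges B F -> de_Branges B (star F).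
Proof.
move=> [dF fF b1 b2 [m1 m2]]; split.
- by move=> z _; apply/cdiffP; apply: cdiff_star; exact: entire_cdiff.
- rewrite /sqnorm; under eq_integral => x _ do rewrite star_real nrm_conj.
  exact: fF.
- exact: b2.
- by rewrite starK; exact: b1.
- by rewrite starK; split; [exact: m2|exact: m1].
Qed.

Lemma sqnorm_star F : sqnorm B (star F) = sqnorm B F.
Proof. by apply: eq_integral => x _; rewrite star_real nrm_conj. Qed.

Lemma near_shift (P : C -> Prop) z c : (\forall w \near z + c, P w) -> \forall w \near z, P (w + c).
Proof.
move=> /nearC[d d0 dP]; apply/nearC; exists d => // w wz; apply: dP.
by have -> : w + c - (z + c) = w - z by ring.
Qed.

Lemma hb_near z : chp z -> \forall w \near z, B w != 0.
Proof.
move=> cz; have B0 : 0 < nrm (B z) by rewrite nrm_gt0 hb_neq0.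
apply: filterS (cdiff_cont (hb_cdiff hB z) B0) => w h; rewrite -nrm_gt0.
by have := nrm_sub (B z) (B w); rewrite nrm_distC; lra.
Qed.

Lemma chp_shift x z : chp z -> chp (z + x%:C).
Proof. by rewrite /chp ImD /= addr0. Qed.

Lemma cdiff_shift F x z : cdiff F (z + x%:C) -> cdiff (fun w => F (w + x%:C)) z.
Proof.
move=> dF; apply: cdiff_comp => //; apply: cdiffD; [exact: cdiff_id|exact: cdiff_cst].
Qed.

Lemma cdiff_quot F x z : (forall z, cdiff F z) -> chp z ->
  \forall w \near z, cdiff (fun w => F (w + x%:C) / B (w + x%:C)) w.
Proof.
move=> dF cz; apply: filterS (near_shift (hb_near (chp_shift x cz))) => w Bw.
by apply: cdiff_div => //; apply: cdiff_shift => //; exact: hb_cdiff.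
Qed.

Lemma de_Branges_hardy F x : de_Branges B F ->
  hardy (fun z => F (z + x%:C) / B (z + x%:C)) (- x) (fine (sqnorm B F)).
Proof.
move=> [/entire_cdiff dF fF b1 b2 [m1 m2]].
have dB := hb_cdiff hB.
pose u t := (nrm (F t%:C) / nrm (B t%:C)) ^+ 2.
have cu_ : continuous u.
  move=> t; apply: (@continuousX2 R (fun t => nrm (F t%:C) / nrm (B t%:C))).
  apply: continuousM; first by apply: cont_nrm; apply: cont_real_line; exact: cdiff_cont.
  apply: continuousV; last by apply: cont_nrm; apply: cont_real_line; exact: cdiff_cont.
  by rewrite nrm_eq0 hb_neq0 // chp_real.
have cq t : cont (fun s : R => F (s%:C + x%:C) / B (s%:C + x%:C)) t.
  apply: (@cont_real_line _ (fun z => F (z + x%:C) / B (z + x%:C))); apply: cdiff_cont.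
  exact: (nbhs_singleton (cdiff_quot x dF (chp_real t))).
split.
- by move=> z cz; exact: cdiff_quot.
- move=> a b; apply: (@le_trans _ _ (ru a b (fun t => u (x + t)))).
    apply: ru_le => [t _|t _|t _].
    + exact: (@continuousX2 R (fun t => nrm (F (t%:C + x%:C) / B (t%:C + x%:C))) t (cont_nrm (cq t))).
    + by apply: (@continuous_comp _ _ _ (fun t => x + t) u) (cu_ _);
        apply: continuousD; [exact: cst_continuous|exact: cvg_id].
    + by rewrite /u nrm_div -rmorphD addrC.
  have [ab|/ltW ba] := leP a b; last first.
    by rewrite ru_eq0 //; apply: fine_ge0; apply: integral_ge0 => t _; rewrite lee_fin sqr_ge0.
  rewrite (ru_shift x cu_ ab); apply: line_integral_ge => //.
    by move=> t; exact: sqr_ge0.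
  by apply/measurable_EFinP; exact: measurable_sqratio.
- have [_ [K K0 HK]] := bounded_type_growth' b1.
  (* From 1 + |z + x|^2 <= (2 + 2 x^2) (1 + |z|^2). *)
  exists (K * (2 + 2 * x ^+ 2)); first by rewrite mulr_ge0 // addr_ge0 // mulr_ge0 ?sqr_ge0.
  move=> z uz; have uz' : uhp (z + x%:C) by rewrite /uhp ImD /= addr0.
  apply: le_trans (HK _ uz') _; rewrite ler_expR ImD /= addr0 ler_pM2r ?invr_gt0 //.
  rewrite -mulrA ler_wpM2l //.
  have := nrmD z x%:C; rewrite nrmR => h.
  have h2 : nrm (z + x%:C) ^+ 2 <= 2 * nrm z ^+ 2 + 2 * x ^+ 2.
    have := lerXn2r 2 _ _ h; rewrite !nnegrE nrm_ge0 addr_ge0 ?nrm_ge0 // => /(_ isT isT).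
    have := sqr_ge0 (nrm z - `|x|); have := real_normK (num_real x); lra.
  have := mulr_ge0 (sqr_ge0 x) (sqr_ge0 (nrm z)); lra.
- move=> e e0; have [Y HY] := mean_type_le0 m1 e0; exists Y => y yY.
  have -> : (- x +i* y) + x%:C = y *i by apply: complex_eqP; rewrite !ReIm /=; ring.
  exact: HY.
Qed.

(** The function T of the overview, formed with B: the last factor is 1 / Theta(x), since [star B]
    is the conjugate of B on the line. *)
Definition inner x z := star B (z + x%:C) / B (z + x%:C) * (B x%:C / (B x%:C)^* ).

Lemma star_cdiff z : cdiff (star B) z.
Proof. by apply: cdiff_star; exact: hb_cdiff. Qed.

Lemma inner_cdiff x z : chp z -> \forall w \near z, cdiff (inner x) w.
Proof.
move=> cz; apply: filterS (cdiff_quot x star_cdiff cz) => w dw.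
by apply: cdiffM => //; exact: cdiff_cst.
Qed.

Lemma nrm_conj_quot z : z != 0 -> nrm (z / z^* ) = 1.
Proof. by move=> z0; rewrite nrm_div nrm_conj divff // nrm_eq0. Qed.

Lemma inner_le1 x z : chp z -> nrm (inner x z) <= 1.
Proof.
move=> cz; rewrite nrmM nrm_conj_quot ?(hb_neq0 hB (chp_real _)) // mulr1 nrm_div.
have cw := chp_shift x cz.
by rewrite ler_pdivrMr ?mul1r ?(hb_le hB) // nrm_gt0 (hb_neq0 hB).
Qed.

Lemma inner_unit x t : nrm (inner x t%:C) = 1.
Proof.
rewrite nrmM nrm_conj_quot ?(hb_neq0 hB (chp_real _)) // mulr1 nrm_div -rmorphD.
by rewrite star_real nrm_conj divff // nrm_eq0 (hb_neq0 hB (chp_real _)).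
Qed.

Lemma inner0 x : inner x 0 = 1.
Proof.
have Bx := hb_neq0 hB (chp_real x).
by rewrite /inner add0r star_real mulf_div [X in X / _]mulrC divff // mulf_neq0 // -nrm_eq0 nrm_conj nrm_eq0.
Qed.

(** [reproducing] is applied to the translates of F / B and F^* / B with b = B(x). On the line these
    are related by conjugation and T, and the integral of |1 - T|^2 / t^2 is at most 2 pi tau. *)
Lemma evaluation_bound F x (tau : R) : de_Branges B F -> isd (inner x) 0 ('i * tau%:C) ->
  (2 * pi * nrm (F x%:C)) ^+ 2 <= nrm (B x%:C) ^+ 2 * (fine (sqnorm B F) * (2 * pi * tau)).
Proof.
move=> bF dT; have Bx := hb_neq0 hB (chp_real x).
have S := inner_integral (inner_cdiff x) (inner_le1 x) (inner_unit x) (inner0 x) dT.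
have cT t : cont (fun s : R => inner x s%:C) t.
  apply: cont_real_line; apply: cdiff_cont.
  exact: (nbhs_singleton (inner_cdiff x (chp_real t))).
have N0 : 0 <= fine (sqnorm B F).
  by apply: fine_ge0; apply: integral_ge0 => t _; rewrite lee_fin sqr_ge0.
have S0 : 0 <= 2 * pi * tau.
  apply: le_trans (S 1 1 ltr01 (lexx _)).
  by apply: addr_ge0; apply: ru_ge0 => t _; rewrite divr_ge0 ?sqr_ge0.
have h1 := de_Branges_hardy x bF.
have h2 := de_Branges_hardy x (de_Branges_star bF); rewrite sqnorm_star in h2.
have := reproducing (b := B x%:C) h1 h2 N0 S0 _ (inner_unit x) (inner0 x) cT S.
rewrite add0r mulrCA divff // mulr1; apply => t.
rewrite /inner -rmorphD !star_real conj_div conjCK.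
have Bt := hb_neq0 hB (chp_real (t + x)).
have Bt' : (B (t + x)%:C)^* != 0 by rewrite -nrm_eq0 nrm_conj nrm_eq0.
have Bx' : (B x%:C)^* != 0 by rewrite -nrm_eq0 nrm_conj nrm_eq0.
by field; rewrite Bt Bt' Bx'.
Qed.

End EvaluationBound.

(** * Absence of real zeros *)

Section VanishingOnInterval.
Variable R : realType.
Local Notation C := R[i].
Implicit Types (x y t a b d : R) (E F G : C -> C) (z w : C).

(* The product of the four rotations of [E] about the centre of a square resting
   on the interval vanishes on the whole boundary of that square. *)
Lemma vanishing_interval E a d : (forall z, cdiff E z) -> 0 < d ->
  (forall t, a < t -> t < a + d -> E t%:C = 0) -> E ((a + d / 2) +i* (d / 4)) = 0.
Proof.
move=> dE d0 E0; pose eta := d / 4; have eta0 : 0 < eta by rewrite divr_gt0.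
pose p : C := (a + d / 2) +i* eta.
pose U : set C := [set w | `|Re w| < eta /\ `|Im w| < eta].
pose rot k w := E (p + 'i ^+ k * w).
have drot k w : cdiff (rot k) w.
  apply: cdiff_comp => //; apply: cdiffD; first exact: cdiff_cst.
  by apply: cdiffM; [exact: cdiff_cst|exact: cdiff_id].
pose g w := rot 0%N w * rot 1%N w * (rot 2%N w * rot 3%N w).
have dg w : cdiff g w by do !apply: cdiffM.
have side w : `|Re w| <= eta -> Im w = - eta -> E (p + w) = 0.
  rewrite ler_norml => /andP[w1 w2] wI.
  have -> : p + w = (a + d / 2 + Re w)%:C by apply: complex_eqP; rewrite !ReIm /= ?wI; ring.
  by apply: E0; rewrite /eta in w1 w2; lra.
have i3 : ('i : C) ^+ 3 = - 'i by rewrite exprS sqr_i mulrN1.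
have absle (u v e : R) : `|u| < eta -> `|u - v| <= e -> `|v| <= eta + e.
  by rewrite ltr_norml !ler_norml => /andP[? ?] /andP[? ?]; apply/andP; split; lra.
have bd w : ~ U w -> adherent U w -> g w = 0.
  move=> nU aU.
  have [wR wI] : `|Re w| <= eta /\ `|Im w| <= eta.
    split; apply/ler_addgt0Pr => e e0; have [z [z1 z2] zw] := aU e e0.
      by apply: (absle (Re z)) => //; apply: le_trans (ltW zw); have := Re_le_nrm (z - w); rewrite !ReIm.
    by apply: (absle (Im z)) => //; apply: le_trans (ltW zw); have := Im_le_nrm (z - w); rewrite !ReIm.
  have r0 : w = 'i ^+ 0%N * w by rewrite mul1r.
  have [h|hR] := eqVneq (`|Re w|) eta.
    have [w0|w0] := leP 0 (Re w).
      suff r3 : rot 3%N w = 0 by rewrite /g r3 !mulr0.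
      apply: side; rewrite i3 !ReIm /=.
        by rewrite oppr0 !mul0r sub0r mulN1r opprK.
      by rewrite oppr0 mul0r add0r mulN1r -h ger0_norm.
    suff r1 : rot 1%N w = 0 by rewrite /g r1 mulr0 mul0r.
    apply: side; rewrite expr1 !ReIm /=; first by rewrite mul0r sub0r mul1r normrN.
    by rewrite mul0r add0r mul1r -h ltr0_norm // opprK.
  have [h|hI] := eqVneq (`|Im w|) eta; last first.
    by case: nU; split; rewrite lt_neqAle ?hR ?hI ?wR ?wI.
  have [w0|w0] := leP 0 (Im w).
    suff r2 : rot 2%N w = 0 by rewrite /g r2 mul0r mulr0.
    by apply: side; rewrite sqr_i mulN1r !ReIm ?normrN // -h ger0_norm.
  suff r1 : rot 0%N w = 0 by rewrite /g r1 !mul0r.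
  by apply: side; rewrite expr0 mul1r // -h ltr0_norm // opprK.
have : nrm (g 0) <= 0.
  apply: (@max_principle _ U g 0 (2 * eta)) => //.
  - move=> z [z1 z2]; apply: le_trans (nrm_le_ReIm _) _; lra.
  - move=> z [z1 z2]; apply/nearC; exists (Num.min (eta - `|Re z|) (eta - `|Im z|)).
      by rewrite lt_min !subr_gt0 z1.
    move=> w; rewrite lt_min => /andP[w1 w2].
    have h1 := le_lt_trans (Re_le_nrm _) w1; have h2 := le_lt_trans (Im_le_nrm _) w2.
    rewrite !ReIm in h1 h2; have e1 := ler_normD (Re w - Re z) (Re z).
    have e2 := ler_normD (Im w - Im z) (Im z); rewrite !subrK in e1 e2; split; lra.
  - move=> w nU aU e e0; have := bd w nU aU => gw.
    have := cdiff_cont (dg w) e0; rewrite gw add0r; apply: filterS => z.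
    by rewrite subr0 => /ltW.
  - by rewrite /U /= normr0.
rewrite /g /rot !mulr0 !addr0 => h; apply/eqP.
have : nrm (E p * E p * (E p * E p)) == 0 by rewrite eq_le h nrm_ge0.
by rewrite nrm_eq0 !mulf_eq0 !orbb.
Qed.
End VanishingOnInterval.

Section BoundaryZeros.
Variable R : realType.
Local Notation C := R[i].
Implicit Types (x y t a b d : R) (F G : C -> C) (z w : C).
Variable E : C -> C.
Hypothesis hE : hermite_biehler E.

Lemma hermite_biehler_cdiff z : cdiff E z.
Proof. by apply: entire_cdiff; case: hE. Qed.

Lemma hermite_biehler_lt z : uhp z -> nrm (star E z) < nrm (E z).
Proof. by move=> uz; rewrite -nrm_lt; case: hE => _; apply. Qed.

Lemma hermite_biehler_neq0 z : uhp z -> E z != 0.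
Proof.
by move=> uz; rewrite -nrm_gt0; apply: le_lt_trans (hermite_biehler_lt uz); exact: nrm_ge0.
Qed.

Lemma hermite_biehler_le z : chp z -> nrm (star E z) <= nrm (E z).
Proof.
rewrite /chp le_eqVlt => /predU1P[z0|z0]; last by apply: ltW; exact: hermite_biehler_lt.
have -> : z = (Re z)%:C by apply: complex_eqP.
by rewrite star_real nrm_conj.
Qed.

Lemma cont_neq0 F z : cdiff F z -> F z != 0 -> \forall w \near z, F w != 0.
Proof.
move=> /cdiff_cont cF; rewrite -nrm_gt0 => F0; apply: filterS (cF _ F0) => w h.
by rewrite -nrm_gt0; have := nrm_sub (F z) (F w); rewrite nrm_distC; lra.
Qed.

(** A real zero is followed within distance 1 by a non-zero real point b, as otherwise E would
    vanish inside the upper half-plane. The supremum of the zeros up to b is the required a. *)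
Lemma last_zero a0 : E a0%:C = 0 ->
  exists a b, [/\ a < b, E a%:C = 0 & forall t, a < t -> t <= b -> E t%:C != 0].
Proof.
move=> Ea0; have [b [b1 b2 Eb]] : exists b, [/\ a0 < b, b < a0 + 1 & E b%:C != 0].
  apply/not_existsP => H; have := vanishing_interval hermite_biehler_cdiff ltr01.
  move=> /(_ a0); rewrite (_ : (E _ = 0) = False); last first.
    by apply/propext; split => // /eqP; apply/negP; apply: hermite_biehler_neq0; rewrite /uhp /=; lra.
  apply => t t1 t2; apply/eqP/negPn/negP => Et; exact: (H t).
pose A : set R := [set t | [/\ a0 <= t, t <= b & E t%:C = 0]].
have Aa0 : A a0 by split => //; exact: ltW.
have ubA : ubound A b by move=> t [].
have sA : has_sup A by split; [exists a0|exists b].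
have a0s : a0 <= sup A by apply: ub_le_sup => //; exists b.
have Es : E (sup A)%:C = 0.
  apply/eqP/negPn/negP => Es; have [e e0 He] := (nearC _ _).1 (cont_neq0 (hermite_biehler_cdiff _) Es).
  have [t [t1 t2 Et] st] := sup_adherent e0 sA.
  have ts : t <= sup A by apply: ub_le_sup; [exists b|split].
  have tE : nrm (t%:C - (sup A)%:C) < e by rewrite -rmorphB nrmR ltr_norml; apply/andP; split; lra.
  by have := He _ tE; rewrite Et eqxx.
have sb : sup A <= b by apply: ge_sup => //; exists a0.
exists (sup A), b; split => //.
  by rewrite lt_neqAle sb andbT; apply/eqP => e; move: Eb; rewrite -e Es eqxx.
move=> t t1 t2; apply/eqP => Et; have : t <= sup A; last by lra.
apply: ub_le_sup; first by exists b.
by split => //; lra.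
Qed.
End BoundaryZeros.

Section KernelFunction.
Variable R : realType.
Local Notation C := R[i].
Implicit Types (x y t a b d : R) (B F G : C -> C) (z w : C).

(** Membership criterion for explicit functions: bounded quotients have bounded type and
    non-positive mean type. *)
Lemma de_Branges_intro B F (M1 M2 : R) :
  (forall z, cdiff B z) -> (forall z, uhp z -> B z != 0) -> (forall z, cdiff F z) ->
  (forall z, uhp z -> nrm (F z) <= M1 * nrm (B z)) ->
  (forall z, uhp z -> nrm (star F z) <= M2 * nrm (B z)) ->
  (sqnorm B F < +oo)%E -> de_Branges B F.
Proof.
move=> dB B0 dF FM sM fin.
have dsF z : cdiff (star F) z by exact: cdiff_star.
have Bp z : uhp z -> 0 < nrm (B z) by move=> /B0; rewrite nrm_gt0.
have d1 z : uhp z -> cdiff (fun z => F z / B z) z.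
  by move=> uz; apply: cdiff_div; [exact: dF|exact: dB|exact: B0].
have d2 z : uhp z -> cdiff (fun z => star F z / B z) z.
  by move=> uz; apply: cdiff_div; [exact: dsF|exact: dB|exact: B0].
have b1 z : uhp z -> nrm (F z / B z) <= M1.
  by move=> uz; rewrite nrm_div ler_pdivrMr ?Bp // FM.
have b2 z : uhp z -> nrm (star F z / B z) <= M2.
  by move=> uz; rewrite nrm_div ler_pdivrMr ?Bp // sM.
split.
- by move=> z _; apply/cdiffP; exact: dF.
- exact: fin.
- exact: bounded_type_bounded d1 b1.
- exact: bounded_type_bounded d2 b2.
- by split; [exact: mean_type_bounded b1|exact: mean_type_bounded b2].
Qed.

Variable E : C -> C.
Hypothesis hE : hermite_biehler E.

(* [k] is, up to a constant, the reproducing kernel of [H(E)] at [i]. *)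
Lemma kernel_exists : exists k, exists c1 c2 c3 : R,
  [/\ 0 < c1, forall z, cdiff k z,
    forall z, chp z -> c1 * nrm (E z) <= nrm (z + 'i) * nrm (k z),
    forall z, chp z -> nrm (z + 'i) * nrm (k z) <= c2 * nrm (E z) &
    forall z, uhp z -> nrm (star k z) <= c3 * nrm (E z)].
Proof.
have ui : uhp ('i : C) by rewrite /uhp /= ltr01.
(* Numerator of the kernel at i. It vanishes at -i, and the strict inequality |E^*(i)| < |E(i)|
   makes it comparable with E on the closed half-plane. *)
pose n z := (E 'i)^* * E z - (star E 'i)^* * star E z.
pose A := nrm (E 'i); pose A' := nrm (star E 'i).
have AA : A' < A by exact: hermite_biehler_lt.
have A'0 : 0 <= A' by exact: nrm_ge0.
have dE z := hermite_biehler_cdiff hE z.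
have dsE z : cdiff (star E) z by exact: cdiff_star.
have dn z : cdiff n z by apply: cdiffB; apply: cdiffM => //; exact: cdiff_cst.
have ci : ('i : C)^* = - 'i by apply: complex_eqP => //=; rewrite oppr0.
have ni : n (- 'i) = 0.
  have cNi : (- 'i : C)^* = 'i by apply: complex_eqP; rewrite /= ?oppr0 ?opprK.
  by rewrite /n /star ci cNi conjCK mulrC subrr.
have [k [nk dk]] : exists k, (forall z, n z = (z + 'i) * k z) /\ forall z, cdiff k z.
  have [|k [nk dk]] := @quotient0 _ n (- 'i) _ ni; first by apply: filterE.
  by exists k; split => z; [rewrite nk opprK|exact: dk].
have nle z : chp z -> nrm (n z) <= 2 * A * nrm (E z).
  move=> cz; apply: le_trans (nrmB _ _) _; rewrite !nrmM (nrm_conj (E 'i)) (nrm_conj (star E 'i)) -/A -/A'.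
  have h := hermite_biehler_le hE cz; have h0 := nrm_ge0 (star E z).
  have := ler_wpM2l A'0 h; have := ler_wpM2r (nrm_ge0 (E z)) (ltW AA); lra.
have nge z : chp z -> (A - A') * nrm (E z) <= nrm (n z).
  move=> cz; apply: le_trans (nrm_sub _ _); rewrite !nrmM (nrm_conj (E 'i)) (nrm_conj (star E 'i)) -/A -/A'.
  have := ler_wpM2l A'0 (hermite_biehler_le hE cz); lra.
have sn z : star n z = (z - 'i) * star k z.
  rewrite /star nk conj_M; congr (_ * _).
  by case: z => x y; apply: complex_eqP; rewrite !ReIm /=; ring.
have snle z : chp z -> nrm (star n z) <= 2 * A * nrm (E z).
  move=> cz; have -> : star n z = E 'i * star E z - star E 'i * E z.
    by rewrite {1}/star /n conj_B !conj_M !conjCK.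
  apply: le_trans (nrmB _ _) _; rewrite !nrmM -/A -/A'.
  have h := hermite_biehler_le hE cz; have h0 := nrm_ge0 (star E z).
  have A0 : 0 <= A by exact: nrm_ge0.
  have := ler_wpM2l A0 h; have := ler_wpM2r (nrm_ge0 (E z)) (ltW AA); lra.
pose G z := star k z / E z.
have cG : cont G 'i.
  apply: cdiff_cont; apply: cdiff_div; first by apply: cdiff_star; exact: dk.
    exact: dE.
  exact: hermite_biehler_neq0.
have [e e0 He] := (nearC _ _).1 (cG 1 ltr01).
(* Since k^* is n^* / (z - i), its bound combines continuity near i with division by |z - i| >= e
   elsewhere. *)
exists k, (A - A'), (2 * A), (Num.max (nrm (G 'i) + 1) (2 * A / e)); split.
- by rewrite subr_gt0.
- exact: dk.
- by move=> z cz; rewrite -nrmM -nk; exact: nge.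
- by move=> z cz; rewrite -nrmM -nk; exact: nle.
move=> z uz; have Ez : 0 < nrm (E z) by rewrite nrm_gt0; exact: hermite_biehler_neq0.
rewrite -ler_pdivrMr // -nrm_div -/(G z) le_max.
have [ze|ze] := ltP (nrm (z - 'i)) e; apply/orP; [left|right].
  by have := He z ze; have := nrm_sub (G z) (G 'i); lra.
rewrite /G nrm_div ler_pdivrMr // mulrAC ler_pdivlMr //.
apply: le_trans (snle z (ltW uz)); rewrite sn nrmM mulrC ler_wpM2r ?nrm_ge0 //.
Qed.
End KernelFunction.

Section LogarithmicGrowth.
Variable R : realType.
Local Notation C := R[i].
Implicit Types (x y t a b d : R) (B F G : C -> C) (z w : C).

Lemma starM F G z : star (fun z => F z * G z) z = star F z * star G z.
Proof. exact: conj_M. Qed.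

Lemma starX F m z : star (fun z => F z ^+ m) z = star F z ^+ m.
Proof. exact: rmorphXn. Qed.

Lemma derive1_isd F z : cdiff F z -> isd F z (derive1 F z).
Proof. by move=> /cdiffP/derivable_isd. Qed.

(* Integrates the logarithmic derivative of [|F|^2]. *)
Lemma log_growth F a b (N : R) : (forall z, cdiff F z) -> (forall z, cdiff (derive1 F) z) ->
  a < b -> (forall t, a < t -> t <= b -> F t%:C != 0) ->
  (forall s, a < s -> s <= b ->
     ru s b (fun t => (nrm (derive1 F t%:C) / nrm (F t%:C)) ^+ 2) <= N) ->
  F a%:C != 0.
Proof.
move=> dF dF' ab F0 FN; apply/eqP => Fa.
pose u t := nrm (F t%:C) ^+ 2.
pose v t := 2 * (Re (F t%:C) * Re (derive1 F t%:C) + Im (F t%:C) * Im (derive1 F t%:C)).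
have cF t : cont (fun s : R => F s%:C) t by apply: cont_real_line; exact: cdiff_cont.
have cF' t : cont (fun s : R => derive1 F s%:C) t by apply: cont_real_line; exact: cdiff_cont.
have dRe t : rderiv (fun s => F s%:C) t (derive1 F t%:C).
  have := @isd_rderiv _ F 0 1 (derive1 F t%:C) t.
  rewrite add0r !mul1r => /(_ (derive1_isd (dF _))).
  by under eq_fun do rewrite add0r mul1r.
have du t : is_derive t (1 : R) u (v t).
  have dR := rderiv_Re (dRe t); have dI := rderiv_Im (dRe t).
  have -> : u = (fun s => Re (F s%:C) * Re (F s%:C) + Im (F s%:C) * Im (F s%:C)).
    by apply/funext => s; rewrite /u nrm_sqr !expr2.
  apply: (is_derive_eq (is_deriveD (is_deriveM dR dR) (is_deriveM dI dI))).
  by rewrite /v /GRing.scale /=; ring.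
have u0 t : a < t -> t <= b -> 0 < u t by move=> h1 h2; rewrite exprn_gt0 // nrm_gt0 F0.
have cu_ : continuous u by move=> t; apply: continuousX2; exact: cont_nrm.
(* From 2 |F F'| <= |F|^2 + |F'|^2 the logarithmic derivative of |F|^2 is at most 1 + |F' / F|^2. *)
have key s : a < s -> s <= b -> ln (u b) - ln (u s) <= (b - s) + N.
  move=> s1 s2.
  pose w t := (nrm (derive1 F t%:C) / nrm (F t%:C)) ^+ 2.
  have in0 t : s <= t <= b -> 0 < u t by move=> /andP[t1 t2]; apply: u0 => //; exact: lt_le_trans t1.
  have cw : rcontI s b w.
    move=> t ht; apply: (@continuousX2 R (fun t => nrm (derive1 F t%:C) / nrm (F t%:C))).
    apply: continuousM; first exact: cont_nrm.
    apply: continuousV; last exact: cont_nrm.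
    by have := in0 t ht; rewrite /u => h; apply/eqP => h0; move: h; rewrite h0 expr0n /= ltxx.
  have cv : rcontI s b (fun t => (u t)^-1 * v t).
    move=> t ht; apply: continuousM; first by apply: continuousV (cu_ t); rewrite gt_eqF ?in0.
    apply: continuousM; first exact: cst_continuous.
    by apply: continuousD; apply: continuousM; (apply: cont_Re || apply: cont_Im); done.
  have <- : ru s b (fun t => (u t)^-1 * v t) = ln (u b) - ln (u s).
    apply: (@ru_FTC _ s b (fun t => ln (u t))) => // t ht.
    apply: (is_derive_eq (@is_derive1_comp _ (@ln R) u t _ _ (is_derive1_ln (in0 t ht)) (du t))).
    by [].
  apply: (@le_trans _ _ (ru s b (fun t => 1 + w t))).
    apply: ru_le => //.
      by move=> t ht; apply: continuousD; [exact: cst_continuous|exact: cw].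
    move=> t ht; have ut := in0 t ht; rewrite mulrC ler_pdivrMr //.
    have -> : (1 + w t) * u t = nrm (F t%:C) ^+ 2 + nrm (derive1 F t%:C) ^+ 2.
      rewrite /w /u; field; apply/eqP => h; move: ut; rewrite /u h expr0n /= ltxx //.
    rewrite !nrm_sqr /v.
    have := sqr_ge0 (Re (F t%:C) - Re (derive1 F t%:C)).
    have := sqr_ge0 (Im (F t%:C) - Im (derive1 F t%:C)); rewrite !expr2; lra.
  rewrite (ruD (@rcontI_cst _ s b 1) cw) ru_cst // mul1r lerD2l.
  exact: FN.
(* A positive lower bound for |F|^2 on (a, b], incompatible with continuity at the zero a. *)
pose c := u b * expR (- (b - a + N)).
have ub0 : 0 < u b by exact: u0.
have c0 : 0 < c by rewrite mulr_gt0 ?expR_gt0.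
have uc s : a < s -> s <= b -> c <= u s.
  move=> s1 s2; rewrite -(lnK (x := u s)) ?posrE ?u0 // /c -{1}(lnK (x := u b)) ?posrE //.
  by rewrite -expRD ler_expR; have := key s s1 s2; lra.
have c1 : 0 < Num.min 1 c by rewrite lt_min ltr01.
have [d d0 dP] := (nearR _ _).1 (cF a _ c1).
pose s := Num.min (a + d / 2) b.
have s1 : a < s by rewrite lt_min ab; lra.
have s2 : s <= b by rewrite ge_min lexx orbT.
have s3 : s <= a + d / 2 by rewrite ge_min lexx.
have sd : `|s - a| < d by rewrite ltr_norml; apply/andP; split; lra.
have := dP s sd; rewrite Fa subr0 lt_min => /andP[h1 h2].
have := uc s s1 s2; rewrite /u expr2; have := ler_wpM2l (nrm_ge0 (F s%:C)) (ltW h1); lra.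
Qed.
End LogarithmicGrowth.

Section NoRealZeros.
Variable R : realType.
Local Notation C := R[i].
Implicit Types (x y t a b d : R) (B F G : C -> C) (z w : C).

Lemma cdiff_derive1 F z : (forall z, cdiff F z) -> cdiff (derive1 F) z.
Proof. by move=> dF; apply: (@cdiff_deriv _ F); apply: filterE => w; exact: derive1_isd. Qed.

Theorem no_real_zero E m x : hermite_biehler E ->
  (forall F, de_Branges (fun z => E z ^+ m.+2) F ->
     de_Branges (fun z => E z ^+ m.+2) (derive1 F)) ->
  E x%:C != 0.
Proof.
move=> hE hD; apply/negP => /eqP /(last_zero hE)[a [b [ab Ea Eab]]].
have [k [c1 [c2 [c3 [c10 dk k1 k2 k3]]]]] := kernel_exists hE.
have dE z := hermite_biehler_cdiff hE z.
pose B z := E z ^+ m.+2; pose F z := E z ^+ m.+1 * k z.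
have dF z : cdiff F z by apply: cdiffM => //; exact: cdiffX.
have dB z : cdiff B z by exact: cdiffX.
have BE z : nrm (B z) = nrm (E z) ^+ m.+1 * nrm (E z) by rewrite nrmX exprSr.
have E0 z : 0 <= nrm (E z) ^+ m.+1 by rewrite exprn_ge0 ?nrm_ge0.
have kle z : chp z -> nrm (k z) <= c2 * nrm (E z).
  move=> cz; apply: le_trans (k2 z cz); rewrite ler_peMl ?nrm_ge0 //; exact: shift_i1.
have FB : de_Branges B F.
  apply: (@de_Branges_intro R B F c2 c3) => //.
  - by move=> z uz; rewrite expf_neq0 //; exact: hermite_biehler_neq0.
  - move=> z uz; rewrite nrmM nrmX BE mulrCA ler_wpM2l // kle //; exact: ltW.
  - move=> z uz; rewrite starM starX nrmM nrmX BE mulrCA.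
    apply: ler_pM; rewrite ?exprn_ge0 ?nrm_ge0 ?k3 //.
    by rewrite lerXn2r ?nnegrE ?nrm_ge0 // ltW // hermite_biehler_lt.
  pose g t : R := c2 ^+ 2 * (t ^+ 2 + 1 ^+ 2)^-1.
  have cg t : {for t, continuous g}.
    by apply: continuousM; [exact: cst_continuous|exact: continuous_poisson].
  have g0 t : 0 <= g t by rewrite mulr_ge0 ?sqr_ge0 // invr_ge0 addr_ge0 ?sqr_ge0.
  apply: (@le_lt_trans _ _ (\int[lebesgue_measure]_(t in setT) (g t)%:E)%E).
    apply: ge0_le_integral => //.
    - by move=> t _; rewrite lee_fin sqr_ge0.
    - exact: measurable_sqratio.
    - by apply/measurable_EFinP; exact: continuous_measurable_fun.
    (* Real zeros of E are still possible here; the quotient counts as 0 there. *)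
    move=> t _; rewrite lee_fin; have [Et|Et] := eqVneq (E t%:C) 0.
      by rewrite /B Et expr0n /= nrm0 invr0 mulr0 expr0n.
    have Et0 : 0 < nrm (E t%:C) by rewrite nrm_gt0.
    have t2 : 0 < t ^+ 2 + 1 ^+ 2 by rewrite ltr_wpDl ?sqr_ge0 // exprn_gt0.
    rewrite nrmM nrmX BE -mulf_div divff ?gt_eqF ?exprn_gt0 // mul1r expr_div_n.
    rewrite ler_pdivrMr ?exprn_gt0 // /g mulrAC ler_pdivlMr //.
    have h := k2 _ (chp_real t); have := nrm2_real_shift 1 t; rewrite mulr1 => <-.
    have h0 : 0 <= nrm (t%:C + 'i) * nrm (k t%:C) by rewrite mulr_ge0 ?nrm_ge0.
    rewrite -!exprMn [X in X ^+ 2 <= _]mulrC; apply: lerXn2r; rewrite ?nnegrE //.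
    exact: le_trans h.
  apply: (@le_lt_trans _ _ (c2 ^+ 2 * pi)%:E); last exact: ltry.
  apply: line_integral_le => // r r0; rewrite ruZ; last by move=> t _; exact: continuous_poisson.
  by rewrite ler_wpM2l ?sqr_ge0 //; have := @ru_poisson_le R 1 (- r) r ltr01; rewrite divr1.
have [_ fin _ _ _] := hD _ FB.
(* Bounds |t + i| on (a, b], so that |F / B| >= c1 / L there and F' / F is controlled by F' / B. *)
pose L := `|a| + `|b| + 2; have L0 : 0 < L by rewrite ltr_wpDl // addr_ge0.
have Lle t : a < t -> t <= b -> nrm (t%:C + 'i) <= L.
  move=> t1 t2; apply: le_trans (nrmD _ _) _; rewrite nrmR nrmi.
  have : `|t| <= `|a| + `|b|.
    by have := ler_norm b; have := ler_norm (- a); rewrite normrN ler_norml => h1 h2;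
      have := normr_ge0 a; have := normr_ge0 b => h3 h4; apply/andP; split; lra.
  rewrite /L; lra.
have kge t : a < t -> t <= b -> c1 * nrm (E t%:C) <= L * nrm (k t%:C).
  by move=> t1 t2; apply: le_trans (k1 _ (chp_real t)) _; rewrite ler_wpM2r ?nrm_ge0 ?Lle.
have kn t : a < t -> t <= b -> 0 < nrm (k t%:C).
  move=> t1 t2; have Et : 0 < c1 * nrm (E t%:C) by rewrite mulr_gt0 // nrm_gt0 Eab.
  by have := lt_le_trans Et (kge t t1 t2); rewrite pmulr_rgt0.
have Fab t : a < t -> t <= b -> F t%:C != 0.
  by move=> t1 t2; rewrite mulf_neq0 ?expf_neq0 ?Eab // -nrm_gt0 kn.
pose N := (L / c1) ^+ 2 * fine (sqnorm B (derive1 F)).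
suff H s : a < s -> s <= b ->
    ru s b (fun t => (nrm (derive1 F t%:C) / nrm (F t%:C)) ^+ 2) <= N.
  have := @log_growth R F a b N dF (fun z => cdiff_derive1 z dF) ab Fab H.
  by rewrite /F Ea expr0n /= mul0r eqxx.
move=> s1 s2.
pose w t := (nrm (derive1 F t%:C) / nrm (B t%:C)) ^+ 2.
have cn G t : (forall z, cdiff G z) -> {for t, continuous (fun s : R => nrm (G s%:C))}.
  by move=> dG; apply: cont_nrm; apply: cont_real_line; exact: cdiff_cont.
have cq G t : (forall z, cdiff G z) -> G t%:C != 0 ->
    {for t, continuous (fun t : R => (nrm (derive1 F t%:C) / nrm (G t%:C)) ^+ 2)}.
  move=> dG Gt; apply: (@continuousX2 R (fun t => nrm (derive1 F t%:C) / nrm (G t%:C))).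
  apply: continuousM; first by apply: cn => z; exact: cdiff_derive1.
  by apply: continuousV (cn _ _ dG); rewrite nrm_eq0.
have in1 t : s <= t <= b -> a < t /\ t <= b by move=> /andP[t1 t2]; split => //; lra.
have cw : rcontI s b w.
  by move=> t /in1[t1 t2]; apply: (cq B) => //; rewrite expf_neq0 ?Eab.
apply: (@le_trans _ _ (ru s b (fun t => (L / c1) ^+ 2 * w t))).
  apply: ru_le.
  - by move=> t /in1[t1 t2]; apply: (cq F) => //; exact: Fab.
  - by move=> t ht; apply: continuousM; [exact: cst_continuous|exact: cw].
  move=> t /in1[t1 t2]; rewrite /w -exprMn lerXn2r ?nnegrE ?mulr_ge0 ?invr_ge0 ?nrm_ge0 ?(ltW L0) ?(ltW c10) //.
  have Bt : 0 < nrm (B t%:C) by rewrite nrm_gt0 expf_neq0 ?Eab.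
  have Ft : 0 < nrm (F t%:C) by rewrite nrm_gt0 Fab.
  have BF : c1 * nrm (B t%:C) <= L * nrm (F t%:C).
    by rewrite BE /F nrmM nrmX !(mulrCA _ (nrm (E t%:C) ^+ m.+1)) ler_wpM2l // kge.
  rewrite ler_pdivrMr //.
  have -> : L / c1 * (nrm (derive1 F t%:C) / nrm (B t%:C)) * nrm (F t%:C) =
      nrm (derive1 F t%:C) * (L * nrm (F t%:C) / (c1 * nrm (B t%:C))).
    by field; rewrite !gt_eqF.
  by rewrite ler_peMr ?nrm_ge0 // ler_pdivlMr ?mul1r // mulr_gt0.
rewrite (ruZ _ cw) ler_wpM2l ?sqr_ge0 //; apply: line_integral_ge => //.
  by move=> t; exact: sqr_ge0.
apply/measurable_EFinP; apply: measurable_sqratio => // z; exact: cdiff_derive1.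
Qed.
End NoRealZeros.

(** * The test function and the phase *)

Section InnerDerivative.
Variable R : realType.
Local Notation C := R[i].
Implicit Types (x y t a b d c : R) (B F G : C -> C) (z w : C).

Lemma Re_unit_le w : nrm w = 1 -> Re w <= 1.
Proof. by move=> w1; apply: le_trans (ler_norm _) _; rewrite -w1 Re_le_nrm. Qed.

(** On the line Re f <= 1 = f(0), so the real part of the derivative cannot be positive in either
    direction. *)
Lemma unit_isd f l : (forall t, nrm (f t%:C) = 1) -> f 0 = 1 -> isd f 0 l -> Re l = 0.
Proof.
move=> f1 f0 /isd_eps H; apply/eqP; rewrite -normr_eq0 eq_le normr_ge0 andbT.
apply/ler_addgt0Pr => e e0; rewrite add0r; have [d d0 dP] := H e e0.
have key (s : R) : `|s| = 1 -> s * Re l <= e.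
  move=> s1; pose h := d / 2; have h0 : 0 < h by rewrite divr_gt0.
  have hs : nrm ((s * h)%:C - 0 : C) = h by rewrite subr0 nrmR normrM s1 mul1r gtr0_norm.
  have hd : nrm ((s * h)%:C - 0 : C) < d by rewrite hs /h; lra.
  have := dP _ hd; rewrite hs f0 subr0 => h1.
  have h2 := le_trans (Re_le_nrm _) h1; rewrite !ReIm /= mulr0 subr0 ler_norml in h2.
  have h3 := Re_unit_le (f1 (s * h)); case/andP: h2 => h2 _.
  rewrite -(ler_pM2r h0); lra.
by rewrite ler_norml lerNl -mulN1r -{2}[Re l]mul1r !key // ?normrN normr1.
Qed.

Lemma inner_isd B x : hb B -> exists tau : R, isd (inner B x) 0 ('i * tau%:C).
Proof.
move=> hB; have [l dl] := nbhs_singleton (inner_cdiff hB x (chp_real 0)).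
exists (Im l); have -> : 'i * (Im l)%:C = l; last exact: dl.
have := unit_isd (inner_unit hB x) (inner0 hB x) dl.
by case: l {dl} => p q /= ->; apply: complex_eqP; rewrite !ReIm /=; ring.
Qed.

(** The gap of width 2 d around x contributes at most 2 K d, so bounds for truncated integrals pass
    to the whole line. *)
Lemma line_integral_punct (u : R -> R) x (K X : R) : (forall t, 0 <= u t) -> (forall t, u t <= K) ->
  continuous u -> (forall d r : R, 0 < d -> d <= r -> rpunct (fun s => u (x + s)) d r <= X) ->
  (\int[lebesgue_measure]_(t in [set: R]) (u t)%:E <= X%:E)%E.
Proof.
move=> u0 uK cu_ H; apply: line_integral_le => // r r0.
pose v s := u (x + s).
have cv s : {for s, continuous v}.
  by apply: (@continuous_comp _ _ _ (fun t => x + t) u) (cu_ _);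
    apply: continuousD; [exact: cst_continuous|exact: cvg_id].
pose r' := r + `|x|; have r'0 : 0 < r' by rewrite ltr_pwDl.
have xr : - `|x| <= x <= `|x| by rewrite -ler_norml.
apply: (@le_trans _ _ (ru (x - r') (x + r') u)).
  have cI a b : rcontI a b u by move=> t _; exact: cu_.
  case/andP: xr => x1 x2; have i1 : x - r' <= - r by rewrite /r'; lra.
  have i2 : r <= x + r' by rewrite /r'; lra.
  rewrite (ru_chasles i1 _ (cI _ _)); last lra.
  rewrite (@ru_chasles _ (- r) r (x + r')) //; last lra.
  have p1 := @ru_ge0 _ (x - r') (- r) u (fun t _ => u0 t).
  have p2 := @ru_ge0 _ r (x + r') u (fun t _ => u0 t); lra.
rewrite -(ru_shift x cu_); last lra.
have K0 : 0 <= K by exact: le_trans (u0 0) (uK 0).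
apply/ler_addgt0Pr => e e0; have K1 : 0 < 2 * K + 1 by lra.
pose d := Num.min r' (e / (2 * K + 1)).
have d0 : 0 < d by rewrite lt_min r'0 divr_gt0.
have dr : d <= r' by rewrite ge_min lexx.
have de : d * (2 * K + 1) <= e by rewrite -ler_pdivlMr // ge_min lexx orbT.
have cI a b : rcontI a b v by move=> t _; exact: cv.
rewrite (@ru_chasles _ (- r') (- d) r') //; [|lra|lra].
rewrite (@ru_chasles _ (- d) d r') //; [|lra].
have := H d r' d0 dr; rewrite /rpunct => h.
have h2 : ru (- d) d v <= K * (d - - d).
  rewrite -ru_cst; last lra.
  by apply: ru_le; [exact: cI|exact: rcontI_cst|move=> s _; exact: uK].
rewrite -/v; lra.
Qed.
End InnerDerivative.

(** * The extremal test function *)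

Section TestFactor.
Variable R : realType.
Local Notation C := R[i].
Implicit Types (x y t a b d c : R) (B F G : C -> C) (z w : C).
Variable E : C -> C.
Hypothesis hE : hb E.
Variables (x tau : R).
Hypothesis dT : isd (inner E x) 0 ('i * tau%:C).

Let beta := (E x%:C)^*.

Lemma test_factor : exists S q (M : R),
  [/\ (forall z, cdiff S z) /\ (forall z, cdiff q z), forall z, S z = (z - x%:C) * q z,
    forall z, star S z = S z, q x%:C = beta * E x%:C * tau%:C &
    (forall z, chp z -> nrm (S z) = nrm beta * nrm (E z) * nrm (1 - inner E x (z - x%:C))) /\
    (forall z, chp z -> nrm (q z) <= M * nrm (E z))].
Proof.
have dE z : cdiff E z by exact: hb_cdiff.
have dsE z : cdiff (star E) z by exact: cdiff_star.
pose S z := 'i * (beta * E z - beta^* * star E z).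
have dS z : cdiff S z.
  apply: cdiffM; first exact: cdiff_cst.
  by apply: cdiffB; apply: cdiffM => //; exact: cdiff_cst.
have Sx : S x%:C = 0 by rewrite /S star_real /beta conjCK mulrC [X in X - _]mulrC subrr mul0r.
have [q [Sq dq]] : exists q, (forall z, S z = (z - x%:C) * q z) /\ forall z, cdiff q z.
  have [|q [Sq dq]] := @quotient0 _ S x%:C _ Sx; first exact: filterE.
  by exists q; split => // z; exact: dq.
have E0 z : chp z -> E z != 0 by exact: hb_neq0.
have bn : beta != 0 by rewrite -nrm_eq0 nrm_conj nrm_eq0 E0 // chp_real.
have Ex : E x%:C != 0 by rewrite E0 // chp_real.
(* In this form both |S / E| and the derivative at x are expressed by T. *)
have SE z : E z != 0 -> S z = 'i * beta * (E z * (1 - inner E x (z - x%:C))).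
  by move=> Ez; rewrite /S /inner subrK /beta conjCK; field; rewrite Ez bn.
have SN z : chp z -> nrm (S z) = nrm beta * nrm (E z) * nrm (1 - inner E x (z - x%:C)).
  by move=> cz; rewrite SE ?E0 // !nrmM nrmi mul1r mulrA.
have qx : q x%:C = beta * E x%:C * tau%:C.
  have d1 : isd S x%:C (q x%:C).
    by exists q; split=> [|w|//]; [exact: cdiff_cont|rewrite Sx add0r].
  have [l dl] := dE x%:C.
  have dI : isd (fun z => inner E x (z - x%:C)) x%:C ('i * tau%:C).
    have h : isd (fun z => z - x%:C) x%:C (1 - 0) by apply: isdB; [exact: isd_id|exact: isd_cst].
    have := @isd_comp _ (fun z => z - x%:C) (inner E x) x%:C _ ('i * tau%:C) h.
    by rewrite subrr subr0 mulr1; apply.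
  have d2 : isd S x%:C ('i * beta * (E x%:C * - ('i * tau%:C))).
    have h := isdM (isd_cst ('i * beta) x%:C) (isdM dl (isdB (isd_cst 1 x%:C) dI)).
    have {}h : isd (fun z => 'i * beta * (E z * (1 - inner E x (z - x%:C)))) x%:C
        ('i * beta * (E x%:C * - ('i * tau%:C))).
      by move: h; rewrite subrr (inner0 hE); congr isd; ring.
    apply: isd_near h; apply: filterS (hb_near hE (chp_real x)) => z Ez.
    by rewrite SE.
  rewrite (isd_unique d1 d2); transitivity (- ('i ^+ 2) * (beta * E x%:C * tau%:C)); first ring.
  by rewrite sqr_i opprK mul1r.
have cG : cont (fun z => q z / E z) x%:C by apply: cdiff_cont; exact: cdiff_div.
have [e e0 He] := (nearC _ _).1 (cG 1 ltr01).
(* Near x continuity bounds q / E; at distance at least e, |S| <= 2 |beta| |E| is divided by e. *)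
exists S, q, (Num.max (nrm (q x%:C / E x%:C) + 1) (2 * nrm beta / e)); split => //.
  move=> z; rewrite /star /S conj_M conj_B !conj_M !conjCK.
  have -> : ('i : C)^* = - 'i by apply: complex_eqP => //=; rewrite oppr0.
  by rewrite /star; ring.
split => // z cz; have Ez : 0 < nrm (E z) by rewrite nrm_gt0 E0.
rewrite -ler_pdivrMr // -nrm_div le_max.
have [ze|ze] := ltP (nrm (z - x%:C)) e; apply/orP; [left|right].
  by have := He z ze; have := nrm_sub (q z / E z) (q x%:C / E x%:C); lra.
rewrite nrm_div ler_pdivrMr // mulrAC ler_pdivlMr //.
apply: (@le_trans _ _ (nrm (S z))); first by rewrite Sq nrmM mulrC ler_wpM2r ?nrm_ge0.
have czx : chp (z - x%:C) by rewrite /chp !ReIm /= subr0.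
have h2 : nrm (1 - inner E x (z - x%:C)) <= 2.
  by apply: le_trans (nrmB _ _) _; rewrite nrm1; have := inner_le1 hE x czx; lra.
rewrite SN // (_ : 2 * nrm beta * nrm (E z) = nrm beta * nrm (E z) * 2); last ring.
by rewrite ler_wpM2l // mulr_ge0 ?nrm_ge0.
Qed.
End TestFactor.

Section TestFunction.
Variable R : realType.
Local Notation C := R[i].
Implicit Types (x y t a b d c : R) (B F G : C -> C) (z w : C).

Lemma test_function E m x tau c : hb E -> isd (inner E x) 0 ('i * tau%:C) ->
  exists F, [/\ de_Branges (fun z => E z ^+ m.+2) F,
    (sqnorm (fun z => (E z ^+ m.+2)%R) F <= (c ^+ 2 * nrm (E x%:C) ^+ 4 * (8 * pi * tau))%:E)%E &
    nrm (derive1 F x%:C) = `|c| * nrm (E x%:C) ^+ m.+4 * tau ^+ 2].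
Proof.
move=> hE dT; have [S [q [M [[dS dq] Sq sS qx [SN qM]]]]] := test_factor hE dT.
set beta := (E x%:C)^* in qx SN; have bE : nrm beta = nrm (E x%:C) by exact: nrm_conj.
have dE z : cdiff E z by exact: hb_cdiff.
have E0 z : chp z -> 0 < nrm (E z) by move=> cz; rewrite nrm_gt0 (hb_neq0 hE).
pose B z := E z ^+ m.+2; pose H z := c%:C * E z ^+ m * q z ^+ 2.
pose F z := c%:C * E z ^+ m * S z * q z.
have dH z : cdiff H z.
  by apply: cdiffM; [apply: cdiffM; [exact: cdiff_cst|exact: cdiffX]|exact: cdiffX].
have FH z : F z = (z - x%:C) * H z by rewrite /F /H Sq; ring.
have dB z : cdiff B z by exact: cdiffX.
have dF z : cdiff F z.
  apply: cdiffM => //; apply: cdiffM => //; apply: cdiffM; [exact: cdiff_cst|exact: cdiffX].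
have dFx : isd F x%:C (H x%:C).
  exists H; split=> [|w|//]; first exact: cdiff_cont.
  by rewrite [F x%:C]FH subrr mul0r add0r FH.
have BE z : nrm (B z) = nrm (E z) ^+ m * nrm (E z) ^+ 2 by rewrite nrmX -exprD addn2.
have T2 z : chp z -> nrm (1 - inner E x (z - x%:C)) <= 2.
  move=> cz; apply: le_trans (nrmB _ _) _; rewrite nrm1.
  have czx : chp (z - x%:C) by rewrite /chp !ReIm /= subr0.
  by have := inner_le1 hE x czx; lra.
pose K := `|c| * (2 * nrm beta * M).
have SM z : chp z -> nrm (S z) <= 2 * nrm beta * nrm (E z).
  move=> cz; rewrite SN // (_ : 2 * nrm beta * nrm (E z) = nrm beta * nrm (E z) * 2); last ring.
  by rewrite ler_wpM2l ?T2 // mulr_ge0 ?nrm_ge0.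
have SqM z : chp z -> nrm (S z) * nrm (q z) <= 2 * nrm beta * M * nrm (E z) ^+ 2.
  move=> cz; have -> : 2 * nrm beta * M * nrm (E z) ^+ 2 = 2 * nrm beta * nrm (E z) * (M * nrm (E z)) by ring.
  by apply: ler_pM; rewrite ?nrm_ge0 ?SM ?qM.
have FM z : chp z -> nrm (F z) <= K * nrm (B z).
  move=> cz; rewrite BE /F !nrmM nrmR nrmX /K.
  have -> : `|c| * nrm (E z) ^+ m * nrm (S z) * nrm (q z) = `|c| * (nrm (E z) ^+ m * (nrm (S z) * nrm (q z))) by ring.
  have -> : `|c| * (2 * nrm beta * M) * (nrm (E z) ^+ m * nrm (E z) ^+ 2) =
    `|c| * (nrm (E z) ^+ m * (2 * nrm beta * M * nrm (E z) ^+ 2)) by ring.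
  by rewrite !ler_wpM2l ?exprn_ge0 ?nrm_ge0 ?SqM.
have sq z : uhp z -> star q z = q z.
  move=> uz; have zx : z - x%:C != 0.
    by apply/eqP => h; move: uz; rewrite /uhp -(subrK x%:C z) h add0r /= ltxx.
  apply: (mulfI zx); rewrite -Sq -sS /star Sq conj_M.
  by congr (_ * _); case: z {uz zx} => z1 z2; apply: complex_eqP; rewrite !ReIm /=; ring.
have sFM z : uhp z -> nrm (star F z) <= K * nrm (B z).
  move=> uz; have cz : chp z by exact: ltW.
  have -> : star F z = c%:C * star E z ^+ m * S z * q z.
    rewrite -(sq z uz) -(sS z) -starX.
    by rewrite /F {1}/star !conj_M conj_real.
  apply: le_trans (FM z cz); rewrite /F !nrmM !nrmX.
  do 2 (apply: ler_wpM2r; first exact: nrm_ge0); apply: ler_wpM2l; first exact: nrm_ge0.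
  by rewrite lerXn2r ?nnegrE ?nrm_ge0 // (hb_le hE).
pose u t := (nrm (F t%:C) / nrm (B t%:C)) ^+ 2.
pose X := c ^+ 2 * nrm (E x%:C) ^+ 4 * (8 * pi * tau).
have B0 z : chp z -> 0 < nrm (B z) by move=> cz; rewrite nrmX exprn_gt0 // E0.
have K0 : 0 <= K.
  have := le_trans (nrm_ge0 _) (FM _ (chp_real 0)).
  by rewrite pmulr_lge0 // B0 // chp_real.
have cn G t : (forall z, cdiff G z) -> {for t, continuous (fun s : R => nrm (G s%:C))}.
  by move=> dG; apply: cont_nrm; apply: cont_real_line; exact: cdiff_cont.
have cu_ t : {for t, continuous u}.
  apply: (@continuousX2 R (fun t => nrm (F t%:C) / nrm (B t%:C))).
  apply: continuousM; first exact: cn.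
  by apply: continuousV (cn _ _ dB); rewrite gt_eqF // B0 // chp_real.
have bound : (sqnorm B F <= X%:E)%E.
  apply: (@line_integral_punct R u x (K ^+ 2)) => //.
  - by move=> t; exact: sqr_ge0.
  - move=> t; rewrite lerXn2r ?nnegrE ?divr_ge0 ?nrm_ge0 //.
    by rewrite ler_pdivrMr ?FM ?B0 ?chp_real.
  move=> d r d0 dr.
  have hS := inner_integral (inner_cdiff hE x) (inner_le1 hE x) (inner_unit hE x) (inner0 hE x) dT d0 dr.
  pose v t := nrm (1 - inner E x t%:C) ^+ 2 / t ^+ 2.
  have cT t : cont (fun s : R => inner E x s%:C) t.
    apply: cont_real_line; apply: cdiff_cont.
    exact: (nbhs_singleton (inner_cdiff hE x (chp_real t))).
  have cv : rcont_off0 v.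
    move=> t t0; apply: continuousM.
      by apply: continuousX2; apply: cont_nrm; apply: contB => //; exact: cont_cst.
    by apply: continuousV; [rewrite expf_neq0|exact: exprn_continuous].
  (* With A = |1 - T(s)|, |F / B|^2 is c^2 |E(x)|^4 A^4 / s^2. Bounding one A^2 by 4 leaves the
     integrand of [inner_integral], whence 8 pi tau = 4 times 2 pi tau. *)
  pose k := 4 * (c ^+ 2 * nrm (E x%:C) ^+ 4).
  apply: (@le_trans _ _ (rpunct (fun t => k * v t) d r)).
    apply: (@rpunct_le _ _ _ d r d0).
    - move=> t _; apply: (@continuous_comp _ _ _ (fun t => x + t) u) (cu_ _).
      by apply: continuousD; [exact: cst_continuous|exact: cvg_id].
    - exact: rcont_off0Z.
    move=> s s0; have cz := chp_real (x + s); rewrite /u /v.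
    set z := (x + s)%:C in cz *; have zs : z - x%:C = s%:C by rewrite /z rmorphD; ring.
    set A := nrm (1 - inner E x s%:C).
    have s1 : 0 < `|s| by rewrite normr_gt0.
    have SA : nrm (S z) = nrm (E x%:C) * nrm (E z) * A by rewrite SN // zs bE.
    have qA : nrm (q z) = nrm (S z) / `|s|.
      by rewrite Sq zs nrmM nrmR mulrC mulKf ?gt_eqF.
    have -> : nrm (F z) / nrm (B z) = `|c| * (nrm (E x%:C) ^+ 2 * (A ^+ 2 / `|s|)).
      rewrite BE /F !nrmM nrmR nrmX qA SA; field.
      have Ez : nrm (E z) != 0 by rewrite gt_eqF ?E0.
      by rewrite expf_neq0 Ez ?gt_eqF.
    have A2 : A <= 2 by have := T2 z cz; rewrite zs.
    have A0 : 0 <= A by exact: nrm_ge0.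
    have -> : (`|c| * (nrm (E x%:C) ^+ 2 * (A ^+ 2 / `|s|))) ^+ 2 =
        `|c| ^+ 2 * nrm (E x%:C) ^+ 4 * (A ^+ 2 * (A ^+ 2 / `|s| ^+ 2)).
      by field; rewrite gt_eqF.
    rewrite !real_normK ?num_real // /k.
    have -> : 4 * (c ^+ 2 * nrm (E x%:C) ^+ 4) * (A ^+ 2 / s ^+ 2) =
        c ^+ 2 * nrm (E x%:C) ^+ 4 * (4 * (A ^+ 2 / s ^+ 2)) by ring.
    apply: ler_wpM2l; first by rewrite mulr_ge0 ?sqr_ge0 ?exprn_ge0 ?nrm_ge0.
    apply: ler_wpM2r; first by rewrite divr_ge0 ?sqr_ge0.
    have := ler_pM A0 A0 A2 A2; rewrite expr2; lra.
  rewrite (rpunctZ k r cv d0) /X /k.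
  have -> : c ^+ 2 * nrm (E x%:C) ^+ 4 * (8 * pi * tau) =
     4 * (c ^+ 2 * nrm (E x%:C) ^+ 4) * (2 * pi * tau) by ring.
  by rewrite ler_wpM2l ?hS // mulr_ge0 // mulr_ge0 ?sqr_ge0 // exprn_ge0 ?nrm_ge0.
exists F; split.
- apply: (@de_Branges_intro R B F K K) => //.
  + by move=> z uz; rewrite -nrm_gt0 B0 //; exact: ltW.
  + by move=> z uz; apply: FM; exact: ltW.
  + by apply: le_lt_trans bound _; exact: ltry.
- exact: bound.
rewrite (isd_unique (derive1_isd (dF _)) dFx) /H qx.
rewrite -(real_normK (num_real tau)) !(nrmM, nrmX, nrmR) bE !exprS; ring.
Qed.
End TestFunction.

(** * The bound for tau *)

Section MainBound.
Variable R : realType.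
Local Notation C := R[i].
Implicit Types (x y t a b d c : R) (B E F G : C -> C) (z w : C).

Lemma hermite_biehler_hb E : hermite_biehler E -> (forall x, E x%:C != 0) -> hb E.
Proof.
move=> hE E0; split=> [z|z|z]; first exact: hermite_biehler_cdiff.
  rewrite /chp le_eqVlt => /predU1P[z0|z0]; last exact: hermite_biehler_neq0.
  by have -> : z = (Re z)%:C by apply: complex_eqP.
exact: hermite_biehler_le.
Qed.

Lemma hbX E n : hb E -> hb (fun z => E z ^+ n).
Proof.
move=> hE; split=> z; first by apply: cdiffX; exact: hb_cdiff.
  by move=> cz; rewrite expf_neq0 // (hb_neq0 hE).
by move=> cz; rewrite starX !nrmX lerXn2r ?nnegrE ?nrm_ge0 // (hb_le hE).
Qed.

Lemma innerX E n x z : inner (fun z => E z ^+ n) x z = inner E x z ^+ n.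
Proof. by rewrite /inner starX exprMn !exprMn !exprVn rmorphXn. Qed.

(** The power multiplies the derivative at 0 by n; this is how nu enters the kernel inequality and,
    after a square root, the final bound. *)
Lemma isd_innerX E n x tau : hb E -> isd (inner E x) 0 ('i * tau%:C) ->
  isd (inner (fun z => E z ^+ n) x) 0 ('i * (n%:R * tau)%:C).
Proof.
move=> hE dT; have h := isdX n dT; rewrite (inner0 hE) expr1n mulr1 in h.
have -> : 'i * (n%:R * tau)%:C = n%:R * ('i * tau%:C) :> C.
  by rewrite rmorphM rmorph_nat; ring.
by apply: isd_near h; apply: filterE => z; rewrite innerX.
Qed.

Lemma differentiation_norm_ub B F (D : R) : bounded_differentiation B ->
  D = differentiation_norm B -> de_Branges B F -> (sqnorm B F <= 1)%E ->
  dB_norm B (derive1 F) <= D.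
Proof.
move=> [_ [M HM]] -> bF F1; apply: ub_le_sup.
  (* Boundedness of differentiation makes the set bounded above, without which its supremum would be
     a default value. *)
  exists `|M| => _ [G [bG G1] <-]; apply: le_trans (HM G bG) _.
  apply: (@le_trans _ _ (`|M| * dB_norm B G)); first by rewrite ler_wpM2r ?sqrtr_ge0 ?ler_norm.
  by rewrite ler_piMr.
exists F => //; split => //; rewrite /dB_norm -[leRHS]sqrtr1 ler_wsqrtr //.
have := @fine_le R (sqnorm B F) 1%E; apply => //.
rewrite ge0_fin_numE; first by case: bF.
by apply: integral_ge0 => t _; rewrite lee_fin sqr_ge0.
Qed.

Theorem inner_derivative_le E m x tau (D : R) : hb E ->
  bounded_differentiation (fun z => E z ^+ m.+2) ->
  D = differentiation_norm (fun z => E z ^+ m.+2) ->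
  isd (inner E x) 0 ('i * tau%:C) -> tau <= 2 * (D * Num.sqrt m.+2%:R).
Proof.
move=> hE hbdd hD dT; pose B z := E z ^+ m.+2.
have hB : hb B by exact: hbX.
(* The test function with c = 0 supplies a member of the unit ball. *)
have D0 : 0 <= D.
  have [F [bF F1 _]] := test_function m 0 hE dT.
  apply: le_trans (differentiation_norm_ub hbdd hD bF _); first exact: sqrtr_ge0.
  by apply: le_trans F1 _; rewrite lee_fin expr0n /= !mul0r ler01.
have [t0|t0] := leP tau 0.
  by apply: le_trans t0 _; rewrite mulr_ge0 // mulr_ge0 // sqrtr_ge0.
pose e := nrm (E x%:C); have e0 : 0 < e by rewrite nrm_gt0 (hb_neq0 hE) // chp_real.
have p0 : 0 < pi :> R by exact: pi_gt0.
pose s := 8 * pi * tau; have s0 : 0 < s by rewrite !mulr_gt0.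
(* Makes the bound c^2 |E(x)|^4 8 pi tau on the squared norm equal to 1. *)
pose c := (e ^+ 2 * Num.sqrt s)^-1.
have c2 : c ^+ 2 = (e ^+ 4 * s)^-1.
  by rewrite exprVn exprMn sqr_sqrtr ?(ltW s0) // -exprM.
have [F [bF F1 F'x]] := test_function m c hE dT.
have F1' : (sqnorm B F <= 1)%E.
  by apply: le_trans F1 _; rewrite lee_fin c2 -mulrA mulVf // mulf_neq0 ?expf_neq0 ?gt_eqF.
have ND := differentiation_norm_ub hbdd hD bF F1'.
have bF' : de_Branges B (derive1 F) by case: hbdd => h _; exact: h.
have N2 : fine (sqnorm B (derive1 F)) <= D ^+ 2.
  have N0 : 0 <= fine (sqnorm B (derive1 F)).
    by apply: fine_ge0; apply: integral_ge0 => t _; rewrite lee_fin sqr_ge0.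
  by rewrite -(sqr_sqrtr N0) lerXn2r ?nnegrE ?sqrtr_ge0.
have := evaluation_bound hB bF' (isd_innerX m.+2 hE dT).
rewrite F'x -/e /B nrmX -/e => H.
have n0 : 0 < m.+2%:R :> R by rewrite ltr0n.
have em : 0 < e ^+ m by exact: exprn_gt0.
have H2 : (2 * pi * (`|c| * e ^+ m.+4 * tau ^+ 2)) ^+ 2 <=
    (e ^+ m.+2) ^+ 2 * (D ^+ 2 * (2 * pi * (m.+2%:R * tau))).
  apply: le_trans H _; rewrite ler_wpM2l ?sqr_ge0 // ler_wpM2r // !mulr_ge0 // ltW //.
have EL : (2 * pi * (`|c| * e ^+ m.+4 * tau ^+ 2)) ^+ 2 = (e ^+ m.+2) ^+ 2 * (pi / 2 * tau ^+ 3).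
  have -> : (2 * pi * (`|c| * e ^+ m.+4 * tau ^+ 2)) ^+ 2 =
      4 * pi ^+ 2 * `|c| ^+ 2 * (e ^+ m.+4) ^+ 2 * tau ^+ 4 by ring.
  rewrite real_normK ?num_real // c2 /s.
  have aux (p : R) : p != 0 -> 4 * p ^+ 2 * (e ^+ 4 * (8 * p * tau))^-1 * (e ^+ m.+4) ^+ 2 * tau ^+ 4
      = (e ^+ m.+2) ^+ 2 * (p / 2 * tau ^+ 3).
    by move=> pn; rewrite !exprS; field; rewrite pn !gt_eqF.
  by apply: aux; rewrite gt_eqF.
move: H2; rewrite EL ler_pM2l ?exprn_gt0 // => H2.
have H3 : tau ^+ 2 <= 4 * (m.+2%:R * D ^+ 2).
  have : (pi / 2 * tau) * tau ^+ 2 <= (pi / 2 * tau) * (4 * (m.+2%:R * D ^+ 2)).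
    have -> : (pi / 2 * tau) * tau ^+ 2 = pi / 2 * tau ^+ 3 by ring.
    by apply: le_trans H2 _; lra.
  by rewrite ler_pM2l // mulr_gt0 // divr_gt0.
rewrite -(@ler_pXn2r _ 2) ?nnegrE ?(ltW t0) ?mulr_ge0 ?sqrtr_ge0 //.
by rewrite !exprMn sqr_sqrtr ?(ltW n0) //; lra.
Qed.
End MainBound.

(** * The phase derivative *)

Section PhaseAndZeros.
Variable R : realType.
Local Notation C := R[i].
Implicit Types (x y t d c : R) (B E F G : C -> C) (z w : C).

(** Complex derivatives can be compared through real increments alone, which is needed because the
    phase identity is known only on the line. *)
Lemma isd_unique_real F G t (a b : C) : isd F t%:C a -> isd G t%:C b ->
  (forall s : R, F s%:C = G s%:C) -> a = b.
Proof.
move=> /isd_eps hF /isd_eps hG FG; apply/eqP; rewrite -subr_eq0 -nrm_eq0 eq_le nrm_ge0 andbT.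
apply/ler_addgt0Pr => e e0; rewrite add0r; have e20 : 0 < e / 2 by rewrite divr_gt0.
have [d1 d10 H1] := hF _ e20; have [d2 d20 H2] := hG _ e20.
pose h := Num.min d1 d2 / 2; have m0 : 0 < Num.min d1 d2 by rewrite lt_min d10.
have h0 : 0 < h by rewrite divr_gt0.
have E : (t + h)%:C - t%:C = h%:C :> C by rewrite rmorphD; ring.
have nh : nrm (h%:C : C) = h by rewrite nrmR gtr0_norm.
have [m1 m2] : h < d1 /\ h < d2.
  have : Num.min d1 d2 <= d1 by rewrite ge_min lexx.
  have : Num.min d1 d2 <= d2 by rewrite ge_min lexx orbT.
  by rewrite /h; split; lra.
have := H1 (t + h)%:C; rewrite E nh => /(_ m1) k1.
have := H2 (t + h)%:C; rewrite E nh => /(_ m2) k2.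
rewrite -!FG in k2; rewrite -(ler_pM2r h0) -{1}nh -nrmM.
have -> : (a - b) * h%:C = (F (t + h)%:C - F t%:C - b * h%:C) - (F (t + h)%:C - F t%:C - a * h%:C) by ring.
apply: le_trans (nrmB _ _) _; lra.
Qed.

Lemma phase_derivative E phi x tau : hb E -> is_phase E phi ->
  isd (inner E x) 0 ('i * tau%:C) -> derive1 phi x%:C = (tau / 2)%:C.
Proof.
move=> hE [[U [oU Ux hU]] ph] dT; set l := derive1 phi x%:C.
have dphi : isd phi x%:C l by apply: derivable_isd; apply: hU.
have i0 : 'i != 0 :> C by rewrite -nrm_gt0 nrmi.
(* As exp(i phi) E is real, it equals its conjugate exp(-i phi) conj(E). *)
have unit t : (E t%:C)^* / E t%:C = expC (2%:R * 'i * phi t%:C).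
  have [pr Er] := ph t; have Et : E t%:C != 0 by rewrite (hb_neq0 hE) // chp_real.
  set u := (_ +i* _) in Er.
  have uE : u = expC ('i * phi t%:C).
    have r1 : Re ('i * phi t%:C) = 0 by rewrite !ReIm pr /=; ring.
    have r2 : Im ('i * phi t%:C) = Re (phi t%:C) by rewrite !ReIm pr /=; ring.
    by rewrite /expC r1 r2 expR0 mul1r.
  have u0 : u != 0 by rewrite uE expC_neq0.
  have u1 : u * u^* = 1.
    by rewrite mul_conj_nrm uE nrm_expC (_ : Re _ = 0) ?expR0 ?expr1n // !ReIm pr /=; ring.
  have wE : (u * E t%:C)^* = u * E t%:C.
    by apply: complex_eqP; case: (u * E t%:C) Er => p q //= ->; rewrite oppr0.
  have -> : 2%:R * 'i * phi t%:C = 'i * phi t%:C + 'i * phi t%:C by ring.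
  rewrite expCD -uE; apply: (canLR (mulfK Et)); rewrite -mulrA -wE conj_M mulrA u1 mul1r.
  by [].
have dG : isd (fun z => expC (2%:R * 'i * (phi (z + x%:C) - phi x%:C))) 0 (2%:R * 'i * l).
  have h0 : isd (fun z => z + x%:C) 0 (1 + 0) by apply: isdD; [exact: isd_id|exact: isd_cst].
  have h1 : isd (fun z => phi (z + x%:C)) 0 (l * (1 + 0)).
    by apply: (@isd_comp _ (fun z => z + x%:C) phi 0 _ l h0); rewrite add0r.
  have h2 := isdM (isd_cst (2%:R * 'i) 0) (isdB h1 (isd_cst (phi x%:C) 0)).
  have := isd_comp h2 (isd_expC _).
  by rewrite add0r subrr mulr0 expC0; congr isd; ring.
have := isd_unique_real (t := 0) dT dG _ => h.
have {}h : 'i * tau%:C = 2%:R * 'i * l.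
  apply: h => s; rewrite /inner -rmorphD star_real unit.
  rewrite mulrBr expCD expCN; congr (_ * _).
  by rewrite -unit invf_div.
have -> : l = ((2^-1)%:C * ('i^-1 * (2%:R * 'i * l))).
  by rewrite fmorphV rmorph_nat; field; rewrite i0.
rewrite -h mulKf // mulrC -rmorphM.
done.
Qed.
End PhaseAndZeros.

(** * Distance of the zeros from the real axis *)

Section ZeroDepth.
Variable R : realType.
Local Notation C := R[i].
Implicit Types (x y t d c : R) (B E F G : C -> C) (z w : C).

(* Dividing the inner function by the Blaschke factor of its zero [i y]. *)
Lemma inner_blaschke f y : 0 < y ->
  (forall z, chp z -> \forall w \near z, cdiff f w) ->
  (forall z, chp z -> nrm (f z) <= 1) -> (forall t, nrm (f t%:C) = 1) -> f (y *i) = 0 ->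
  forall z, uhp z -> nrm (f z) * nrm (z + y *i) <= nrm (z - y *i).
Proof.
move=> y0 df f1 fu fy; have uy : uhp (y *i : C) by [].
have [q [fq dq]] := quotient0 (df _ (ltW uy)) fy.
pose g z := q z * (z + y *i).
have dg z : chp z -> cdiff g z.
  move=> cz; apply: cdiffM; first by apply: dq; exact: (nbhs_singleton (df z cz)).
  by apply: cdiffD; [exact: cdiff_id|exact: cdiff_cst].
have cg z : chp z -> cont g z by move=> /dg /cdiff_cont.
have fg z : nrm (f z) * nrm (z + y *i) = nrm (z - y *i) * nrm (g z).
  by rewrite fq /g !nrmM; ring.
have gt t : nrm (g t%:C) = 1.
  have h := fg t%:C; rewrite fu mul1r in h.
  have E : nrm (t%:C + y *i) = nrm (t%:C - y *i).
    by rewrite -nrm_conj; congr nrm; apply: complex_eqP; rewrite !ReIm /=; ring.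
  have n0 : 0 < nrm (t%:C - y *i).
    by apply: lt_le_trans (Im_le_nrm _); rewrite !ReIm /= normr_gt0 sub0r oppr_eq0 gt_eqF.
  by apply: (mulfI (lt0r_neq0 n0)); rewrite -h E mulr1.
have [e e0 He] := (nearC _ _).1 (cg _ (ltW uy) 1 ltr01).
(* Any finite bound will do: the half-plane principle improves it to 1, the modulus on the axis. *)
have gM z : uhp z -> nrm (g z) <= Num.max (nrm (g (y *i)) + 1) (1 + 2 * y / e).
  move=> uz; rewrite le_max; have [ze|ze] := ltP (nrm (z - y *i)) e; apply/orP; [left|right].
    by have := He z ze; have := nrm_sub (g z) (g (y *i)); lra.
  have z0 : 0 < nrm (z - y *i) by apply: lt_le_trans ze.
  rewrite -(ler_pM2l z0) -fg; apply: (@le_trans _ _ (nrm (z + y *i))).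
    by rewrite ler_piMl ?nrm_ge0 // f1 //; exact: ltW.
  have -> : z + y *i = (z - y *i) + (2 * y) *i by apply: complex_eqP; rewrite !ReIm /=; ring.
  apply: le_trans (nrmD _ _) _; rewrite mulrDr mulr1 lerD2l.
  have -> : nrm ((2 * y) *i : C) = 2 * y.
    have -> : (2 * y) *i = 'i * (2 * y)%:C :> C by apply: complex_eqP; rewrite !ReIm /=; ring.
    by rewrite nrmM nrmi mul1r nrmR gtr0_norm // mulr_gt0.
  by rewrite mulrA ler_pdivlMr // [leRHS]mulrC ler_wpM2l // mulr_ge0 // ltW.
have axg : axis_le g 1.
  move=> t d d0; apply: filterS (cg _ (chp_real t) d d0) => z h _.
  by have := nrm_sub (g z) (g t%:C); rewrite gt; lra.
move=> z uz; rewrite fg ler_piMr ?nrm_ge0 //.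
apply: (PL_half_plane2 _ axg ltr01 gM uz) => w uw; apply: dg; exact: ltW.
Qed.

Lemma inner_zero_depth f y tau : 0 < y ->
  (forall z, chp z -> \forall w \near z, cdiff f w) ->
  (forall z, chp z -> nrm (f z) <= 1) -> (forall t, nrm (f t%:C) = 1) -> f (y *i) = 0 ->
  f 0 = 1 -> isd f 0 ('i * tau%:C) -> 2 / y <= tau.
Proof.
move=> y0 df f1 fu fy f0 /isd_eps H; apply/ler_addgt0Pr => e e0.
have [d d0 dP] := H e e0; rewrite ler_pdivrMr //.
(* At the point i h the derivative gives |f| >= 1 - (tau + e) h, while the Blaschke factor gives |f|
   <= (y - h) / (y + h). *)
have key h : 0 < h -> h < d -> h < y -> 2 <= (tau + e) * (y + h).
  move=> h0 hd hy; have nh (s : R) : nrm (s *i : C) = `|s|.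
    have -> : s *i = 'i * s%:C :> C by apply: complex_eqP; rewrite !ReIm /=; ring.
    by rewrite nrmM nrmi mul1r nrmR.
  have := dP (h *i); rewrite subr0 nh gtr0_norm // f0 => /(_ hd) k1.
  have k2 := le_trans (Re_le_nrm _) k1; rewrite !ReIm /= ler_norml in k2.
  have k3 : 1 - (tau + e) * h <= nrm (f (h *i)).
    apply: le_trans (le_trans (ler_norm _) (Re_le_nrm _)).
    by case/andP: k2 => k2 _; lra.
  have := inner_blaschke y0 df f1 fu fy (z := h *i) h0.
  have -> : h *i + y *i = (h + y) *i :> C by apply: complex_eqP; rewrite !ReIm /=; ring.
  have -> : h *i - y *i = (h - y) *i :> C by apply: complex_eqP; rewrite !ReIm /=; ring.
  rewrite !nh [`|h - y|]distrC (@gtr0_norm _ (h + y)) ?addr_gt0 // (@gtr0_norm _ (y - h)) ?subr_gt0 // => k4.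
  have k5 : (1 - (tau + e) * h) * (h + y) <= y - h.
    by apply: le_trans (ler_wpM2r _ k3) _; [rewrite addr_ge0 ?ltW|lra].
  by rewrite -(ler_pM2l h0); lra.
apply/ler_addgt0Pr => e2 e20.
pose k := e2 / (1 + `|tau + e|); have a1 : 0 < 1 + `|tau + e| by rewrite ltr_pwDl.
have k0 : 0 < k by rewrite divr_gt0.
pose h := Num.min (Num.min d y) k / 2.
have m0 : 0 < Num.min (Num.min d y) k by rewrite !lt_min d0 y0.
have [m1 [m2 m3]] : h < d /\ h < y /\ h <= k.
  have h1 : Num.min (Num.min d y) k <= Num.min d y by rewrite ge_min lexx.
  have h2 : Num.min (Num.min d y) k <= k by rewrite ge_min lexx orbT.
  have h3 : Num.min d y <= d by rewrite ge_min lexx.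
  have h4 : Num.min d y <= y by rewrite ge_min lexx orbT.
  by rewrite /h; split; [|split]; lra.
have h0 : 0 < h by rewrite divr_gt0.
apply: le_trans (key h h0 m1 m2) _; rewrite mulrDr lerD2l.
apply: (@le_trans _ _ (`|tau + e| * k)).
  by apply: le_trans (ler_wpM2r (ltW h0) (ler_norm _)) _; rewrite ler_wpM2l.
by rewrite /k mulrA ler_pdivrMr // mulrC ler_wpM2l ?(ltW e20) // lerDr.
Qed.

End ZeroDepth.

Unset Implicit Arguments.

Theorem proposition6 (R : realType) (E phi : R[i] -> R[i]) (nu : nat) (D : R)
    (hE : hermite_biehler E) (hphi : is_phase E phi) (hnu : (2 <= nu)%N)
    (hbdd : bounded_differentiation (fun z => E z ^+ nu))
    (hD : D = differentiation_norm (fun z => E z ^+ nu)) :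
  (forall x : R, derive1 phi x%:C <= (D * Num.sqrt nu%:R)%:C) /\
  (forall x y : R, E (x -i* y) = 0 -> 1 / (D * Num.sqrt nu%:R) <= y).
Proof.
case: nu hnu hbdd hD => [|[|m]] // _ hbdd hD.
have E0 x : E x%:C != 0 by case: hbdd => h _; exact: (no_real_zero x hE h).
have hbE := hermite_biehler_hb hE E0.
split=> [x|x y Exy].
  have [tau dT] := inner_isd x hbE.
  rewrite (phase_derivative hbE hphi dT) lecR.
  by have := inner_derivative_le hbE hbdd hD dT; lra.
(* y = 0 would be a real zero, and y < 0 a zero in the upper half-plane. *)
have y0 : 0 < y.
  rewrite ltNge le_eqVlt; apply/negP => /orP[/eqP y0|y0].
    by have := E0 x; rewrite -[x%:C]/(x +i* 0) -[0]oppr0 -y0 Exy eqxx.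
  have := hermite_biehler_neq0 hE (z := x -i* y).
  by rewrite Exy eqxx /uhp /= oppr_gt0 => /(_ y0).
have [tau dT] := inner_isd x hbE.
have Ty : inner E x (y *i) = 0.
  rewrite /inner /star; have -> : (y *i + x%:C)^* = x -i* y.
    by apply: complex_eqP => /=; ring.
  by rewrite Exy rmorph0 !mul0r.
have h1 := inner_zero_depth y0 (inner_cdiff hbE x) (inner_le1 hbE x) (inner_unit hbE x) Ty (inner0 hbE x) dT.
have h2 := inner_derivative_le hbE hbdd hD dT.
set s := D * _ in h2 *.
have h3 : 2 / y <= 2 * s by apply: le_trans h1 h2.
rewrite ler_pdivrMr // in h3.
(* Positivity of D sqrt(nu) follows from the existence of the zero itself, through 2 <= 2 s y. *)
have s0 : 0 < s by rewrite -(pmulr_lgt0 _ y0); lra.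
by rewrite ler_pdivrMr //; lra.
Qed.
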